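(* Let $G_n\sim\mathcal G(n,q_n)$ be an Erdős–Rényi random graph with $q_n\in(0,1)$, let $H$ be a connected graph, and let $p_n\in(0,\tfrac1{20}]$ be the sampling ratio (vertex sampling independent of $G_n$). Then: (a) If $np_nq_n^{m(H)}\to\infty$, then $\hat N(H,G_n)$ is consistent for $N(H,G_n)$, $Z(H,G_n)\to N(0,1)$ in distribution, and $$\mathrm{Wass}(Z(H,G_n),N(0,1))=O_P\big((np_nq_n^{m(H)})^{-1/2}\big),$$ where the Wasserstein distance is computed conditionally on $G_n$. (b) If $np_nq_n^{m(H)}=O(1)$, then $\hat N(H,G_n)$ is not consistent for $N(H,G_n)$, and $Z(H,G_n)$ is not asymptotically normal.
   Context: $\mathcal G(n,q)$: random graph on $\{1,\dots,n\}$ with each edge present independently with probability $q$. $H=(V(H),E(H))$ connected, $|Aut(H)|$ its automorphisms; $m(H)=\max_{H_1\subseteq H}\frac{|E(H_1)|}{|V(H_1)|}$, maximum over nonempty subgraphs. With adjacency $(a_{ij})$ of $G_n$, $V(G_n)_k$ the $k$-tuples of distinct vertices, $M_H(\mathbf s)=\prod_{(i,j)\in E(H)}a_{s_is_j}$, $N(H,G_n)=\frac1{|Aut(H)|}\sum_{\mathbf s\in V(G_n)_{|V(H)|}}M_H(\mathbf s)$. Given $G_n$, $\{X_v\}$ i.i.d. Bernoulli$(p_n)$, $X_{\mathbf s}=\prod_uX_{s_u}$, $T(H,G_n)=\frac1{|Aut(H)|}\sum_{\mathbf s}M_H(\mathbf s)X_{\mathbf s}$, $\hat N(H,G_n)=p_n^{-|V(H)|}T(H,G_n)$,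 $\sigma(H,G_n)^2=\mathrm{Var}[T(H,G_n)\mid G_n]$, $Z(H,G_n)=(T(H,G_n)-p_n^{|V(H)|}N(H,G_n))/\sigma(H,G_n)$. Consistency: $\hat N/N\to1$ in probability; asymptotic normality: $Z\to N(0,1)$ in distribution. $X_n=O_P(a_n)$ means $X_n/a_n$ is stochastically bounded. *)

(* Defs.v *)
From HB Require Import structures.
From mathcomp Require Import all_boot all_order all_algebra.
From mathcomp Require Import fingroup perm.
From mathcomp Require Import all_classical all_reals all_analysis.
Set Implicit Arguments.
Unset Strict Implicit.
Unset Printing Implicit Defensive.
Import Order.TTheory GRing.Theory Num.Theory.
Import numFieldNormedType.Exports.

Local Open Scope ring_scope.

Definition edgesH (k : nat) (e : rel 'I_k) : {set 'I_k * 'I_k} :=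
  [set uv : 'I_k * 'I_k | e uv.1 uv.2 && (uv.1 < uv.2)%N].

Definition autH (k : nat) (e : rel 'I_k) : {set {perm 'I_k}} :=
  [set s : {perm 'I_k} | [forall u, forall v, e (s u) (s v) == e u v]].

Definition m_density (R : realType) (k : nat) (e : rel 'I_k) : R :=
  \big[Num.max/0]_(VE : {set 'I_k} * {set 'I_k * 'I_k} |
        [&& (0 < #|VE.1|)%N, VE.2 \subset edgesH e &
            [forall uv in VE.2, (uv.1 \in VE.1) && (uv.2 \in VE.1)]])
     (#|VE.2|%:R / #|VE.1|%:R).

Definition upper (n : nat) : {set 'I_n * 'I_n} := [set ij : 'I_n * 'I_n | (ij.1 < ij.2)%N].

Definition adj (n : nat) (E : {set 'I_n * 'I_n}) (i j : 'I_n) : bool :=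
  ((i, j) \in E) || ((j, i) \in E).

Definition er_weight (R : realType) (n : nat) (q : R) (E : {set 'I_n * 'I_n}) : R :=
  if E \subset upper n then
    \prod_(ij in upper n) (if ij \in E then q else 1 - q)
  else 0.

Definition samp_weight (R : realType) (n : nat) (p : R) (X : {ffun 'I_n -> bool}) : R :=
  \prod_(v : 'I_n) (if X v then p else 1 - p).

Definition MH (R : realType) (k : nat) (e : rel 'I_k) (n : nat)
    (E : {set 'I_n * 'I_n}) (s : {ffun 'I_k -> 'I_n}) : R :=
  \prod_(uv in edgesH e) ((adj E (s uv.1) (s uv.2))%:R : R).

Definition Xs (R : realType) (k n : nat) (X : {ffun 'I_n -> bool})
    (s : {ffun 'I_k -> 'I_n}) : R :=
  \prod_(u : 'I_k) ((X (s u))%:R : R).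

Definition Ncount (R : realType) (k : nat) (e : rel 'I_k) (n : nat)
    (E : {set 'I_n * 'I_n}) : R :=
  (#|autH e|%:R)^-1 * \sum_(s : {ffun 'I_k -> 'I_n} | injectiveb s) MH R e E s.

Definition Tcount (R : realType) (k : nat) (e : rel 'I_k) (n : nat)
    (E : {set 'I_n * 'I_n}) (X : {ffun 'I_n -> bool}) : R :=
  (#|autH e|%:R)^-1 *
    \sum_(s : {ffun 'I_k -> 'I_n} | injectiveb s) MH R e E s * Xs R X s.

Definition Nhat (R : realType) (p : R) (k : nat) (e : rel 'I_k) (n : nat)
    (E : {set 'I_n * 'I_n}) (X : {ffun 'I_n -> bool}) : R :=
  p ^- k * Tcount R e E X.

Definition condE (R : realType) (n : nat) (p : R) (f : {ffun 'I_n -> bool} -> R) : R :=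
  \sum_(X : {ffun 'I_n -> bool}) samp_weight p X * f X.

Definition sigma2 (R : realType) (p : R) (k : nat) (e : rel 'I_k) (n : nat)
    (E : {set 'I_n * 'I_n}) : R :=
  condE p (fun X => Tcount R e E X ^+ 2) - (condE p (fun X => Tcount R e E X)) ^+ 2.

Definition Zstat (R : realType) (p : R) (k : nat) (e : rel 'I_k) (n : nat)
    (E : {set 'I_n * 'I_n}) (X : {ffun 'I_n -> bool}) : R :=
  (Tcount R e E X - p ^+ k * Ncount R e E) / Num.sqrt (sigma2 p e E).

Definition Prob (R : realType) (n : nat) (q p : R)
    (A : pred ({set 'I_n * 'I_n} * {ffun 'I_n -> bool})) : R :=
  \sum_(w | A w) er_weight q w.1 * samp_weight p w.2.

Definition statistic (R : realType) :=
  forall n : nat, {set 'I_n * 'I_n} -> {ffun 'I_n -> bool} -> R.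

Definition cvg_in_prob (R : realType) (q p : nat -> R) (Y : statistic R) (c : R) :=
  forall eps : R, 0 < eps ->
    ((fun n => Prob (q n) (p n) (fun w => eps < `|Y n w.1 w.2 - c|)) @ \oo --> 0)%classic.

Definition std_normal_cdf (R : realType) (x : R) : R :=
  fine (normal_prob 0 1 (`]-oo, x])%classic).

(* Y_n -> N(0,1) in distribution (cdf convergence at every point, the
   standard normal cdf being continuous) *)
Definition cvg_in_dist_std_normal (R : realType) (q p : nat -> R) (Y : statistic R) :=
  forall x : R,
    ((fun n => Prob (q n) (p n) (fun w => Y n w.1 w.2 <= x)) @ \oo --> std_normal_cdf x)%classic.

Definition wass_cond (R : realType) (n : nat) (p : R)
    (Zg : {ffun 'I_n -> bool} -> R) : \bar R :=
  ereal_sup ([set r | exists h : R -> R,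
     (forall x y : R, `|h x - h y| <= `|x - y|) /\
     r = abse ((condE p (fun X => h (Zg X)))%:E
               - (\int[normal_prob (0:R) 1]_x (h x)%:E))%E ])%classic.

Definition stoch_bigO (R : realType) (q p : nat -> R)
    (W : forall n : nat, {set 'I_n * 'I_n} -> \bar R) (a : nat -> R) :=
  forall eps : R, 0 < eps -> exists M : R,
    (\forall n \near \oo,
      Prob (q n) (p n) (fun w => ((M * a n)%:E < abse (W n w.1))%E) <= eps)%classic.

Definition lambda (R : realType) (k : nat) (e : rel 'I_k) (q p : nat -> R) (n : nat) : R :=
  n%:R * p n * q n `^ m_density R e.

(* Main.v *)
Require Import Defs.
From HB Require Import structures.
From mathcomp Require Import all_boot all_order all_algebra.
From mathcomp Require Import fingroup perm.
From mathcomp Require Import zify ring lra.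
From mathcomp Require Import all_classical all_reals all_analysis.
From mathcomp Require Import measurable_realfun.
Import Order.TTheory GRing.Theory Num.Theory.
Import numFieldNormedType.Exports.
Set Implicit Arguments.
Unset Strict Implicit.
Local Open Scope classical_set_scope.
Local Open Scope ring_scope.

(** Given the graph, the centred count is a sum over embedded copies of H in which copies without a
    common vertex are independent, so Stein's method bounds the Wasserstein distance by
    S3 / sigma^3, where S3 sums p^|s u t u u| over triples of overlapping copies.

    For a subgraph K put psi_K = (n p)^v(K) q^e(K), and let Psi be its minimum over K. Revealing the
    copies of a triple one after the other gives E S3 <= C psi_H^3 / Psi^2, E sigma^2 <= C psi_H^2 / Psi,
    and, for p = 1, the variance of N. Restricting copies of H to the minimising K and applying
    Cauchy-Schwarz gives sigma^2 >= c psi_H^2 / Psi with high probability, so the bound is of order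
    Psi^(-1/2), and Psi >= n p q^m.

    If n p q^m stays bounded, apply the Harris inequality to the copies of the densest subgraph: T = 0
    with probability bounded below, which rules out consistency. As for normality, if n q^m is small
    then N = 0, hence Z = 0, with probability bounded below; if n q^m is large then p^k N / sigma is
    bounded with high probability, and so is Z from below. *)

(** * Product Bernoulli measures *)

Section BernoulliProduct.
Variables (R : realType) (I : finType).
Implicit Types (pr : I -> R) (x y : {ffun I -> bool}) (A : {set I}).

(** The exponent -1/2 is what remains of [psi_H ^ 3 / Psi ^ 2] over [(psi_H ^ 2 / Psi) ^ (3/2)], so
    the triple sum and the variance have to be measured against the same minimum [Psi]. The
    minimising K varies with n, p and q and may differ from the densest subgraph; density enters
    through q^e(K) >= q^(m v(K)), hence psi_K >= (n p q^m)^v(K) >= n p q^m as soon as n p q^m >= 1.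
    The bound S3 / sigma^3 is a quotient of dependent random variables, so its expectation is never
    taken. Markov's inequality (for S3 and for the copies of K) and Chebyshev's inequality (for the
    copies of H) isolate an exceptional set of graphs, outside which the bound is deterministic; its
    constant depends on the probability conceded to that set, which is exactly what O_P allows.
    Since p <= 1/20, the factor 1 - p is bounded below, and sigma^2 is comparable to the sum of p^|s
    u t| over overlapping pairs. Expectations over graphs and samples are finite sums against
    product weights; integrals appear only for the normal law. *)

Definition bern_weight pr x : R := \prod_i (if x i then pr i else 1 - pr i).

Definition bern_E pr (f : {ffun I -> bool} -> R) : R :=
  \sum_x bern_weight pr x * f x.

Definition mix A x y : {ffun I -> bool} := [ffun i => if i \in A then x i else y i].

Definition all_on A x : R := (\prod_(i in A) (x i : nat))%:R.

Lemma all_onE A x : all_on A x = [forall i in A, x i]%:R.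
Proof.
rewrite /all_on; congr (_%:R).
case: (boolP [forall i in A, x i]) => [/forall_inP h|].
  by rewrite big1 // => i iA; rewrite h.
rewrite negb_forall_in => /exists_inP[i iA /negbTE xi].
by rewrite (bigD1 i) //= xi mul0n.
Qed.

Lemma all_on_prod A x : all_on A x = \prod_(i in A) (x i)%:R.
Proof. by rewrite /all_on natr_prod. Qed.

Lemma all_on_01 A x : 0 <= all_on A x <= 1.
Proof. by rewrite all_onE; have [_|_] := boolP [forall i in A, x i]; rewrite /= ?lexx ?ler01. Qed.

Lemma all_onU A B x : all_on (A :|: B) x = all_on A x * all_on B x.
Proof.
rewrite !all_onE -natrM mulnb; congr (_%:R); congr nat_of_bool.
apply/forall_inP/andP => [h|[/forall_inP hA /forall_inP hB] i].
  by split; apply/forall_inP => i iA; apply: h; rewrite inE iA ?orbT.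
by rewrite inE => /orP[/hA|/hB].
Qed.

Lemma bern_E_sum pr (J : Type) (r : seq J) (P : pred J) (F : J -> {ffun I -> bool} -> R) :
  bern_E pr (fun x => \sum_(j <- r | P j) F j x) = \sum_(j <- r | P j) bern_E pr (F j).
Proof.
rewrite /bern_E exchange_big /=; apply: eq_bigr => x _; exact: mulr_sumr.
Qed.

Lemma bern_EZ pr c f : bern_E pr (fun x => c * f x) = c * bern_E pr f.
Proof. by rewrite /bern_E mulr_sumr; apply: eq_bigr => x _; rewrite mulrCA. Qed.

Lemma bern_EZr pr c f : bern_E pr (fun x => f x * c) = bern_E pr f * c.
Proof. by rewrite /bern_E mulr_suml; apply: eq_bigr => x _; rewrite mulrA. Qed.

Lemma bern_ED pr f g : bern_E pr (fun x => f x + g x) = bern_E pr f + bern_E pr g.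
Proof. by rewrite /bern_E -big_split; apply: eq_bigr => x _ /=; rewrite mulrDr. Qed.

Lemma bern_EN pr f : bern_E pr (fun x => - f x) = - bern_E pr f.
Proof. by rewrite /bern_E -sumrN; apply: eq_bigr => x _ /=; rewrite mulrN. Qed.

Lemma bern_EB pr f g : bern_E pr (fun x => f x - g x) = bern_E pr f - bern_E pr g.
Proof. by rewrite bern_ED bern_EN. Qed.

Lemma eq_bern_E pr f g : f =1 g -> bern_E pr f = bern_E pr g.
Proof. by move=> fg; apply: eq_bigr => x _; rewrite fg. Qed.

Lemma bern_E1 pr : bern_E pr (fun=> 1) = 1.
Proof.
rewrite /bern_E; under eq_bigr do rewrite mulr1.
rewrite /bern_weight -(bigA_distr_bigA (fun i (b : bool) => if b then pr i else 1 - pr i)).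
by rewrite big1 // => i _; rewrite big_bool /= addrC subrK.
Qed.

Lemma bern_E_cst pr c : bern_E pr (fun=> c) = c.
Proof.
by rewrite -[RHS]mulr1 -(bern_E1 pr) -bern_EZ; apply: eq_bern_E => x; rewrite mulr1.
Qed.

Lemma mixK A x y : mix A (mix A x y) (mix A y x) = x.
Proof. by apply/ffunP => i; rewrite !ffunE; case: (i \in A). Qed.

Lemma bern_weight_mix pr A x y :
  bern_weight pr (mix A x y) * bern_weight pr (mix A y x) = bern_weight pr x * bern_weight pr y.
Proof.
rewrite /bern_weight -!big_split; apply: eq_bigr => i _; rewrite /= !ffunE.
by case: (i \in A) => //; rewrite mulrC.
Qed.

(* Swapping the coordinates outside [A] preserves the law of two independent copies. *)
Lemma bern_E_mix pr A (G : {ffun I -> bool} -> {ffun I -> bool} -> R) :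
  bern_E pr (fun x => bern_E pr (fun y => G (mix A x y) (mix A y x))) =
  bern_E pr (fun x => bern_E pr (fun y => G x y)).
Proof.
rewrite /bern_E; under eq_bigr do rewrite mulr_sumr.
rewrite pair_bigA /=.
under [RHS]eq_bigr do rewrite mulr_sumr.
rewrite [RHS]pair_bigA /=.
pose sw (u : {ffun I -> bool} * {ffun I -> bool}) := (mix A u.1 u.2, mix A u.2 u.1).
have swK : involutive sw by case=> x y; rewrite /sw /= !mixK.
rewrite [RHS](reindex_inj (inv_inj swK)) /=.
by apply: eq_bigr => -[x y] _ /=; rewrite !mulrA bern_weight_mix.
Qed.

(** Dependence on coordinates is expressed through [mix]: [f] ignores those outside [A], [g] those
    inside. The product of expectations is one over two independent copies, and swapping coordinates
    brings both arguments back to the same copy. *)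
Lemma bern_E_indep pr A f g :
  (forall x y, f (mix A x y) = f x) -> (forall x y, g (mix A y x) = g x) ->
  bern_E pr (fun x => f x * g x) = bern_E pr f * bern_E pr g.
Proof.
move=> fA gA.
have -> : bern_E pr f * bern_E pr g = bern_E pr (fun x => bern_E pr (fun y => f x * g y)).
  by rewrite -bern_EZr; apply: eq_bern_E => x; rewrite bern_EZ.
rewrite -(bern_E_mix pr A); under [RHS]eq_bern_E do under eq_bern_E do rewrite fA.
have h x y : g (mix A y x) = g x by rewrite gA.
under [RHS]eq_bern_E do under eq_bern_E do rewrite h.
by under [RHS]eq_bern_E do rewrite bern_E_cst.
Qed.

Lemma bern_E_all_on pr A : bern_E pr (all_on A) = \prod_(i in A) pr i.
Proof.
have -> : bern_E pr (all_on A) = bern_E pr (fun x => \prod_i (if i \in A then (x i)%:R else 1)).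
  by apply: eq_bern_E => x; rewrite all_on_prod big_mkcond.
transitivity (\sum_(x : {ffun I -> bool}) \prod_i ((if x i then pr i else 1 - pr i) *
   (if i \in A then (x i : nat)%:R else 1))).
  by apply: eq_bigr => x _; rewrite big_split.
rewrite -(bigA_distr_bigA (fun i (b : bool) => (if b then pr i else 1 - pr i) *
   (if i \in A then (b : nat)%:R else 1))) /= [RHS]big_mkcond.
by apply: eq_bigr => i _; rewrite big_bool /=; case: (i \in A); ring.
Qed.

Variable pr : I -> R.
Hypothesis pr01 : forall i, 0 <= pr i <= 1.

Lemma bern_weight_ge0 x : 0 <= bern_weight pr x.
Proof.
apply: prodr_ge0 => i _; case/andP: (pr01 i) => h1 h2.
by case: ifP; rewrite ?subr_ge0.
Qed.

Lemma le_bern_E f g : (forall x, f x <= g x) -> bern_E pr f <= bern_E pr g.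
Proof.
by move=> fg; apply: ler_sum => x _; rewrite ler_wpM2l ?bern_weight_ge0.
Qed.

Lemma bern_E_ge0 f : (forall x, 0 <= f x) -> 0 <= bern_E pr f.
Proof. by move=> f0; rewrite -(bern_E_cst pr 0); apply: le_bern_E. Qed.

Lemma norm_bern_E f : `|bern_E pr f| <= bern_E pr (fun x => `|f x|).
Proof.
rewrite ler_norml -bern_EN; apply/andP; split; apply: le_bern_E => x.
  by rewrite lerNl -normrN ler_norm.
exact: ler_norm.
Qed.

Definition antitone (g : {ffun I -> bool} -> R) :=
  forall x y, (forall i, x i -> y i) -> g y <= g x.

(** Resampling the coordinates of [A] inside [g] decouples the two factors. Where [all_on A x]
    holds, the resampled configuration lies below [x], so [g] can only increase. *)
Lemma bern_E_antitone_all_on A g : antitone g ->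
  bern_E pr (fun x => all_on A x * g x) <= bern_E pr (all_on A) * bern_E pr g.
Proof.
move=> gd.
have -> : bern_E pr (all_on A) * bern_E pr g =
    bern_E pr (fun x => bern_E pr (fun y => all_on A x * g y)).
  by rewrite -bern_EZr; apply: eq_bern_E => x; rewrite bern_EZ.
rewrite -(bern_E_mix pr A) /=.
apply: le_bern_E => x; rewrite -[leLHS](bern_E_cst pr); apply: le_bern_E => y.
have -> : all_on A (mix A x y) = all_on A x.
  by rewrite !all_on_prod; apply: eq_bigr => i iA; rewrite ffunE iA.
rewrite [all_on A x]all_onE; have [/forall_inP h|_] := boolP [forall i in A, x i]; rewrite ?mul0r // !mul1r.
by apply: gd => i; rewrite ffunE; case: ifP => [/h|].
Qed.

(** Factors are peeled off one at a time, the remaining product being antitone. The weights [a] make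
    the inequality iterable: vertex sampling in a fixed graph uses edge indicators as weights and
    leaves a product of the same shape over graphs, with a power of [p] as weight. *)
Lemma bern_harris (J : Type) (r : seq J) (a : J -> R) (B : J -> {set I}) :
  (forall j, 0 <= a j <= 1) ->
  \prod_(j <- r) (1 - a j * \prod_(i in B j) pr i) <=
  bern_E pr (fun x => \prod_(j <- r) (1 - a j * all_on (B j) x)).
Proof.
move=> a01.
have fac01 j x : 0 <= 1 - a j * all_on (B j) x.
  have /andP[a0 a1] := a01 j; have /andP[h0 h1] := all_on_01 (B j) x.
  by rewrite subr_ge0 mulr_ile1.
have fac0 j : 0 <= 1 - a j * \prod_(i in B j) pr i.
  have /andP[a0 a1] := a01 j; rewrite subr_ge0 mulr_ile1 ?prodr_ge0 //.
    by move=> i _; case/andP: (pr01 i).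
  by apply: prodr_ile1 => i _; apply: pr01.
elim: r => [|j r IH].
  by rewrite big_nil; under eq_bern_E do rewrite big_nil; rewrite bern_E1.
rewrite big_cons; under eq_bern_E do rewrite big_cons.
set g := fun x => \prod_(j0 <- r) (1 - a j0 * all_on (B j0) x) in IH *.
apply: (le_trans (ler_wpM2l (fac0 _) IH)).
have gd : antitone g.
  move=> x y xy; apply: ler_prod => l _; rewrite fac01 /= lerB // ler_wpM2l //.
    by case/andP: (a01 l).
  rewrite !all_on_prod; apply: ler_prod => i _; rewrite ler0n ler_nat.
  by have := xy i; case: (x i) => // ->.
have -> : bern_E pr (fun x => (1 - a j * all_on (B j) x) * g x) =
   bern_E pr g - a j * bern_E pr (fun x => all_on (B j) x * g x).
  by rewrite -bern_EZ -bern_EB; apply: eq_bern_E => x; ring.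
rewrite mulrBl mul1r lerB // -mulrA ler_wpM2l //; first by case/andP: (a01 j).
by apply: (le_trans (bern_E_antitone_all_on _ gd)); rewrite bern_E_all_on.
Qed.

End BernoulliProduct.

(** * Stein's method for dissociated sums *)

Definition overlap (I : finType) (A B : {set I}) : bool := [exists i in A, i \in B].

Lemma overlapF (I : finType) (A B : {set I}) i : ~~ overlap A B -> i \in A -> (i \in B) = false.
Proof. by move=> /exists_inPn h /h /negbTE. Qed.

Lemma overlapS (I : finType) (A B D : {set I}) : B \subset D -> overlap A B -> overlap A D.
Proof. by move=> /fintype.subsetP BD /exists_inP[i iA /BD iD]; apply/exists_inP; exists i. Qed.

Section DissociatedStein.
Variables (R : realType) (I : finType) (pr : I -> R).
Hypothesis pr01 : forall i, 0 <= pr i <= 1.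
Implicit Types (A B D : {set I}) (x y : {ffun I -> bool}).

Definition moment A : R := \prod_(i in A) pr i.

Lemma moment_ge0 A : 0 <= moment A.
Proof. by apply: prodr_ge0 => i _; case/andP: (pr01 i). Qed.

Lemma moment_le1 A : moment A <= 1.
Proof. by apply: prodr_ile1 => i _; apply: pr01. Qed.

(** The left side counts the common coordinates twice, and every factor is at most 1. *)
Lemma momentU_ge A B : moment A * moment B <= moment (A :|: B).
Proof.
have -> : moment (A :|: B) = moment A * moment (B :\: A).
  rewrite /moment (big_setID A) /=; congr (_ * _); apply: eq_bigl => i; rewrite !inE.
    by case: (i \in A); rewrite ?andbF ?andbT.
  by case: (i \in A).
rewrite ler_wpM2l ?moment_ge0 // {1}/moment (big_setID A) /= ler_piMl ?moment_ge0 //.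
exact: moment_le1.
Qed.

Definition centered A x : R := all_on R A x - moment A.

Lemma bern_E_centered A : bern_E pr (centered A) = 0.
Proof. by rewrite bern_EB bern_E_cst bern_E_all_on subrr. Qed.

Lemma norm_centered A x : `|centered A x| <= all_on R A x + moment A.
Proof.
rewrite /centered; have /andP[h0 _] := all_on_01 R A x; have := moment_ge0 A.
by rewrite ler_norml; lra.
Qed.

(** Opening every factor gives [2 ^+ size r] products of moments, each at most the moment of the
    union by [momentU_ge]. The constants 2, 4, 8 in the absolute moments below come from here. *)
Lemma bern_E_prod_bound D (r : seq {set I}) :
  bern_E pr (fun x => all_on R D x * \prod_(A <- r) (all_on R A x + moment A)) <=
  2 ^+ size r * moment (D :|: \big[@finset.setU I/@finset.set0 I]_(A <- r) A).
Proof.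
elim: r D => [|A r IH] D /=.
  under eq_bern_E do rewrite big_nil mulr1.
  by rewrite bern_E_all_on big_nil finset.setU0 expr0 mul1r.
have -> : bern_E pr (fun x => all_on R D x * \prod_(B <- A :: r) (all_on R B x + moment B)) =
   bern_E pr (fun x => all_on R (D :|: A) x * \prod_(B <- r) (all_on R B x + moment B)) +
   moment A * bern_E pr (fun x => all_on R D x * \prod_(B <- r) (all_on R B x + moment B)).
  rewrite -bern_EZ -bern_ED; apply: eq_bern_E => x; rewrite big_cons all_onU; ring.
rewrite big_cons exprS -mulrA [leRHS](_ : _ = 2 ^+ size r * moment (D :|: (A :|: \big[@finset.setU I/@finset.set0 I]_(j <- r) j))
   + 2 ^+ size r * moment (D :|: (A :|: \big[@finset.setU I/@finset.set0 I]_(j <- r) j))); last by ring.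
apply: lerD; first by rewrite finset.setUA; apply: IH.
apply: (le_trans (ler_wpM2l (moment_ge0 A) (IH D))).
rewrite mulrCA ler_wpM2l ?exprn_ge0 //.
by rewrite finset.setUCA; apply: momentU_ge.
Qed.

Lemma bern_E_norm_centered A : bern_E pr (fun x => `|centered A x|) <= 2 * moment A.
Proof.
have := bern_E_prod_bound (@finset.set0 I) [:: A]; rewrite big_seq1 finset.set0U /= expr1.
apply: le_trans; apply: le_bern_E => // x.
by rewrite big_seq1 all_onE; case: forall_inP => [_|[i]]; rewrite ?inE // mul1r norm_centered.
Qed.

Lemma bern_E_norm_centered2 A B :
  bern_E pr (fun x => `|centered A x * centered B x|) <= 4 * moment (A :|: B).
Proof.
have := bern_E_prod_bound (@finset.set0 I) [:: A; B]; rewrite !big_cons big_nil finset.setU0 finset.set0U /=.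
rewrite (_ : 2 ^+ 2 = 4 :> R); last by ring.
apply: le_trans; apply: le_bern_E => // x.
rewrite !big_cons big_nil mulr1 normrM all_onE; case: forall_inP => [_|[i]]; rewrite ?inE // mul1r.
by apply: ler_pM; rewrite ?norm_centered.
Qed.

Lemma bern_E_norm_centered3 A B D :
  bern_E pr (fun x => `|centered A x * centered B x * centered D x|) <= 8 * moment (A :|: B :|: D).
Proof.
have := bern_E_prod_bound (@finset.set0 I) [:: A; B; D]; rewrite !big_cons big_nil finset.setU0 finset.set0U finset.setUA /=.
rewrite (_ : 2 ^+ 3 = 8 :> R); last by ring.
apply: le_trans; apply: le_bern_E => // x.
rewrite !big_cons big_nil mulr1 !normrM all_onE; case: forall_inP => [_|[i]]; rewrite ?inE // mul1r mulrA.
by apply: ler_pM; rewrite ?mulr_ge0 ?norm_centered // ler_pM ?norm_centered.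
Qed.

Lemma centered_mix A B x y : A \subset B -> centered A (mix B x y) = centered A x.
Proof.
move=> AB; rewrite /centered !all_on_prod; congr (_ - _); apply: eq_bigr => i iA.
by rewrite ffunE (fintype.subsetP AB).
Qed.

Lemma centered_mixC A B x y : ~~ overlap A B -> centered A (mix B x y) = centered A y.
Proof.
move=> AB; rewrite /centered !all_on_prod; congr (_ - _); apply: eq_bigr => i iA.
by rewrite ffunE (overlapF AB).
Qed.

Variables (S : finType) (act : {set S}) (sup : S -> {set I}).
Implicit Types s t u : S.

Definition Wsum x : R := \sum_(s in act) centered (sup s) x.
(** The part of the sum that is independent of everything determined by the coordinates in [B]. *)
Definition Wfar B x : R := \sum_(s in act | ~~ overlap (sup s) B) centered (sup s) x.
Definition Wnear B x : R := \sum_(s in act | overlap (sup s) B) centered (sup s) x.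

Definition triple_sum : R :=
  \sum_(s in act) \sum_(t in act | overlap (sup t) (sup s))
  \sum_(u in act | overlap (sup u) (sup s :|: sup t)) moment (sup s :|: sup t :|: sup u).

Lemma Wsum_split B x : Wsum x = Wfar B x + Wnear B x.
Proof. by rewrite /Wsum (bigID (fun s => overlap (sup s) B)) addrC. Qed.

Lemma bern_E_Wfar B (g : {ffun I -> bool} -> R) (h : R -> R) :
  (forall x y, g (mix B x y) = g x) ->
  bern_E pr (fun x => g x * h (Wfar B x)) = bern_E pr g * bern_E pr (fun x => h (Wfar B x)).
Proof.
move=> gB; apply: (@bern_E_indep _ _ _ B) => // x y; congr h.
by apply: eq_bigr => s /andP[_ sB]; rewrite centered_mixC.
Qed.

Lemma bern_E_Wsum2 : bern_E pr (fun x => Wsum x ^+ 2) =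
  \sum_(s in act) \sum_(t in act | overlap (sup t) (sup s))
    bern_E pr (fun x => centered (sup s) x * centered (sup t) x).
Proof.
have -> : bern_E pr (fun x => Wsum x ^+ 2) =
  bern_E pr (fun x => \sum_(s in act) \sum_(t in act) centered (sup s) x * centered (sup t) x).
  by apply: eq_bern_E => x; rewrite expr2 /Wsum big_distrlr.
rewrite bern_E_sum; apply: eq_bigr => s _.
rewrite bern_E_sum (bigID (fun t => overlap (sup t) (sup s))) /= [X in _ + X]big1 ?addr0 // => t /andP[_ dst].
rewrite (@bern_E_indep _ _ _ (sup s)).
- by rewrite bern_E_centered mul0r.
- by move=> x y; rewrite centered_mix.
- by move=> x y; rewrite centered_mixC.
Qed.

Variables (phi dphi : R -> R) (L : R).
Hypothesis phi_taylor : forall a b, `|phi a - phi b - (a - b) * dphi a| <= L * (a - b) ^+ 2.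
Hypothesis dphi_lip : forall a b, `|dphi a - dphi b| <= L * `|a - b|.

Lemma stein_L_ge0 : 0 <= L.
Proof.
by have := phi_taylor 1 0; rewrite subr0 expr1n mulr1; apply: le_trans.
Qed.

(** Each centred indicator is independent of its far sum, so [phi] may be replaced by its increment
    from the far sum to the full sum. Expanding at the full sum leaves the pair terms with [dphi];
    the remainder is quadratic in the near sum and becomes a sum of third absolute moments. *)
Lemma stein_first_order :
  `|bern_E pr (fun x => Wsum x * phi (Wsum x)) -
    \sum_(s in act) \sum_(t in act | overlap (sup t) (sup s))
       bern_E pr (fun x => centered (sup s) x * centered (sup t) x * dphi (Wsum x))|
  <= 8 * L * triple_sum.
Proof.
have L0 := stein_L_ge0.
have -> : bern_E pr (fun x => Wsum x * phi (Wsum x)) =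
  \sum_(s in act) bern_E pr (fun x => centered (sup s) x * phi (Wsum x)).
  by rewrite -bern_E_sum; apply: eq_bern_E => x; rewrite -mulr_suml.
rewrite -sumrB; apply: (le_trans (ler_norm_sum _ _ _)).
rewrite /triple_sum mulr_sumr; apply: ler_sum => s sact.
rewrite -bern_E_sum.
have -> : bern_E pr (fun x => centered (sup s) x * phi (Wsum x)) -
   bern_E pr (fun x => \sum_(t in act | overlap (sup t) (sup s))
       centered (sup s) x * centered (sup t) x * dphi (Wsum x)) =
   bern_E pr (fun x => centered (sup s) x *
     (phi (Wsum x) - phi (Wfar (sup s) x) - (Wsum x - Wfar (sup s) x) * dphi (Wsum x))).
  (* A mean-zero factor times an independent one: this term can be subtracted at no cost. *)
  have h0 : bern_E pr (fun x => centered (sup s) x * phi (Wfar (sup s) x)) = 0.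
    by rewrite bern_E_Wfar ?bern_E_centered ?mul0r // => x y; rewrite centered_mix.
  rewrite -bern_EB -[LHS]subr0 -[X in _ - X]h0 -bern_EB; apply: eq_bern_E => x.
  rewrite -mulr_suml -mulr_sumr -/(Wnear (sup s) x) (_ : Wnear _ _ = Wsum x - Wfar (sup s) x); first by ring.
  by rewrite (Wsum_split (sup s)); ring.
apply: (le_trans (norm_bern_E pr01 _)).
have -> : 8 * L * \sum_(t in act | overlap (sup t) (sup s))
     \sum_(u in act | overlap (sup u) (sup s :|: sup t)) moment (sup s :|: sup t :|: sup u) =
   L * \sum_(t in act | overlap (sup t) (sup s))
     \sum_(u in act | overlap (sup u) (sup s :|: sup t)) 8 * moment (sup s :|: sup t :|: sup u).
  rewrite [8 * L]mulrC -mulrA; congr (_ * _); rewrite mulr_sumr; apply: eq_bigr => t _.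
  by rewrite mulr_sumr.
(* The remainder only produces [u] meeting [sup s]; they are among the [u] meeting [sup s :|: sup t]
   that [triple_sum] ranges over. *)
apply: (@le_trans _ _ (L * \sum_(t in act | overlap (sup t) (sup s))
     \sum_(u in act | overlap (sup u) (sup s))
       bern_E pr (fun x => `|centered (sup s) x * centered (sup t) x * centered (sup u) x|))); last first.
  rewrite ler_wpM2l //; apply: ler_sum => t _.
  rewrite [leRHS](bigID (fun u => overlap (sup u) (sup s))) /= -[leLHS]addr0 lerD //; last first.
    by apply: sumr_ge0 => u _; rewrite mulr_ge0 ?moment_ge0.
  rewrite [leLHS]big_mkcond [leRHS]big_mkcond; apply: ler_sum => u _.
  have -> : (u \in act) && overlap (sup u) (sup s :|: sup t) && overlap (sup u) (sup s) =
     (u \in act) && overlap (sup u) (sup s).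
    case: (u \in act) => //=; case: (boolP (overlap (sup u) (sup s))) => h; rewrite ?andbF // andbT.
    by apply: overlapS h; apply: finset.subsetUl.
  by case: ifP => // _; apply: bern_E_norm_centered3.
under eq_bigr do rewrite -bern_E_sum.
rewrite -bern_E_sum -bern_EZ; apply: le_bern_E => // x.
have -> : \sum_(t in act | overlap (sup t) (sup s)) \sum_(u in act | overlap (sup u) (sup s))
    `|centered (sup s) x * centered (sup t) x * centered (sup u) x| =
  `|centered (sup s) x| * (\sum_(t in act | overlap (sup t) (sup s)) `|centered (sup t) x|) ^+ 2.
  rewrite expr2 big_distrlr /= mulr_sumr; apply: eq_bigr => t _; rewrite mulr_sumr.
  by apply: eq_bigr => u _; rewrite !normrM mulrA.
rewrite normrM mulrCA ler_wpM2l //; apply: (le_trans (phi_taylor _ _)).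
rewrite ler_wpM2l // [X in X - _](Wsum_split (sup s)) [X in X ^+ 2](_ : _ = Wnear (sup s) x); last by ring.
rewrite -real_normK ?num_real // lerXn2r ?nnegrE ?sumr_ge0 //; exact: ler_norm_sum.
Qed.

(** Replacing the argument of [dphi] by the sum far from both supports makes it independent of the
    pair. The replacement is made in the joint expectation and in the product of expectations, each
    costing [8 * L] times the sum. *)
Lemma stein_second_order s t :
  `|bern_E pr (fun x => centered (sup s) x * centered (sup t) x * dphi (Wsum x)) -
    bern_E pr (fun x => centered (sup s) x * centered (sup t) x) * bern_E pr (fun x => dphi (Wsum x))|
  <= 16 * L * \sum_(u in act | overlap (sup u) (sup s :|: sup t)) moment (sup s :|: sup t :|: sup u).
Proof.
have L0 := stein_L_ge0.
set B := sup s :|: sup t; set g := fun x => centered (sup s) x * centered (sup t) x.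
have gB x y : g (mix B x y) = g x.
  by rewrite /g !centered_mix // /B ?finset.subsetUl ?finset.subsetUr.
have far := bern_E_Wfar dphi gB.
have dd x : `|dphi (Wsum x) - dphi (Wfar B x)| <=
    L * \sum_(u in act | overlap (sup u) B) `|centered (sup u) x|.
  apply: (le_trans (dphi_lip _ _)); rewrite ler_wpM2l // (Wsum_split B).
  rewrite addrAC subrr add0r; exact: ler_norm_sum.
have -> : bern_E pr (fun x => g x * dphi (Wsum x)) - bern_E pr g * bern_E pr (fun x => dphi (Wsum x)) =
    bern_E pr (fun x => g x * (dphi (Wsum x) - dphi (Wfar B x))) -
    bern_E pr g * bern_E pr (fun x => dphi (Wsum x) - dphi (Wfar B x)).
  rewrite bern_EB mulrBr -far.
  rewrite (_ : bern_E pr (fun x => g x * (dphi (Wsum x) - dphi (Wfar B x))) =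
     bern_E pr (fun x => g x * dphi (Wsum x)) - bern_E pr (fun x => g x * dphi (Wfar B x))); first by ring.
  by rewrite -bern_EB; apply: eq_bern_E => x; ring.
apply: (le_trans (ler_normB _ _)).
rewrite (_ : 16 = 8 + 8); last by ring.
rewrite -mulrA mulrDl; apply: lerD.
  apply: (le_trans (norm_bern_E pr01 _)).
  rewrite mulrCA mulr_sumr.
  apply: (@le_trans _ _ (L * \sum_(u in act | overlap (sup u) B)
     bern_E pr (fun x => `|centered (sup s) x * centered (sup t) x * centered (sup u) x|))); last first.
    by rewrite ler_wpM2l //; apply: ler_sum => u _; apply: bern_E_norm_centered3.
  rewrite -bern_E_sum -bern_EZ; apply: le_bern_E => // x.
  rewrite normrM; apply: (le_trans (ler_wpM2l (normr_ge0 _) (dd x))).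
  rewrite mulrCA ler_wpM2l // mulr_sumr; apply: ler_sum => u _.
  by rewrite /g [leRHS]normrM.
rewrite normrM.
apply: (@le_trans _ _ (4 * moment B * (L * \sum_(u in act | overlap (sup u) B) 2 * moment (sup u)))).
  apply: ler_pM => //.
    by apply: (le_trans (norm_bern_E pr01 _)); apply: bern_E_norm_centered2.
  apply: (le_trans (norm_bern_E pr01 _)).
  apply: (@le_trans _ _ (L * \sum_(u in act | overlap (sup u) B) bern_E pr (fun x => `|centered (sup u) x|))).
    by rewrite -bern_E_sum -bern_EZ; apply: le_bern_E.
  rewrite ler_wpM2l //; apply: ler_sum => u _; exact: bern_E_norm_centered.
rewrite mulrCA [leRHS]mulrCA ler_wpM2l // !mulr_sumr; apply: ler_sum => u _.
rewrite (_ : 4 * _ * _ = 8 * (moment B * moment (sup u))); last by ring.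
by rewrite ler_wpM2l //; apply: momentU_ge.
Qed.

(** The constant is 8 from the expansion plus 16 from decoupling the pairs, whose covariances add up
    to the variance by [bern_E_Wsum2]. *)
Lemma stein_dissociated :
  `|bern_E pr (fun x => Wsum x * phi (Wsum x)) -
    bern_E pr (fun x => Wsum x ^+ 2) * bern_E pr (fun x => dphi (Wsum x))| <= 24 * L * triple_sum.
Proof.
have h1 := stein_first_order.
set T1 := bern_E pr (fun x => Wsum x * phi (Wsum x)) in h1 *.
set T2 := \sum_(s in act) _ in h1.
have h2 : `|T2 - bern_E pr (fun x => Wsum x ^+ 2) * bern_E pr (fun x => dphi (Wsum x))|
   <= 16 * L * triple_sum.
  rewrite bern_E_Wsum2 mulr_suml /T2 -sumrB; apply: (le_trans (ler_norm_sum _ _ _)).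
  rewrite /triple_sum mulr_sumr; apply: ler_sum => s _.
  rewrite mulr_suml -sumrB; apply: (le_trans (ler_norm_sum _ _ _)).
  by rewrite mulr_sumr; apply: ler_sum => t _; apply: stein_second_order.
move: h1 h2; rewrite !ler_norml; lra.
Qed.

End DissociatedStein.

(** * The Stein equation for the standard normal law *)

Section GaussianIntegral.
Variable R : realType.
Local Notation mu := (@lebesgue_measure R).
Local Notation gauss := (normal_prob (0 : R) 1).

Definition gpdf (x : R) : R := normal_pdf 0 1 x.

Lemma gpdfE x : gpdf x = normal_peak (1 : R) * expR (- x ^+ 2 / 2).
Proof.
by rewrite /gpdf normal_pdfE ?oner_neq0 // /normal_fun subr0 expr1n.
Qed.

Lemma gpdf_gt0 x : 0 < gpdf x.
Proof. by rewrite gpdfE mulr_gt0 ?expR_gt0 // normal_peak_gt0 // oner_neq0. Qed.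

Lemma measurable_gpdf : measurable_fun setT gpdf.
Proof. exact: measurable_normal_pdf. Qed.

(** The Radon-Nikodym derivative of the normal law has the same integral as [gpdf] over every
    measurable set, hence equals it almost everywhere. *)
Lemma gauss_ge0_integral (f : R -> \bar R) : (forall x, (0 <= f x)%E) -> measurable_fun setT f ->
  (\int[gauss]_x f x = \int[mu]_x (f x * (gpdf x)%:E))%E.
Proof.
move=> f0 mf; have dom := normal_prob_dominates (0 : R) 1.
rewrite -(Radon_Nikodym_SigmaFinite.change_of_variables dom f0 measurableT mf).
apply: ae_eq_integral => //.
- apply: emeasurable_funM => //; apply: (measurable_int mu).
  exact: Radon_Nikodym_SigmaFinite.f_integrable.
- apply: emeasurable_funM => //; apply/measurable_EFinP; exact: measurable_gpdf.
- apply: ae_eqe_mul2l; apply: integral_ae_eq => //.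
  + exact: Radon_Nikodym_SigmaFinite.f_integrable.
  + by apply/measurable_EFinP; exact: measurable_gpdf.
  + by move=> E _ mE; rewrite -Radon_Nikodym_SigmaFinite.f_integral.
Qed.

Lemma gauss_integrableP (f : R -> R) : measurable_fun setT f ->
  mu.-integrable setT (EFin \o (fun x => f x * gpdf x)) <-> gauss.-integrable setT (EFin \o f).
Proof.
move=> mf; have mfg : measurable_fun setT (fun x => f x * gpdf x).
  by apply: measurable_funM => //; exact: measurable_gpdf.
have E : (\int[gauss]_x `|(f x)%:E| = \int[mu]_x `|(f x * gpdf x)%:E|)%E.
  rewrite gauss_ge0_integral //; last by do 2 apply: measurableT_comp => //; exact/measurable_EFinP.
  by apply: eq_integral => x _; rewrite /= -EFinM normrM [`|gpdf x|]ger0_norm // ltW // gpdf_gt0.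
split=> /integrableP[_ fin]; apply/integrableP; split; try exact/measurable_EFinP.
  by rewrite E.
by rewrite -E.
Qed.

Lemma gauss_integral (f : R -> R) : gauss.-integrable setT (EFin \o f) ->
  (\int[gauss]_x (f x)%:E = \int[mu]_x (f x * gpdf x)%:E)%E.
Proof.
move=> intf; have mf : measurable_fun setT f by apply/measurable_EFinP; case/integrableP: intf.
have ig := (gauss_integrableP mf).2 intf.
rewrite [LHS]integralE [RHS]integralE; congr (_ - _)%E.
  rewrite gauss_ge0_integral //; last first.
    by apply: measurable_funepos; exact/measurable_EFinP.
  apply: eq_integral => x _; rewrite !funeposE -EFin_max -EFinM -EFin_max; congr (_%:E).
  by rewrite maxr_pMl ?mul0r // ltW // gpdf_gt0.
rewrite gauss_ge0_integral //; last first.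
  by apply: measurable_funeneg; exact/measurable_EFinP.
apply: eq_integral => x _; rewrite !funenegE -!EFinN -!EFin_max -EFinM; congr (_%:E).
by rewrite maxr_pMl ?mul0r ?mulNr // ltW // gpdf_gt0.
Qed.

Lemma gauss_abs_integrable : gauss.-integrable setT (EFin \o (fun x : R => `|x|)).
Proof.
have mabs : measurable_fun setT (fun x : R => `|x|) by exact: measurableT_comp.
apply/gauss_integrableP => //.
have c0 : 0 < normal_peak (2 : R) by rewrite normal_peak_gt0 ?pnatr_eq0.
(* The dominating function is a multiple of the normal density with standard deviation 2; the spare
   factor exp(-3/8 x^2) absorbs |x|. *)
pose C : R := normal_peak 1 / normal_peak 2.
have C0 : 0 <= C by apply: divr_ge0; exact: normal_peak_ge0.
apply: (@le_integrable _ _ _ mu _ measurableT _ (EFin \o (fun x => C * normal_pdf 0 2 x))) => //.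
- by apply/measurable_EFinP; apply: measurable_funM => //; exact: measurable_gpdf.
- move=> x _; rewrite /= lee_fin [leLHS]ger0_norm ?mulr_ge0 ?(ltW (gpdf_gt0 _)) //.
  rewrite [leRHS]ger0_norm; last by apply: mulr_ge0 => //; exact: normal_pdf_ge0.
  rewrite gpdfE normal_pdfE ?pnatr_eq0 // /normal_fun subr0 /C.
  rewrite [leRHS]mulrA divfK ?gt_eqF // mulrCA; apply: ler_wpM2l; first exact: normal_peak_ge0.
  have -> : - x ^+ 2 / 2 = - (3 / 8 * x ^+ 2) + - x ^+ 2 / (2 ^+ 2 *+ 2) by field.
  rewrite expRD mulrA ler_piMl ?expR_ge0 // expRN ler_pdivrMr ?expR_gt0 // mul1r.
  apply: (@le_trans _ _ (1 + 3 / 8 * x ^+ 2)); last exact: expR_ge1Dx.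
  rewrite -(real_normK (num_real x)); have := sqr_ge0 (3 * `|x| - 4); lra.
- exact: (integrableZl measurableT C (integrable_normal_pdf 0 2)).
Qed.

Definition gabs : R := fine (\int[gauss]_x `|x|%:E).

Lemma gabsE : (\int[gauss]_x `|x|%:E = gabs%:E)%E.
Proof. by rewrite /gabs fineK //; apply: integrable_fin_num => //; exact: gauss_abs_integrable. Qed.

Lemma gabs_ge0 : 0 <= gabs.
Proof. by rewrite -lee_fin -gabsE; apply: integral_ge0 => x _; rewrite lee_fin. Qed.

Section Lipschitz.
Variable h : R -> R.
Hypothesis h_lip : forall x y, `|h x - h y| <= `|x - y|.

Lemma lip_continuous : continuous h.
Proof.
move=> x; apply/cvgrPdist_le => e e0; near=> t.
apply: (le_trans (h_lip _ _)); near: t.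
exact: cvgr_dist_le.
Unshelve. all: by end_near. Qed.

Lemma lip_measurable : measurable_fun setT h.
Proof. apply: continuous_measurable_fun; exact: lip_continuous. Qed.

Lemma lip_bound x : `|h x - h 0| <= `|x|.
Proof. by have := h_lip x 0; rewrite subr0. Qed.

Lemma lip_integrable : gauss.-integrable setT (EFin \o h).
Proof.
apply: (@le_integrable _ _ _ gauss _ measurableT _ (EFin \o (fun x => `|x| + `|h 0|))) => //.
- by apply/measurable_EFinP; exact: lip_measurable.
- move=> x _; rewrite /= lee_fin [leRHS]ger0_norm ?addr_ge0 //.
  have := lip_bound x; have := ler_normD (h x - h 0) (h 0); rewrite subrK; lra.
- rewrite (_ : EFin \o _ = fun x => (`|x|%:E + `|h 0|%:E)%E) //.
  apply: integrableD => //; first exact: gauss_abs_integrable.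
  by apply: finite_measure_integrable_cst.
Qed.

Definition gmean : R := fine (\int[gauss]_x (h x)%:E).

Lemma gmeanE : (\int[gauss]_x (h x)%:E = gmean%:E)%E.
Proof. by rewrite /gmean fineK //; apply: integrable_fin_num => //; exact: lip_integrable. Qed.

Lemma gauss_integral_cst (c : R) : (\int[gauss]_x c%:E = c%:E)%E.
Proof. by rewrite integral_cst // [X in (_ * X)%E]probability_setT mule1. Qed.

Lemma gmean_dist : `|h 0 - gmean| <= gabs.
Proof.
have icst c : gauss.-integrable setT (EFin \o (fun=> c : R)).
  exact: finite_measure_integrable_cst.
have iabs := gauss_abs_integrable.
have le1 : (\int[gauss]_x (h x)%:E <= \int[gauss]_x (h 0 + `|x|)%:E)%E.
  apply: le_integral => //; first exact: lip_integrable.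
    exact: (integrableD measurableT (icst (h 0)) iabs).
  by move=> x _; rewrite lee_fin; have := lip_bound x; rewrite ler_norml; lra.
have le2 : (\int[gauss]_x (h 0)%:E <= \int[gauss]_x (h x + `|x|)%:E)%E.
  apply: le_integral => //; first exact: icst.
    exact: (integrableD measurableT lip_integrable iabs).
  by move=> x _; rewrite lee_fin; have := lip_bound x; rewrite ler_norml; lra.
have e1 : (\int[gauss]_x (h 0 + `|x|)%:E = (h 0)%:E + gabs%:E)%E.
  rewrite -gabsE -[X in (_ = X + _)%E](gauss_integral_cst (h 0)).
  exact: (integralD measurableT (icst (h 0)) iabs).
have e2 : (\int[gauss]_x (h x + `|x|)%:E = gmean%:E + gabs%:E)%E.
  by rewrite -gabsE -gmeanE; exact: (integralD measurableT lip_integrable iabs).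
move: le1 le2; rewrite e1 e2 !gauss_integral_cst gmeanE -!EFinD !lee_fin ler_norml; lra.
Qed.

(** Divided by [gpdf], this is the standard solution of the Stein equation for [h]. *)
Definition stein_int (x : R) : R := (\int[mu]_(t in `]-oo, x]) ((h t - gmean) * gpdf t))%R.

Lemma integrable_centered : gauss.-integrable setT (EFin \o (fun x => h x - gmean)).
Proof.
rewrite (_ : EFin \o _ = fun x => ((h x)%:E - gmean%:E)%E) //.
apply: integrableB => //; first exact: lip_integrable.
exact: finite_measure_integrable_cst.
Qed.

Lemma measurable_centered : measurable_fun setT (fun x => h x - gmean).
Proof. by apply: measurable_funB => //; exact: lip_measurable. Qed.

Lemma integrable_steinf : mu.-integrable setT (EFin \o (fun t => (h t - gmean) * gpdf t)).
Proof.
apply/gauss_integrableP; first exact: measurable_centered.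
exact: integrable_centered.
Qed.

Lemma steinf_continuous : continuous (fun t => (h t - gmean) * gpdf t).
Proof.
move=> x; apply: cvgM; last by apply: continuous_normal_pdf; exact: oner_neq0.
by apply: cvgB; [exact: lip_continuous|exact: cvg_cst].
Qed.

Lemma is_derive_stein_int (x : R) : is_derive x (1 : R) stein_int ((h x - gmean) * gpdf x).
Proof.
have [] := @continuous_FTC1 R (fun t => (h t - gmean) * gpdf t) -oo%O x (x + 1).
- by rewrite ltrDl.
- by apply: (integrableS measurableT _ _ integrable_steinf).
- by rewrite ltNyr.
- exact: steinf_continuous.
by move=> d1 <-; rewrite derive1E; apply: derivableP.
Qed.

(** Covers both ends of the line by dominated convergence: [D] is the whole line for [a n] tending
    to +oo and empty for [a n] tending to -oo. *)
Lemma stein_int_dominated (a : nat -> R) (D : set R) : measurable D ->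
  (forall x, \forall n \near \oo, (x <= a n) = (x \in D)) ->
  (fun n => stein_int (a n)) @ \oo --> (\int[mu]_(t in D) ((h t - gmean) * gpdf t))%R.
Proof.
move=> mD aD; set g := fun t => (h t - gmean) * gpdf t.
have ig := integrable_steinf; rewrite -/g in ig.
have mg : measurable_fun setT g by apply/measurable_EFinP; case/integrableP: ig.
have dct := @dominated_convergence _ _ _ mu setT measurableT
  (fun n => EFin \o (g \_ `]-oo, a n])) (EFin \o (g \_ D)) (EFin \o (fun x => `|g x|)).
have h1 : (forall n, measurable_fun [set: R] (EFin \o g \_ `]-oo, a n])).
  move=> n; apply/measurable_EFinP; apply/(measurable_restrict _ _ _) => //.
  by rewrite setTI; exact: measurable_funTS.
have h2 : measurable_fun [set: R] (EFin \o g \_ D).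
  apply/measurable_EFinP; apply/(measurable_restrict _ _ _) => //.
  by rewrite setTI; exact: measurable_funTS.
have h3 : {ae mu, forall (x : R), [set: R] x -> (EFin \o g \_ `]-oo, a n]) x @[n --> \oo] --> (EFin \o g \_ D) x}.
  apply: aeW => x _; apply: cvg_near_cst.
  near=> n; rewrite /= !patchE; congr (_%:E).
  have <- : (x <= a n) = (x \in D) by near: n; exact: aD.
  by rewrite mem_setE in_itv.
have h4 : mu.-integrable [set: R] (EFin \o (fun x => `|g x|)).
  by have := integrable_norm ig.
have h5 : {ae mu, forall (x : R) (n : nat), [set: R] x -> (`|(EFin \o g \_ `]-oo, a n]) x| <= (EFin \o (fun y : R => `|g y|%R)) x)%E}.
  by apply: aeW => x n _; rewrite /= lee_fin patchE; case: ifP; rewrite ?normr0.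
have [igD _ hcvg] := dct h1 h2 h3 h4 h5.
rewrite Rintegral_mkcond.
have -> : (fun n => stein_int (a n)) = fine \o (fun n => \int[mu]_x (EFin \o g \_ `]-oo, a n]) x)%E.
  by apply/funext => n; rewrite /stein_int Rintegral_mkcond.
apply: fine_cvg; rewrite /Rintegral fineK; first exact: hcvg.
exact: integrable_fin_num igD.
Unshelve. all: by end_near. Qed.

Lemma stein_int_pinfty : (fun n : nat => stein_int n%:R) @ \oo --> (0 : R).
Proof.
(* The total integral vanishes because [gmean] is the normal mean of [h]; this makes the solution
   decay on the right as well. *)
have : (\int[mu]_(t in setT) ((h t - gmean) * gpdf t))%R = 0.
  rewrite /Rintegral -gauss_integral; last exact: integrable_centered.
  under eq_integral do rewrite EFinB.
  rewrite integralB //; [|exact: lip_integrable|exact: finite_measure_integrable_cst].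
  by rewrite gmeanE gauss_integral_cst -EFinB subrr.
move=> <-; apply: stein_int_dominated => // x; near=> n.
rewrite in_setT; near: n; exact: nbhs_infty_ger.
Unshelve. all: by end_near. Qed.

Lemma stein_int_ninfty : (fun n : nat => stein_int (- n%:R)) @ \oo --> (0 : R).
Proof.
rewrite -(Rintegral_set0 mu (fun t => (h t - gmean) * gpdf t)).
apply: stein_int_dominated => // x; near=> n.
rewrite in_set0; apply/negbTE; rewrite -ltNge ltrNl; near: n; exact: nbhs_infty_gtr.
Unshelve. all: by end_near. Qed.

End Lipschitz.
End GaussianIntegral.

(** * Solution of the Stein equation with Lipschitz derivative *)

Section SteinEquation.
Variable R : realType.
Local Notation gpdf := (@gpdf R).

Lemma MVT_is_derive (f df : R -> R) (a b : R) : a <= b ->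
  (forall x, a <= x <= b -> is_derive x (1 : R) f (df x)) ->
  exists2 c, a <= c <= b & f b - f a = df c * (b - a).
Proof.
move=> ab fdf; have [||c cab ->] := @MVT_segment R f df a b ab.
- by move=> x; rewrite in_itv /= => /andP[h1 h2]; apply: fdf; rewrite !ltW.
- apply: derivable_within_continuous => x; rewrite in_itv /= => xab.
  by have [] := fdf x xab.
by exists c; rewrite // in_itv in cab.
Qed.

Lemma is_derive_gpdf (x : R) : is_derive x (1 : R) gpdf (- x * gpdf x).
Proof.
have -> : gpdf = (fun x => normal_peak (1 : R) * expR (- x ^+ 2 / 2)).
  by apply/funext => y; exact: gpdfE.
have d1 : is_derive x (1 : R) (fun x : R => - x ^+ 2 / 2) (- x).
  by apply: is_derive_eq; rewrite /GRing.scale /=; field.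
have d2 := @is_derive1_comp R expR (fun x : R => - x ^+ 2 / 2) x _ _ (is_derive_expR (- x ^+ 2 / 2)) d1.
by apply: is_derive_eq; rewrite /GRing.scale /=; ring.
Qed.

Lemma gpdf_cvg0 : (fun n : nat => gpdf n%:R) @ \oo --> (0 : R).
Proof.
have P0 : 0 <= normal_peak (1 : R) by exact: normal_peak_ge0.
apply: (@squeeze_cvgr _ _ _ _ (fun=> 0) (fun n => normal_peak 1 * 2 * harmonic n)).
- apply: nearW => n; rewrite ltW ?gpdf_gt0 //= gpdfE -mulrA ler_wpM2l //.
  rewrite mulNr expRN -[leRHS]invrK lef_pV2 ?posrE ?expR_gt0 ?invr_gt0 ?mulr_gt0 ?harmonic_gt0 //.
  apply: le_trans (expR_ge1Dx _); rewrite /harmonic /= invfM invrK -[n.+1%:R]natr1.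
  have [->|n0] := posnP n; first by rewrite expr0n /=; lra.
  have : (1 : R) <= n%:R by rewrite ler1n.
  nra.
- exact: cvg_cst.
- rewrite -(mulr0 (normal_peak 1 * 2)); by apply: cvgM; [exact: cvg_cst|exact: cvg_harmonic].
Qed.

(** Both [V - U] and [V + U] are nonincreasing and eventually at least [- e] along the integers, so
    they are nonnegative at [a]. Tail estimates thus reduce to differentiating a guessed majorant
    [V]. *)
Lemma decay_comparison (U V dU dV : R -> R) (a : R) :
  (forall x, a <= x -> is_derive x (1 : R) U (dU x)) ->
  (forall x, a <= x -> is_derive x (1 : R) V (dV x)) ->
  (forall x, a <= x -> `|dU x| <= - dV x) ->
  (forall x, a <= x -> 0 <= V x) ->
  (fun n : nat => U n%:R) @ \oo --> (0 : R) -> `|U a| <= V a.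
Proof.
move=> derU derV dUV V0 Ulim.
apply/ler_addgt0Pr => e e0.
have [N _ hN] : \forall n \near \oo, `|U n%:R| <= e.
  have /cvgrPdist_le/(_ e e0) := Ulim.
  by apply: filterS => n; rewrite sub0r normrN.
have [m am] : exists m : nat, a <= m%:R.
  by exists (Num.bound `|a|); apply: (le_trans (ler_norm a)); apply/ltW/archi_boundP.
set b : R := (N + m)%:R.
have ab : a <= b by apply: (le_trans am); rewrite ler_nat leq_addl.
have Ub : `|U b| <= e by apply: hN; rewrite /= leq_addr.
have bnd (s : R) : `|s| = 1 -> s * U a <= V a + e.
  move=> s1.
  have [|c /andP[ac _] E] := @MVT_is_derive (fun x => V x - s * U x) (fun x => dV x - s * dU x) a b ab.
    move=> x /andP[ax _]; have := derU x ax; have := derV x ax => dv du.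
    by apply: is_derive_eq; rewrite /GRing.scale /=.
  have : (dV c - s * dU c) * (b - a) <= 0.
    apply: mulr_le0_ge0; last by rewrite subr_ge0.
    have := dUV c ac; have := ler_norm (- s * dU c); rewrite normrM normrN s1; lra.
  rewrite -E; have := V0 b ab; have := ler_norm (s * U b); rewrite normrM s1; lra.
have := bnd 1 (normr1 _); have := bnd (-1) (normrN1 _); rewrite ler_norml; lra.
Qed.

(** Transfers the bounds on the positive axis to the negative one. *)
Lemma is_derive_odd_reflection (F : R -> R) (x d : R) :
  is_derive (- x) (1 : R) F d -> is_derive x (1 : R) (fun y => - F (- y)) d.
Proof.
move=> dF; have dN : is_derive x (1 : R) (fun y : R => - y) (-1) by apply: is_derive_eq.
have dc := @is_derive1_comp R F (fun y : R => - y) x _ _ dF dN.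
by apply: is_derive_eq; rewrite /GRing.scale /=; ring.
Qed.

Section Bounds.
Variables (F g : R -> R) (kap : R).
Hypothesis g_lip : forall x y, `|g x - g y| <= `|x - y|.
Hypothesis g0 : `|g 0| <= kap.
Hypothesis derF : forall x, is_derive x (1 : R) F (g x * gpdf x).
Hypothesis limF : (fun n : nat => F n%:R) @ \oo --> (0 : R).

Lemma lip_growth x : `|g x| <= `|x| + kap.
Proof.
have := g_lip x 0; have := ler_normD (g x - g 0) (g 0); rewrite subrK subr0.
by have := g0; lra.
Qed.

(** For t >= 1 the growth |g t| <= t + kap is at most (1 + kap) t, and t [gpdf] t is minus the
    derivative of [gpdf]. *)
Lemma stein_tail (x : R) : 1 <= x -> `|F x| <= (1 + kap) * gpdf x.
Proof.
move=> x1; have k0 : 0 <= kap by apply: le_trans g0.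
apply: (@decay_comparison F (fun t => (1 + kap) * gpdf t) (fun t => g t * gpdf t)
   (fun t => (1 + kap) * (- t * gpdf t)) x) => //.
- by move=> t _; have dg := is_derive_gpdf t; apply: is_derive_eq; rewrite /GRing.scale /=; ring.
- move=> t xt; rewrite normrM (ger0_norm (ltW (gpdf_gt0 t))).
  rewrite [leRHS](_ : _ = (1 + kap) * t * gpdf t); last by ring.
  rewrite ler_wpM2r ?(ltW (gpdf_gt0 t)) //; apply: (le_trans (lip_growth t)).
  rewrite ger0_norm; last lra.
  nra.
- by move=> t _; rewrite mulr_ge0 ?(ltW (gpdf_gt0 t)) //; lra.
Qed.

(** The left side is [gpdf x] times the derivative of the Stein solution [F / gpdf]. Its two terms
    may each be of order x [gpdf x]; their cancellation leaves order [gpdf x] / x, which compensates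
    the further factor x in the next bound. *)
Lemma stein_tail_weighted (x : R) : 1 <= x -> `|g x * gpdf x + x * F x| <= (`|g x| + x) / x ^+ 2 * gpdf x.
Proof.
move=> x1; have x0 : 0 < x by lra.
have A0 : 0 <= `|g x| + x by have := normr_ge0 (g x); lra.
set A := `|g x| + x in A0 *.
(* The comparison function satisfies [- V' >= A (t - x) gpdf], while [g x * gpdf + x * F] has
   derivative at most [A (t - x) gpdf] because [g] is 1-Lipschitz. *)
have := @decay_comparison (fun t => g x * gpdf t + x * F t)
   (fun t => A * (((t - x) / x + (x ^+ 2)^-1) * gpdf t))
   (fun t => g x * (- t * gpdf t) + x * (g t * gpdf t))
   (fun t => A * (x^-1 * gpdf t + ((t - x) / x + (x ^+ 2)^-1) * (- t * gpdf t))) x.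
rewrite subrr mul0r add0r !mulrA; apply.
- move=> t _; have dg := is_derive_gpdf t; have dF := derF t.
  by apply: is_derive_eq; rewrite /GRing.scale /=; ring.
- move=> t _; have dg := is_derive_gpdf t.
  by apply: is_derive_eq; rewrite /GRing.scale /=; ring.
- move=> t xt; have w0 := ltW (gpdf_gt0 t).
  rewrite [X in `|X|](_ : _ = (- (t - x) * g x + x * (g t - g x)) * gpdf t); last by ring.
  rewrite normrM (ger0_norm w0).
  apply: (@le_trans _ _ (A * (t - x) * gpdf t)).
    rewrite ler_wpM2r // /A; apply: (le_trans (ler_normD _ _)).
    rewrite !normrM normrN (ger0_norm (ltW x0)) [`|t - x|]ger0_norm; last by lra.
    have := g_lip t x; rewrite [`|t - x|]ger0_norm; last by lra.
    by move=> /(ler_wpM2l (ltW x0)); lra.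
  rewrite [leRHS](_ : _ = A * ((t - x) * (t / x) + (t - x) / x ^+ 2) * gpdf t); last first.
    by field; rewrite gt_eqF.
  rewrite ler_wpM2r // ler_wpM2l //.
  have tx : 1 <= t / x by rewrite ler_pdivlMr // mul1r.
  have h1 : 0 <= (t - x) / x ^+ 2 by rewrite divr_ge0 ?sqr_ge0 // subr_ge0.
  have h2 : 0 <= (t - x) * (t / x - 1) by rewrite mulr_ge0 // subr_ge0.
  lra.
- move=> t xt; have h1 : 0 <= (t - x) / x by apply: divr_ge0; rewrite ?subr_ge0 // ltW.
  have h2 : 0 <= (x ^+ 2)^-1 by rewrite invr_ge0 sqr_ge0.
  by rewrite mulr_ge0 // mulr_ge0 ?addr_ge0 // ltW // gpdf_gt0.
- rewrite (_ : 0 = g x * 0 + x * 0 :> R); last by ring.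
  apply: cvgD; apply: cvgM; first exact: cvg_cst.
  + exact: gpdf_cvg0.
  + exact: cvg_cst.
  + exact: limF.
Qed.

(** With f = [F / gpdf], the left side is [gpdf x] times the derivative of x f(x). The constant 13
    is dictated by the central range; the tail leaves room. *)
Lemma stein_second_bound_tail (x : R) : 1 <= x ->
  `|F x + x * (g x * gpdf x) + x ^+ 2 * F x| <= 13 * (1 + kap) * gpdf x.
Proof.
move=> x1; have w0 := gpdf_gt0 x; have x0 : 0 < x by lra.
have k0 : 0 <= kap by apply: le_trans g0.
have t2 : `|x * (g x * gpdf x + x * F x)| <= (2 + kap) * gpdf x.
  rewrite normrM (ger0_norm (ltW x0)).
  apply: (le_trans (ler_wpM2l (ltW x0) (stein_tail_weighted x1))).
  rewrite [leLHS](_ : _ = (`|g x| + x) / x * gpdf x); last by field; rewrite gt_eqF.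
  rewrite ler_wpM2r ?(ltW w0) // ler_pdivrMr //.
  by have := lip_growth x; rewrite (ger0_norm (ltW x0)); nra.
have := ler_normD (F x) (x * (g x * gpdf x + x * F x)); have := stein_tail x1.
rewrite (_ : F x + x * (g x * gpdf x) + x ^+ 2 * F x = F x + x * (g x * gpdf x + x * F x)); last by ring.
have := mulr_ge0 k0 (ltW w0); nra.
Qed.

Lemma gpdf_le0 (x : R) : gpdf x <= gpdf 0.
Proof.
rewrite !gpdfE ler_wpM2l ?normal_peak_ge0 // ler_expR expr0n /= oppr0 mul0r.
have := sqr_ge0 x; lra.
Qed.

Lemma gpdf_near0 (x : R) : `|x| <= 1 -> gpdf 0 <= 2 * gpdf x.
Proof.
move=> x1; rewrite !gpdfE mulrCA ler_wpM2l ?normal_peak_ge0 // expr0n /= oppr0 mul0r expR0.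
have := expR_ge1Dx (- x ^+ 2 / 2).
have : x ^+ 2 <= 1 by rewrite -(real_normK (num_real x)) expr_le1.
lra.
Qed.

Lemma stein_second_bound_center (x : R) : `|x| <= 1 ->
  `|F x + x * (g x * gpdf x) + x ^+ 2 * F x| <= 13 * (1 + kap) * gpdf x.
Proof.
move=> x1; have w0 := gpdf_gt0 x.
have k0 : 0 <= kap by apply: le_trans g0.
have xx : -1 <= x <= 1 by rewrite -ler_norml.
have w00 := gpdf_gt0 (0 : R).
have kw : 0 <= (1 + kap) * gpdf 0 by rewrite mulr_ge0 ?ltW //; lra.
(* Going from x to 1 over a length at most 2 gives 3 (1 + kap) [gpdf 0], and [gpdf_near0] doubles
   this. With 1 + x^2 <= 2 it contributes 12, and the term in [g] contributes 1, in total 13. *)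
have Fx : `|F x| <= 6 * (1 + kap) * gpdf x.
  have F1 := stein_tail (lexx 1).
  have x1' : x <= 1 by case/andP: xx.
  have [c /andP[xc c1] E] := @MVT_is_derive F (fun x => g x * gpdf x) x 1 x1'.
  have gc : `|g c * gpdf c * (1 - x)| <= (1 + kap) * gpdf 0 * 2.
    rewrite normrM [`|1 - x|]ger0_norm; last by case/andP: xx; lra.
    apply: ler_pM => //; [lra| |lra].
    rewrite normrM [`|gpdf c|]ger0_norm ?(ltW (gpdf_gt0 _)) //.
    apply: ler_pM => //; rewrite ?(ltW (gpdf_gt0 _)) ?gpdf_le0 //.
    apply: (le_trans (lip_growth c)); rewrite lerD2r ler_norml; lra.
  have : `|F x| <= `|F 1| + `|g c * gpdf c * (1 - x)|.
    by rewrite -E; have := ler_normB (F 1) (F 1 - F x); rewrite opprB addrC subrK.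
  have := gpdf_near0 x1; have : gpdf 1 <= gpdf 0 := gpdf_le0 1.
  nra.
rewrite (_ : F x + x * (g x * gpdf x) + x ^+ 2 * F x = (1 + x ^+ 2) * F x + x * g x * gpdf x); last by ring.
apply: (le_trans (ler_normD _ _)).
have x2 : 0 <= x ^+ 2 <= 1 by rewrite sqr_ge0 -(real_normK (num_real x)) expr_le1.
have t1 : `|(1 + x ^+ 2) * F x| <= 2 * (6 * (1 + kap) * gpdf x).
  by rewrite normrM ger0_norm; [apply: ler_pM => //; lra|lra].
have t2 : `|x * g x * gpdf x| <= (1 + kap) * gpdf x.
  rewrite !normrM [`|gpdf x|]ger0_norm ?(ltW w0) // ler_wpM2r ?(ltW w0) //.
  rewrite -[leRHS]mul1r; apply: ler_pM => //.
  by apply: (le_trans (lip_growth x)); rewrite lerD2r.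
lra.
Qed.

End Bounds.
Section Solution.
Variable h : R -> R.
Hypothesis h_lip : forall x y, `|h x - h y| <= `|x - y|.

(** The derivative of the solution is h - [gmean h] + x f(x): the last 1 is the Lipschitz constant
    of [h], the rest bounds the derivative of x f(x). This avoids a second derivative of f, which a
    merely Lipschitz [h] does not provide. *)
Definition stein_lip : R := 13 * (1 + gabs R) + 1.

Lemma stein_second_bound (x : R) :
  `|stein_int h x + x * ((h x - gmean h) * gpdf x) + x ^+ 2 * stein_int h x| <= (stein_lip - 1) * gpdf x.
Proof.
rewrite /stein_lip addrK.
pose g x := h x - gmean h.
have g_lip y z : `|g y - g z| <= `|y - z| by rewrite /g opprB addrA subrK.
have g0 : `|g 0| <= gabs R by exact: gmean_dist.
have dF := is_derive_stein_int h_lip.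
have lF := stein_int_pinfty h_lip.
have [x1|x1] := lerP `|x| 1; first exact: (stein_second_bound_center g_lip g0 dF lF).
have [x0|x0] := lerP 0 x.
  by apply: (stein_second_bound_tail g_lip g0 dF lF); move: x1; rewrite ger0_norm // => /ltW.
pose F' y := - stein_int h (- y); pose g' y := g (- y).
have gE y : gpdf (- y) = gpdf y by rewrite !gpdfE sqrrN.
have g'_lip y z : `|g' y - g' z| <= `|y - z|.
  by apply: (le_trans (g_lip _ _)); rewrite opprK addrC distrC.
have g'0 : `|g' 0| <= gabs R by rewrite /g' oppr0.
have dF' y : is_derive y (1 : R) F' (g' y * gpdf y).
  by apply: is_derive_odd_reflection; rewrite -gE; exact: dF.
have lF' : (fun n : nat => F' n%:R) @ \oo --> (0 : R).
  by rewrite -oppr0; apply: cvgN; exact: (stein_int_ninfty h_lip).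
have := @stein_second_bound_tail F' g' _ g'_lip g'0 dF' lF' (- x).
rewrite /F' /g' /g !opprK gE sqrrN => bnd.
rewrite -normrN; apply: le_trans (bnd _); last by move: x1; rewrite ltr0_norm // => /ltW.
by rewrite le_eqVlt; apply/orP; left; apply/eqP; congr `|_|; ring.
Qed.

Lemma stein_solution : exists f fd : R -> R,
  [/\ forall x, fd x - x * f x = h x - gmean h,
      forall a b, `|f a - f b - (a - b) * fd a| <= stein_lip * (a - b) ^+ 2 &
      forall a b, `|fd a - fd b| <= stein_lip * `|a - b|].
Proof.
pose f x := stein_int h x / gpdf x.
pose fd x := (h x - gmean h) + x * f x.
have w0 x : gpdf x != 0 by rewrite gt_eqF // gpdf_gt0.
have df x : is_derive x (1 : R) f (fd x).
  have dF := is_derive_stein_int h_lip x.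
  have dw := is_deriveV (w0 x) (is_derive_gpdf x).
  have dM := is_deriveM dF dw.
  apply: (is_derive_eq dM); rewrite /fd /f /GRing.scale /=; field; exact: w0.
have dxf x : is_derive x (1 : R) (fun y => y * f y) (f x + x * fd x).
  have dM := is_deriveM (is_derive_id x (1 : R)) (df x).
  by apply: (is_derive_eq dM); rewrite /GRing.scale /=; ring.
have bxf x : `|f x + x * fd x| <= stein_lip - 1.
  rewrite -(ler_pM2r (gpdf_gt0 x)); apply: le_trans (stein_second_bound x).
  rewrite -[X in _ * X](ger0_norm (ltW (gpdf_gt0 x))) -normrM; rewrite le_eqVlt; apply/orP; left; apply/eqP; congr `|_|.
  rewrite /fd /f; field; exact: w0.
have mvt_lip (u du : R -> R) (L : R) : (forall x, is_derive x (1 : R) u (du x)) ->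
    (forall x, `|du x| <= L) -> forall a b, `|u a - u b| <= L * `|a - b|.
  move=> dU bU; have key a b : a <= b -> `|u a - u b| <= L * `|a - b|.
    move=> ab; have [c _ E] := @MVT_is_derive u du a b ab.
    by rewrite distrC E normrM [`|b - a|]distrC ler_wpM2r.
  move=> a b; have [ab|/ltW ab] := leP a b; first exact: key.
  by rewrite distrC [X in _ * X]distrC; exact: key.
have fd_lip a b : `|fd a - fd b| <= stein_lip * `|a - b|.
  have := mvt_lip _ _ _ dxf bxf a b; have := h_lip a b.
  have := ler_normD (h a - h b) (a * f a - b * f b).
  rewrite (_ : h a - h b + (a * f a - b * f b) = fd a - fd b); last by rewrite /fd; ring.
  have := normr_ge0 (a - b); lra.
exists f, fd; split => //; first by move=> x; rewrite /fd; ring.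
(* The quadratic remainder follows from the mean value theorem, by comparing [fd c] with [fd a]. *)
have mvtf a b : exists2 c, `|c - a| <= `|a - b| & f a - f b = fd c * (a - b).
  have [ab|/ltW ab] := leP a b.
    have [c /andP[ac cb] E] := @MVT_is_derive f fd a b ab.
    exists c; last by rewrite -opprB E; ring.
    by rewrite [leRHS]distrC !ger0_norm; lra.
  have [c /andP[ac cb] E] := @MVT_is_derive f fd b a ab.
  exists c => //; rewrite [leLHS]distrC !ger0_norm; lra.
have L0 : 0 <= stein_lip by have := bxf 0; have := normr_ge0 (f 0 + 0 * fd 0); lra.
move=> a b; have [c ca ->] := mvtf a b.
rewrite mulrC -mulrBr normrM -real_normK ?num_real // expr2 mulrCA ler_wpM2l //.
by apply: (le_trans (fd_lip c a)); rewrite ler_wpM2l.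
Qed.

End Solution.
End SteinEquation.

(** * Lipschitz-test bound for the normalised sum *)

Section SteinWasserstein.
Variables (R : realType) (I S : finType) (pr : I -> R) (act : {set S}) (sup : S -> {set I}).
Hypothesis pr01 : forall i, 0 <= pr i <= 1.
Local Notation W := (Wsum pr act sup).
Local Notation sd := (Num.sqrt (bern_E pr (fun x => W x ^+ 2))).

(** The test function w -> f(w / sd) has remainder constant [stein_lip R / sd ^+ 2]. By the Stein
    equation the left side of [stein_dissociated] is then sd times the error for [h], which supplies
    the third power of sd. *)
Lemma stein_wass (h : R -> R) : (forall x y, `|h x - h y| <= `|x - y|) -> 0 < sd ->
  `|bern_E pr (fun x => h (W x / sd)) - gmean h| <=
  24 * stein_lip R * triple_sum pr act sup / sd ^+ 3.
Proof.
move=> h_lip sd0; set s := sd in sd0 *.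
have sn0 : s != 0 by rewrite gt_eqF.
have [f [fd [eqf tay lip]]] := stein_solution h_lip.
have bnd := @stein_dissociated R I pr pr01 S act sup (fun w => f (w / s)) (fun w => fd (w / s) / s)
   (stein_lip R / s ^+ 2) _ _.
have {bnd} : `|bern_E pr (fun x => W x * f (W x / s)) -
   bern_E pr (fun x => W x ^+ 2) * bern_E pr (fun x => fd (W x / s) / s)| <=
   24 * (stein_lip R / s ^+ 2) * triple_sum pr act sup.
  apply: bnd => a b.
    rewrite (_ : (a - b) * (fd (a / s) / s) = (a / s - b / s) * fd (a / s)); last by field.
    apply: (le_trans (tay _ _)).
    by rewrite le_eqVlt; apply/orP; left; apply/eqP; field.
  rewrite -mulrBl normrM (ger0_norm (x := s^-1)) ?invr_ge0 ?(ltW sd0) //.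
  rewrite ler_pdivrMr //; apply: (le_trans (lip _ _)).
  rewrite -mulrBl normrM (ger0_norm (x := s^-1)) ?invr_ge0 ?(ltW sd0) //.
  by rewrite le_eqVlt; apply/orP; left; apply/eqP; field.
have -> : bern_E pr (fun x => W x ^+ 2) = s ^+ 2.
  by rewrite sqr_sqrtr // ltW // -sqrtr_gt0.
have -> : bern_E pr (fun x => W x * f (W x / s)) - s ^+ 2 * bern_E pr (fun x => fd (W x / s) / s) =
   - (s * (bern_E pr (fun x => h (W x / s)) - gmean h)).
  rewrite -[X in _ = - (_ * (_ - X))](bern_E_cst pr) -bern_EB -!bern_EZ -bern_EB -bern_EN.
  apply: eq_bern_E => x; rewrite -eqf; field; exact: sn0.
rewrite normrN normrM (ger0_norm (ltW sd0)) -ler_pdivlMl // => bnd.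
apply: (le_trans bnd).
by rewrite le_eqVlt; apply/orP; left; apply/eqP; field.
Qed.

End SteinWasserstein.

(** * From Lipschitz test functions to distribution functions *)

Section NormalCdf.
Variable R : realType.
Local Notation gauss := (normal_prob (0 : R) 1).
Local Notation Phi := (@std_normal_cdf R).
Implicit Types x y d : R.

Lemma gauss_fin (A : set R) : measurable A -> (fine (gauss A))%:E = gauss A.
Proof. by move=> mA; rewrite fineK //; exact: fin_num_measure. Qed.

Lemma std_normal_cdf_split x d : 0 <= d ->
  ((Phi (x + d))%:E = (Phi x)%:E + gauss `]x, (x + d)%R])%E.
Proof.
move=> d0; rewrite /Phi !gauss_fin //.
have -> : (`]-oo, x + d]%classic = `]-oo, x]%classic `|` `]x, x + d]%classic :> set R).
  by rewrite -itv_bndbnd_setU // bnd_simp; rewrite ?lerDl.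
rewrite measureU // -subset0 => t /=; rewrite !in_itv /= => -[t1 /andP[t2 _]].
by move: t2; rewrite ltNge t1.
Qed.

(** The density is at most 1, because 2 pi >= 1. *)
Lemma std_normal_cdf_lip x d : 0 <= d -> Phi (x + d) <= Phi x + d.
Proof.
move=> d0; rewrite -lee_fin std_normal_cdf_split // EFinD leeD2l // /normal_prob.
apply: (@le_trans _ _ (\int[lebesgue_measure]_(t in `]x, (x + d)%R]) 1%:E)%E); last first.
  rewrite integral_cst // mul1e.
  by rewrite [X in (X <= _)%E]lebesgue_measure_itv /= lte_fin; case: ifP => // _; rewrite -EFinD lee_fin; lra.
apply: ge0_le_integral => //.
- by move=> t _; rewrite lee_fin normal_pdf_ge0.
- by apply/measurable_funTS/measurable_EFinP; exact: measurable_normal_pdf.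
- move=> t _; rewrite lee_fin; apply: le_trans (normal_pdf_ub _ _ _) _; first exact: oner_neq0.
  have pi0 := pi_gt0 R.
  rewrite /normal_peak expr1n mul1r invf_le1 ?sqrtr_gt0 //; last by rewrite pmulrn_lgt0.
  rewrite -[X in X <= _]sqrtr1 ler_wsqrtr //.
  have := pi_ge2 R; rewrite mulr2n; lra.
Qed.

Lemma std_normal_cdf_gt0 x : 0 < Phi x.
Proof.
have m0 : 0 < gpdf (`|x| + 1) by exact: gpdf_gt0.
suff : Phi (x - 1) + gpdf (`|x| + 1) <= Phi x.
  apply: lt_le_trans; rewrite -[ltLHS]addr0 ler_ltD //.
  by rewrite /Phi fine_ge0 // measure_ge0.
rewrite -[X in _ <= Phi X](subrK 1) -lee_fin std_normal_cdf_split // EFinD leeD2l //.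
rewrite subrK /normal_prob.
apply: (@le_trans _ _ (\int[lebesgue_measure]_(t in `](x - 1)%R, x]) (gpdf (`|x| + 1))%:E)%E).
  rewrite integral_cst // [X in (_ * X)%E]lebesgue_measure_itv /= lte_fin ifT; last by lra.
  by rewrite -EFinD -EFinM lee_fin opprB addrCA subrr addr0 mulr1.
apply: ge0_le_integral => //.
- by move=> t _; rewrite lee_fin ltW.
- by apply/measurable_funTS/measurable_EFinP; exact: measurable_normal_pdf.
- move=> t; rewrite /= in_itv /= => /andP[t1 t2]; rewrite lee_fin -/(gpdf t) !gpdfE.
  rewrite ler_wpM2l ?normal_peak_ge0 // ler_expR.
  have tx : `|t| <= `|x| + 1.
    by have := ler_norm x; have := ler_norm (- x); rewrite normrN ler_norml; lra.
  have := real_normK (num_real t); have := normr_ge0 t; nra.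
Qed.

(** A smoothed indicator of the half-line up to [x], of height [d] rather than 1 so that its slope
    stays at most 1. *)
Definition ramp x d : R -> R := fun y => Num.min d (Num.max 0 (x + d - y)).

Lemma ramp_lip x d y z : `|ramp x d y - ramp x d z| <= `|y - z|.
Proof.
rewrite /ramp; wlog yz : y z / y <= z.
  by move=> H; have [/H //|/ltW /H] := leP y z; rewrite distrC [X in _ <= X -> _]distrC.
rewrite [`|y - z|]distrC [`|z - y|]ger0_norm ?subr_ge0 // ler_norml.
rewrite !minEle !maxEle; do 4 case: ifPn; rewrite -?ltNge => *; lra.
Qed.

Lemma ramp_ge x d y : 0 <= d -> d * (y <= x)%R%:R <= ramp x d y.
Proof.
move=> d0; rewrite /ramp minEle maxEle.
by case: (leP y x) => h; rewrite ?mulr1 ?mulr0; do 2 case: ifPn; rewrite -?ltNge => *; lra.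
Qed.

Lemma ramp_le x d y : 0 <= d -> ramp x d y <= d * (y <= x + d)%R%:R.
Proof.
move=> d0; rewrite /ramp minEle maxEle.
by case: (leP y (x + d)) => h; rewrite ?mulr1 ?mulr0; do 2 case: ifPn; rewrite -?ltNge => *; lra.
Qed.

Lemma gauss_integral_step x d : 0 <= d -> (\int[gauss]_y (d * (y <= x)%R%:R)%:E = (d * Phi x)%:E)%E.
Proof.
move=> d0; under eq_integral => y _.
  rewrite (_ : (y <= x)%R%:R = \1_(`]-oo, x]%classic : set R) y :> R); last first.
    by rewrite indicE mem_setE in_itv.
  rewrite EFinM; over.
rewrite ge0_integralZl //; last by apply/measurable_EFinP; exact: measurable_indic.
by rewrite integral_indic // setIT EFinM; congr (_ * _)%E; apply/esym; exact: gauss_fin.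
Qed.

Lemma gmean_ramp_ge x d : 0 <= d -> d * Phi x <= gmean (ramp x d).
Proof.
move=> d0; rewrite -lee_fin -gauss_integral_step // -(gmeanE (ramp_lip x d)).
apply: ge0_le_integral => //.
- by move=> y _; rewrite lee_fin mulr_ge0.
- apply/measurable_EFinP/measurable_funM => //.
  rewrite (_ : (fun y => (y <= x)%R%:R) = \1_(`]-oo, x]%classic : set R)); first exact: measurable_indic.
  by apply/funext => y; rewrite indicE mem_setE in_itv.
- by apply/measurable_EFinP; exact: lip_measurable (ramp_lip x d).
- by move=> y _; rewrite lee_fin ramp_ge.
Qed.

Lemma gmean_ramp_le x d : 0 <= d -> gmean (ramp x d) <= d * Phi (x + d).
Proof.
move=> d0; rewrite -lee_fin -gauss_integral_step // -(gmeanE (ramp_lip x d)).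
apply: ge0_le_integral => //.
- by move=> y _; rewrite lee_fin; apply: le_trans (ramp_ge x y d0); rewrite mulr_ge0.
- by apply/measurable_EFinP; exact: lip_measurable (ramp_lip x d).
- apply/measurable_EFinP/measurable_funM => //.
  rewrite (_ : (fun y => (y <= x + d)%R%:R) = \1_(`]-oo, x + d]%classic : set R)); first exact: measurable_indic.
  by apply/funext => y; rewrite indicE mem_setE in_itv.
- by move=> y _; rewrite lee_fin ramp_le.
Qed.

(* A Lipschitz-distance bound [w] gives a Kolmogorov bound by smoothing the indicator on scale [d]. *)
Lemma cdf_of_wass (I : finType) (pr : I -> R) (Z : {ffun I -> bool} -> R) (w x d : R) :
  (forall i, 0 <= pr i <= 1) -> 0 < d ->
  (forall h : R -> R, (forall y z, `|h y - h z| <= `|y - z|) ->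
     `|bern_E pr (fun X => h (Z X)) - gmean h| <= w) ->
  `|bern_E pr (fun X => (Z X <= x)%R%:R) - Phi x| <= d + w / d.
Proof.
move=> pr01 d0 Hw; have d0' := ltW d0.
have up : d * bern_E pr (fun X => (Z X <= x)%R%:R) <= d * Phi (x + d) + w.
  have := Hw _ (ramp_lip x d); have := gmean_ramp_le x d0'.
  have : d * bern_E pr (fun X => (Z X <= x)%R%:R) <= bern_E pr (fun X => ramp x d (Z X)).
    by rewrite -bern_EZ; apply: le_bern_E => // X; exact: ramp_ge.
  rewrite ler_norml; lra.
have dn : d * Phi (x - d) - w <= d * bern_E pr (fun X => (Z X <= x)%R%:R).
  have := Hw _ (ramp_lip (x - d) d); have := gmean_ramp_ge (x - d) d0'.
  have : bern_E pr (fun X => ramp (x - d) d (Z X)) <= d * bern_E pr (fun X => (Z X <= x)%R%:R).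
    by rewrite -bern_EZ; apply: le_bern_E => // X; have := ramp_le (x - d) (Z X) d0'; rewrite subrK.
  rewrite ler_norml; lra.
have l1 := std_normal_cdf_lip x d0'; have l2 := std_normal_cdf_lip (x - d) d0'.
rewrite subrK in l2.
have -> : d + w / d = (d * d + w) / d by field; rewrite gt_eqF.
rewrite ler_pdivlMr // -[X in _ * X <= _](ger0_norm d0') -normrM ler_norml; nra.
Qed.

End NormalCdf.

(** * Embeddings into the Erdos-Renyi graph *)

Section ErdosRenyi.
Variables (R : realType) (n : nat) (q : R).
Local Notation V := 'I_n.
Implicit Types (E D : {set V * V}) (f g : {set V * V} -> R).

(** Graphs of positive [er_weight] consist of increasing pairs, so images of edges must be sorted
    before they are compared with [E]. *)
Definition ue (i j : V) : V * V := if (i < j)%N then (i, j) else (j, i).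

Lemma ue_inj i j i' j' : ue i j = ue i' j' -> (i, j) = (i', j') \/ (i, j) = (j', i').
Proof. by rewrite /ue; case: ifP => _; case: ifP => _ [-> ->]; auto. Qed.

Lemma ue_upper i j : i != j -> ue i j \in upper n.
Proof. by rewrite /ue inE; case: (ltngtP i j) => //= /ord_inj ->; rewrite eqxx. Qed.

Lemma adjE E i j : E \subset upper n -> adj E i j = (ue i j \in E).
Proof.
move=> /fintype.subsetP EU; rewrite /adj /ue.
case: (ltngtP i j) => ij; last by rewrite (ord_inj ij) orbb.
  by case: (boolP ((j, i) \in E)) => [/EU|]; rewrite ?inE /= ?orbF // ltnNge (ltnW ij).
by case: (boolP ((i, j) \in E)) => [/EU|]; rewrite ?inE /= // ltnNge (ltnW ij).
Qed.

(* Pairs outside [upper n] get probability 0: this turns the restriction of [er_weight] to subsets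
   of [upper n] into a product measure on all pairs. *)
Definition edge_pr (ij : V * V) : R := if ij \in upper n then q else 0.
Definition edge_set (x : {ffun V * V -> bool}) : {set V * V} := [set ij | x ij].
Definition er_E f : R := bern_E edge_pr (fun x => f (edge_set x)).

Lemma er_EE f : er_E f = \sum_E er_weight q E * f E.
Proof.
rewrite /er_E /bern_E.
pose ind (E : {set V * V}) : {ffun V * V -> bool} := [ffun ij => ij \in E].
have K1 : cancel ind edge_set by move=> E; apply/setP => ij; rewrite inE ffunE.
have K2 : cancel edge_set ind by move=> x; apply/ffunP => ij; rewrite ffunE inE.
rewrite (reindex ind) /=; last by exists edge_set => x _; [exact: K1|exact: K2].
apply: eq_bigr => E _; rewrite K1; congr (_ * _).
rewrite /bern_weight /er_weight; case: (boolP (E \subset upper n)) => [/fintype.subsetP EU|].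
  rewrite [RHS]big_mkcond; apply: eq_bigr => ij _; rewrite ffunE /edge_pr.
  case: (boolP (ij \in E)) => [/EU ->//|_]; case: ifP => // _; exact: subr0.
case/fintype.subsetPn => ij ijE ijU.
by rewrite (bigD1 ij) //= ffunE ijE /edge_pr (negbTE ijU) mul0r.
Qed.

Lemma er_E_prob p A : Prob q p A = er_E (fun E => condE p (fun X => (A (E, X))%:R)).
Proof.
rewrite er_EE /Prob big_mkcond /=.
under [RHS]eq_bigr do rewrite /condE mulr_sumr.
rewrite pair_bigA /=; apply: eq_bigr => -[E X] _ /=.
by case: (A (E, X)); rewrite ?mulr1 ?mulr0.
Qed.

Lemma er_E_sum (T : Type) (r : seq T) (P : pred T) (F : T -> {set V * V} -> R) :
  er_E (fun E => \sum_(t <- r | P t) F t E) = \sum_(t <- r | P t) er_E (F t).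
Proof. by rewrite /er_E bern_E_sum. Qed.

Lemma er_EZ c f : er_E (fun E => c * f E) = c * er_E f.
Proof. exact: bern_EZ. Qed.

Lemma er_ED f g : er_E (fun E => f E + g E) = er_E f + er_E g.
Proof. exact: bern_ED. Qed.

Lemma er_EB f g : er_E (fun E => f E - g E) = er_E f - er_E g.
Proof. exact: bern_EB. Qed.

Lemma er_E_cst c : er_E (fun=> c) = c.
Proof. exact: bern_E_cst. Qed.

Lemma eq_er_E f g : (forall E, E \subset upper n -> f E = g E) -> er_E f = er_E g.
Proof.
move=> fg; rewrite !er_EE; apply: eq_bigr => E _; rewrite /er_weight.
by case: ifP => [/fg ->//|_]; rewrite !mul0r.
Qed.

Lemma er_E_subset D : D \subset upper n -> er_E (fun E => (D \subset E)%:R) = q ^+ #|D|.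
Proof.
move=> /fintype.subsetP DU.
rewrite /er_E [LHS](_ : _ = bern_E edge_pr (all_on R D)); last first.
  apply: eq_bern_E => x; rewrite all_onE; congr (_%:R); congr nat_of_bool.
  by apply/fintype.subsetP/forall_inP => h ij /h; rewrite inE.
rewrite bern_E_all_on -prodr_const; apply: eq_bigr => ij /DU ijU.
by rewrite /edge_pr ijU.
Qed.

Hypothesis q01 : 0 < q < 1.

Lemma edge_pr01 ij : 0 <= edge_pr ij <= 1.
Proof. by rewrite /edge_pr; case/andP: q01 => *; case: ifP => _; apply/andP; split; lra. Qed.

Lemma le_er_E f g : (forall E, E \subset upper n -> f E <= g E) -> er_E f <= er_E g.
Proof.
move=> fg.
rewrite -subr_ge0 -er_EB (@eq_er_E _ (fun E => if E \subset upper n then g E - f E else 0)).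
  apply: bern_E_ge0; first exact: edge_pr01.
  by move=> x; case: ifP => // /fg; rewrite subr_ge0.
by move=> E ->.
Qed.

Lemma er_E_ge0 f : (forall E, E \subset upper n -> 0 <= f E) -> 0 <= er_E f.
Proof. by move=> f0; rewrite -(er_E_cst 0); apply: le_er_E. Qed.

Lemma er_markov f a : (forall E, E \subset upper n -> 0 <= f E) -> 0 < a ->
  er_E (fun E => (a < f E)%R%:R) <= er_E f / a.
Proof.
move=> f0 a0; rewrite ler_pdivlMr // mulrC -er_EZ; apply: le_er_E => E EU.
by case: ltP => h; rewrite ?mulr1 ?mulr0 ?f0 // ltW.
Qed.

End ErdosRenyi.

(** * Expected sums over overlapping embeddings *)

Section Embeddings.
Variables (R : realType) (J : finType) (F : {set J * J}).
Hypothesis F_asym : forall uv, uv \in F -> (uv.1 != uv.2) && ((uv.2, uv.1) \notin F).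
Variable n : nat.
Implicit Types (s t u : {ffun J -> 'I_n}) (E : {set 'I_n * 'I_n}).

Definition edge_im s : {set 'I_n * 'I_n} := [set ue (s uv.1) (s uv.2) | uv in F].
Definition vert_im s : {set 'I_n} := [set s j | j in predT].
(** Labelled copies, over an arbitrary vertex type [J] so that the results apply both to H and to
    its subgraphs. *)
Definition embeddings E : {set {ffun J -> 'I_n}} :=
  [set s : {ffun J -> 'I_n} | injectiveb s && (edge_im s \subset E)].

Lemma injectivebP s : injectiveb s -> injective s.
Proof. by move/injectiveP. Qed.

Lemma card_vert_im s : injectiveb s -> #|vert_im s| = #|J|.
Proof. by move/injectivebP => si; rewrite card_imset. Qed.

(** [F] stores each edge in one orientation only, so two of its edges cannot have the same sorted
    image. *)
Lemma edge_im_inj s : injectiveb s -> {in F &, injective (fun uv => ue (s uv.1) (s uv.2))}.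
Proof.
move/injectivebP => si [a b] [c d] /= abF cdF /ue_inj[[/si -> /si ->]//|[/si E1 /si E2]].
by have := F_asym abF; rewrite /= E1 E2 cdF andbF.
Qed.

Lemma card_edge_im s : injectiveb s -> #|edge_im s| = #|F|.
Proof. by move=> si; rewrite card_in_imset //; exact: edge_im_inj. Qed.

Lemma edge_im_upper s : injectiveb s -> edge_im s \subset upper n.
Proof.
move=> si; apply/fintype.subsetP => _ /imsetP[uv uvF ->]; apply: ue_upper.
by rewrite (inj_eq (injectivebP si)); case/andP: (F_asym uvF).
Qed.

Lemma edge_im_vert s ij : ij \in edge_im s -> (ij.1 \in vert_im s) && (ij.2 \in vert_im s).
Proof.
by case/imsetP => uv _ ->; rewrite /ue; case: ifP => _ /=; rewrite !imset_f.
Qed.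

Variables (p q P0 : R).
Hypothesis p0 : 0 < p.
Hypothesis q01 : 0 < q < 1.
Hypothesis P00 : 0 < P0.
Hypothesis P0_min : forall (A : {set J}) (D : {set J * J}), (0 < #|A|)%N -> D \subset F ->
  (forall uv, uv \in D -> (uv.1 \in A) && (uv.2 \in A)) ->
  P0 <= (n%:R * p) ^+ #|A| * q ^+ #|D|.

(* Up to a constant, the expected number of sampled embedded copies of [(J, F)]. *)
Definition psi : R := (n%:R * p) ^+ #|J| * q ^+ #|F|.

Lemma psi_ge0 : 0 <= psi.
Proof. by case/andP: q01 => q0 _; rewrite /psi mulr_ge0 // exprn_ge0 ?mulr_ge0 // ltW. Qed.

(* [u^-1 B], with the edges sent into [F0], is a nonempty subgraph; minimality of [P0] over
   subgraphs trades it for a factor [n^-1] per vertex sent outside [B]. *)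
Lemma extension_weight (B : {set 'I_n}) (F0 : {set 'I_n * 'I_n}) u : (0 < n)%N ->
  (forall ij, ij \in F0 -> (ij.1 \in B) && (ij.2 \in B)) ->
  injectiveb u -> overlap (vert_im u) B ->
  p ^+ #|vert_im u :\: B| * q ^+ #|edge_im u :\: F0| <=
  psi / P0 * \prod_j (if u j \in B then 1 else n%:R^-1).
Proof.
move=> n0 F0B ui ov; case/andP: q01 => q0 q1.
have nR0 : 0 < n%:R :> R by rewrite ltr0n.
pose A : {set J} := [set j | u j \in B]%SET; pose D : {set J * J} := [set uv in F | ue (u uv.1) (u uv.2) \in F0]%SET.
have A0 : (0 < #|A|)%N.
  case/exists_inP: ov => _ /imsetP[j _ ->] jB; apply/card_gt0P; exists j; by rewrite inE.
have DF : D \subset F by apply/fintype.subsetP => uv; rewrite inE => /andP[].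
have DA uv : uv \in D -> (uv.1 \in A) && (uv.2 \in A).
  rewrite !inE => /andP[_ /F0B]; rewrite /ue; case: ifP => _ //=. by rewrite andbC.
have vE : #|vert_im u :\: B| = #|~: A|.
  rewrite -(card_imset (mem (~: A)) (injectivebP ui)); apply: eq_card => i; rewrite inE.
  apply/andP/imsetP => [[iB /imsetP[j _ ij]]|[j jA ->]].
    by exists j => //; rewrite !inE -ij.
  by move: jA; rewrite !inE => ->; rewrite imset_f.
have eE : #|edge_im u :\: F0| = #|F :\: D|.
  rewrite -(@card_in_imset _ _ (fun uv => ue (u uv.1) (u uv.2)) (mem (F :\: D))); last first.
    by move=> a b; rewrite !inE => /andP[_ aF] /andP[_ bF]; exact: edge_im_inj.
  apply: eq_card => i; rewrite inE; apply/andP/imsetP => [[iF0 /imsetP[uv uvF E]]|[uv uvA ->]].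
    by exists uv => //; rewrite !inE uvF -E (negbTE iF0).
  by move: uvA; rewrite !inE => /andP[+ uvF]; rewrite uvF /= => ->; split => //; apply/imsetP; exists uv.
have -> : \prod_j (if u j \in B then 1 else n%:R^-1) = (n%:R ^+ #|~: A|)^-1 :> R.
  rewrite -exprVn -prodr_const [RHS]big_mkcond; apply: eq_bigr => j _; rewrite !inE.
  by case: ifP.
rewrite vE eE -(ler_pM2l P00) mulrA mulrA [P0 * (psi / P0)]mulrC divfK ?gt_eqF //.
rewrite ler_pdivlMr ?exprn_gt0 //.
have -> : psi = (n%:R * p) ^+ #|A| * q ^+ #|D| * (p ^+ #|~: A| * q ^+ #|F :\: D| * n%:R ^+ #|~: A|).
  rewrite /psi -(cardsC A) exprD -(cardsID D F) exprD (_ : F :&: D = D); last exact/finset.setIidPr.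
  by rewrite [(_ * p) ^+ #|~: A|]exprMn; ring.
rewrite [leLHS](_ : _ = P0 * (p ^+ #|~: A| * q ^+ #|F :\: D| * n%:R ^+ #|~: A|)); last by ring.
apply: ler_wpM2r; last exact: P0_min.
by rewrite !mulr_ge0 ?exprn_ge0 // ltW.
Qed.

(** After [extension_weight] the sum over all maps factorises over the vertices of [J]: images in
    [B] contribute [#|B|], images outside at most n / n = 1. *)
Lemma extension_sum (B : {set 'I_n}) (F0 : {set 'I_n * 'I_n}) : (0 < n)%N ->
  (forall ij, ij \in F0 -> (ij.1 \in B) && (ij.2 \in B)) ->
  \sum_(u : {ffun J -> 'I_n} | injectiveb u && overlap (vert_im u) B)
     p ^+ #|vert_im u :\: B| * q ^+ #|edge_im u :\: F0| <=
  (#|B|.+1)%:R ^+ #|J| * (psi / P0).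
Proof.
move=> n0 F0B; have nR0 : 0 < n%:R :> R by rewrite ltr0n.
have pp : 0 <= psi / P0 by rewrite divr_ge0 ?psi_ge0 // ltW.
apply: (@le_trans _ _ (\sum_(u : {ffun J -> 'I_n}) psi / P0 * \prod_j (if u j \in B then 1 else n%:R^-1))).
  rewrite [leRHS](bigID (fun u : {ffun J -> 'I_n} => injectiveb u && overlap (vert_im u) B)) /=.
  rewrite -[leLHS]addr0; apply: lerD; last first.
    apply: sumr_ge0 => u _; rewrite mulr_ge0 // prodr_ge0 // => j _.
    by case: ifP; rewrite ?invr_ge0 ?ltW.
  by apply: ler_sum => u /andP[ui uB]; exact: extension_weight.
rewrite -mulr_sumr mulrC ler_wpM2r //.
rewrite -(bigA_distr_bigA (fun (j : J) (i : 'I_n) => if i \in B then 1 else n%:R^-1 : R)) /=.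
rewrite prodr_const cardT -cardE lerXn2r ?nnegrE ?sumr_ge0 //.
  by move=> i _; case: ifP; rewrite ?invr_ge0 ?ltW.
rewrite (bigID (mem B)) /= -addn1 natrD lerD //.
  by rewrite (eq_bigr (fun=> 1)) ?sumr_const //= => i ->.
rewrite (eq_bigr (fun=> n%:R^-1)) /=; last by move=> i /negbTE ->.
rewrite sumr_const -[leLHS]mulr_natr ler_pdivrMl // mulr1 ler_nat.
by apply: (leq_trans (max_card _)); rewrite card_ord.
Qed.


Lemma cards_setUD (T : finType) (A B : {set T}) : #|A :|: B| = (#|A| + #|B :\: A|)%N.
Proof.
rewrite cardsU cardsD -addnBA; first by rewrite finset.setIC.
by rewrite subset_leq_card // finset.subsetIr.
Qed.

Lemma sum_embeddings E (f : {ffun J -> 'I_n} -> R) (P : pred {ffun J -> 'I_n}) :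
  \sum_(s in embeddings E | P s) f s =
  \sum_(s : {ffun J -> 'I_n} | injectiveb s && P s) (edge_im s \subset E)%:R * f s.
Proof.
rewrite big_mkcond [RHS]big_mkcond; apply: eq_bigr => s _; rewrite inE.
by case: (injectiveb s); case: (edge_im s \subset E); case: (P s); rewrite /= ?mul1r ?mul0r.
Qed.

Lemma sum_embeddingsT E (f : {ffun J -> 'I_n} -> R) :
  \sum_(s in embeddings E) f s =
  \sum_(s : {ffun J -> 'I_n} | injectiveb s) (edge_im s \subset E)%:R * f s.
Proof.
rewrite -[LHS](eq_bigl _ _ (fun s => andbT _)) (sum_embeddings E f xpredT).
by apply: eq_bigl => s; rewrite andbT.
Qed.

Definition pair_sum E : R :=
  \sum_(s in embeddings E) \sum_(t in embeddings E | overlap (vert_im t) (vert_im s))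
    p ^+ #|vert_im s :|: vert_im t|.

Lemma subset_natr (D D' E : {set 'I_n * 'I_n}) :
  (D \subset E)%:R * (D' \subset E)%:R = (D :|: D' \subset E)%:R :> R.
Proof. by rewrite finset.subUset -natrM mulnb. Qed.

Lemma sum_injective_le (c : R) : 0 <= c ->
  \sum_(s : {ffun J -> 'I_n} | injectiveb s) p ^+ #|J| * q ^+ #|F| * c <= psi * c.
Proof.
move=> c0; case/andP: q01 => q0 q1; rewrite sumr_const -[leLHS]mulr_natl mulrA ler_wpM2r //.
rewrite /psi exprMn -mulrA ler_wpM2r ?mulr_ge0 ?exprn_ge0 ?(ltW p0) ?(ltW q0) //.
rewrite -natrX ler_nat; apply: (leq_trans (max_card _)).
by rewrite card_ffun card_ord.
Qed.

Hypothesis n0 : (0 < n)%N.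

Lemma edge_imU_vert s t ij : ij \in edge_im s :|: edge_im t ->
  (ij.1 \in vert_im s :|: vert_im t) && (ij.2 \in vert_im s :|: vert_im t).
Proof.
by rewrite inE => /orP[] /edge_im_vert /andP[h1 h2]; rewrite !inE h1 h2 ?orbT.
Qed.

(** Given the first embedding, [extension_sum] charges the new vertices and edges of the second by a
    factor [psi / P0]; the first costs at most [psi]. The case [p] = 1 controls the variance of the
    number of embeddings. *)
Lemma er_pair_sum : er_E q pair_sum <= (#|J|.+1)%:R ^+ #|J| * (psi ^+ 2 / P0).
Proof.
case/andP: q01 => q0 q1.
have -> : er_E q pair_sum = \sum_(s : {ffun J -> 'I_n} | injectiveb s) p ^+ #|J| * q ^+ #|F| *
   \sum_(t : {ffun J -> 'I_n} | injectiveb t && overlap (vert_im t) (vert_im s))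
     p ^+ #|vert_im t :\: vert_im s| * q ^+ #|edge_im t :\: edge_im s|.
  transitivity (er_E q (fun E : {set 'I_n * 'I_n} => \sum_(s : {ffun J -> 'I_n} | injectiveb s)
     \sum_(t : {ffun J -> 'I_n} | injectiveb t && overlap (vert_im t) (vert_im s))
        p ^+ #|vert_im s :|: vert_im t| * (edge_im s :|: edge_im t \subset E)%:R)).
    apply: eq_er_E => E _; rewrite /pair_sum sum_embeddingsT; apply: eq_bigr => s _.
    rewrite sum_embeddings mulr_sumr; apply: eq_bigr => t _.
    by rewrite mulrA subset_natr mulrC.
  rewrite er_E_sum; apply: eq_bigr => s si; rewrite er_E_sum mulr_sumr; apply: eq_bigr => t /andP[ti _].
  rewrite er_EZ er_E_subset; last by rewrite finset.subUset !edge_im_upper.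
  rewrite !cards_setUD !exprD card_vert_im // card_edge_im //; ring.
apply: (@le_trans _ _ (\sum_(s : {ffun J -> 'I_n} | injectiveb s) p ^+ #|J| * q ^+ #|F| *
   ((#|J|.+1)%:R ^+ #|J| * (psi / P0)))).
  apply: ler_sum => s si; rewrite ler_wpM2l ?mulr_ge0 ?exprn_ge0 ?(ltW p0) ?(ltW q0) //.
  rewrite -(card_vert_im si); rewrite [X in _ ^+ X](card_vert_im si).
  apply: extension_sum => // ij; exact: edge_im_vert.
apply: (le_trans (sum_injective_le _)).
  by rewrite mulr_ge0 ?exprn_ge0 // divr_ge0 ?psi_ge0 // ltW.
by rewrite le_eqVlt; apply/orP; left; apply/eqP; ring.
Qed.

(** The same revelation, once more: the third embedding is attached to the union of the first two,
    which has at most [#|J| + #|J|] vertices. *)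
Lemma er_triple_sum :
  er_E q (fun E => triple_sum (fun=> p) (embeddings E) vert_im) <=
  ((#|J| + #|J|).+1)%:R ^+ #|J| * (#|J|.+1)%:R ^+ #|J| * (psi ^+ 3 / P0 ^+ 2).
Proof.
case/andP: q01 => q0 q1.
set C2 := ((#|J| + #|J|).+1)%:R ^+ #|J| * (psi / P0); set C1 := (#|J|.+1)%:R ^+ #|J| * (psi / P0).
have pp : 0 <= psi / P0 by rewrite divr_ge0 ?psi_ge0 // ltW.
have C20 : 0 <= C2 by rewrite mulr_ge0 ?exprn_ge0.
have C10 : 0 <= C1 by rewrite mulr_ge0 ?exprn_ge0.
have pq m l : 0 <= p ^+ m * q ^+ l by rewrite mulr_ge0 ?exprn_ge0 ?ltW.
have -> : er_E q (fun E => triple_sum (fun=> p) (embeddings E) vert_im) =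
   \sum_(s : {ffun J -> 'I_n} | injectiveb s) p ^+ #|J| * q ^+ #|F| *
   \sum_(t : {ffun J -> 'I_n} | injectiveb t && overlap (vert_im t) (vert_im s))
     p ^+ #|vert_im t :\: vert_im s| * q ^+ #|edge_im t :\: edge_im s| *
   \sum_(u : {ffun J -> 'I_n} | injectiveb u && overlap (vert_im u) (vert_im s :|: vert_im t))
     p ^+ #|vert_im u :\: (vert_im s :|: vert_im t)| * q ^+ #|edge_im u :\: (edge_im s :|: edge_im t)|.
  transitivity (er_E q (fun E : {set 'I_n * 'I_n} => \sum_(s : {ffun J -> 'I_n} | injectiveb s)
     \sum_(t : {ffun J -> 'I_n} | injectiveb t && overlap (vert_im t) (vert_im s))
     \sum_(u : {ffun J -> 'I_n} | injectiveb u && overlap (vert_im u) (vert_im s :|: vert_im t))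
        p ^+ #|vert_im s :|: vert_im t :|: vert_im u| *
        (edge_im s :|: edge_im t :|: edge_im u \subset E)%:R)).
    apply: eq_er_E => E _; rewrite /triple_sum sum_embeddingsT; apply: eq_bigr => s _.
    rewrite sum_embeddings mulr_sumr; apply: eq_bigr => t _.
    rewrite sum_embeddings mulrA subset_natr mulr_sumr; apply: eq_bigr => u _.
    by rewrite mulrA subset_natr mulrC /moment prodr_const.
  rewrite er_E_sum; apply: eq_bigr => s si; rewrite er_E_sum mulr_sumr; apply: eq_bigr => t /andP[ti _].
  rewrite er_E_sum !mulr_sumr; apply: eq_bigr => u /andP[ui _].
  rewrite er_EZ er_E_subset; last by rewrite !finset.subUset !edge_im_upper.
  rewrite (cards_setUD (vert_im s :|: vert_im t)) (cards_setUD (edge_im s :|: edge_im t)).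
  rewrite !cards_setUD !exprD card_vert_im // card_edge_im //; ring.
apply: (@le_trans _ _ (\sum_(s : {ffun J -> 'I_n} | injectiveb s) p ^+ #|J| * q ^+ #|F| * (C1 * C2))).
  apply: ler_sum => s si; rewrite ler_wpM2l //.
  apply: (@le_trans _ _ (\sum_(t : {ffun J -> 'I_n} | injectiveb t && overlap (vert_im t) (vert_im s))
     p ^+ #|vert_im t :\: vert_im s| * q ^+ #|edge_im t :\: edge_im s| * C2)).
    apply: ler_sum => t /andP[ti _]; rewrite ler_wpM2l //.
    have := @extension_sum (vert_im s :|: vert_im t) (edge_im s :|: edge_im t) n0 (@edge_imU_vert s t).
    move=> /le_trans; apply; rewrite ler_wpM2r // lerXn2r ?nnegrE // ler_nat ltnS.
    by rewrite cardsU !card_vert_im // leq_subr.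
  rewrite -mulr_suml ler_wpM2r // /C1.
  rewrite -[X in X.+1%:R](card_vert_im si).
  apply: extension_sum => // ij; exact: edge_im_vert.
apply: (le_trans (sum_injective_le _)); first exact: mulr_ge0.
rewrite le_eqVlt; apply/orP; left; apply/eqP; rewrite /C1 /C2; field; exact: lt0r_neq0.
Qed.

Definition copies E : R := #|embeddings E|%:R.

Lemma copiesE E : copies E = \sum_(s : {ffun J -> 'I_n} | injectiveb s) (edge_im s \subset E)%:R.
Proof.
rewrite /copies -sumr_const (sum_embeddingsT E (fun=> 1)).
by apply: eq_bigr => s _; rewrite mulr1.
Qed.

Lemma er_copies : er_E q copies = #|[set s : {ffun J -> 'I_n} | injectiveb s]%SET|%:R * q ^+ #|F|.
Proof.
transitivity (er_E q (fun E : {set 'I_n * 'I_n} =>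
    \sum_(s : {ffun J -> 'I_n} | injectiveb s) (edge_im s \subset E)%:R)).
  by apply: eq_er_E => E _; rewrite copiesE.
rewrite er_E_sum mulr_natl -sumr_const; apply: eq_big => [s|s si]; first by rewrite inE.
by rewrite er_E_subset ?edge_im_upper // card_edge_im.
Qed.

Lemma er_copies_le : er_E q copies <= n%:R ^+ #|J| * q ^+ #|F|.
Proof.
case/andP: q01 => q0 q1; rewrite er_copies ler_wpM2r ?exprn_ge0 ?(ltW q0) //.
rewrite -natrX ler_nat; apply: (leq_trans (max_card _)).
by rewrite card_ffun card_ord.
Qed.

Lemma er_copies_ge : (#|J|.*2 <= n)%N -> 2^-1 ^+ #|J| * (n%:R ^+ #|J| * q ^+ #|F|) <= er_E q copies.
Proof.
move=> Jn; case/andP: q01 => q0 q1; rewrite er_copies mulrA ler_wpM2r ?exprn_ge0 ?(ltW q0) //.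
have -> : #|[set s : {ffun J -> 'I_n} | injectiveb s]%SET| = (n ^_ #|J|)%N.
  by rewrite card_inj_ffuns card_ord.
have h m : (m <= #|J|)%N -> (2^-1 * n%:R) ^+ m <= (n ^_ m)%:R :> R.
  (* Each factor n - m of the falling factorial is at least n / 2, as m < [#|J|] and 2 [#|J|] <=
     n. *)
  elim: m => [|m IH] mJ; first by rewrite ffactn0 expr0.
  rewrite exprSr ffactnSr natrM; apply: ler_pM; rewrite ?exprn_ge0 ?mulr_ge0 ?invr_ge0 //.
    exact/IH/ltnW.
  rewrite ler_pdivrMl // -natrM ler_nat; move: mJ Jn; rewrite -muln2; move: #|J| => l; clear; lia.
by rewrite -exprMn h.
Qed.

End Embeddings.

(** * Concentration of the number of embeddings *)

Section CopiesVariance.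
Variables (R : realType) (J : finType) (F : {set J * J}).
Hypothesis F_asym : forall uv, uv \in F -> (uv.1 != uv.2) && ((uv.2, uv.1) \notin F).
Variables (n : nat) (q : R).
Hypothesis q01 : 0 < q < 1.
Implicit Types (s t u : {ffun J -> 'I_n}) (E : {set 'I_n * 'I_n}).

(** Vertex-disjoint embeddings have disjoint edge sets and zero covariance; for the others the
    covariance is bounded by the joint probability. *)
Lemma er_copies_var :
  er_E q (fun E => (copies R F E - er_E q (@copies R J F n)) ^+ 2) <= er_E q (@pair_sum R J F n 1).
Proof.
case/andP: q01 => q0 q1.
set mu := er_E q (copies R F (n:=n)).
have muE : mu = \sum_(s : {ffun J -> 'I_n} | injectiveb s) q ^+ #|F|.
  rewrite /mu er_copies // mulr_natl -sumr_const; by apply: eq_big => [s|s _ //]; rewrite inE.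
have -> : er_E q (fun E : {set 'I_n * 'I_n} => (copies R F E - mu) ^+ 2) =
    er_E q (fun E => copies R F E ^+ 2) - mu ^+ 2.
  have -> : mu ^+ 2 = 2 * mu * mu - mu ^+ 2 by ring.
  rewrite {3}/mu -er_EZ -[mu ^+ 2 in RHS](@er_E_cst R n q) -!er_EB; apply: eq_er_E => E _; ring.
have -> : er_E q (fun E : {set 'I_n * 'I_n} => copies R F E ^+ 2) =
   \sum_(s : {ffun J -> 'I_n} | injectiveb s) \sum_(t : {ffun J -> 'I_n} | injectiveb t)
     q ^+ #|edge_im F s :|: edge_im F t|.
  transitivity (er_E q (fun E : {set 'I_n * 'I_n} => \sum_(s : {ffun J -> 'I_n} | injectiveb s)
     \sum_(t : {ffun J -> 'I_n} | injectiveb t) (edge_im F s :|: edge_im F t \subset E)%:R)).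
    apply: eq_er_E => E _; rewrite copiesE expr2 big_distrlr /=.
    by apply: eq_bigr => s _; apply: eq_bigr => t _; rewrite subset_natr.
  rewrite er_E_sum; apply: eq_bigr => s si; rewrite er_E_sum; apply: eq_bigr => t ti.
  by rewrite er_E_subset // finset.subUset !edge_im_upper.
have -> : er_E q (@pair_sum R J F n 1) =
   \sum_(s : {ffun J -> 'I_n} | injectiveb s)
   \sum_(t : {ffun J -> 'I_n} | injectiveb t && overlap (vert_im t) (vert_im s))
     q ^+ #|edge_im F s :|: edge_im F t|.
  transitivity (er_E q (fun E : {set 'I_n * 'I_n} => \sum_(s : {ffun J -> 'I_n} | injectiveb s)
     \sum_(t : {ffun J -> 'I_n} | injectiveb t && overlap (vert_im t) (vert_im s))
       (edge_im F s :|: edge_im F t \subset E)%:R)).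
    apply: eq_er_E => E _; rewrite /pair_sum sum_embeddingsT; apply: eq_bigr => s _.
    rewrite sum_embeddings mulr_sumr; apply: eq_bigr => t _.
    by rewrite mulrA subset_natr expr1n mulr1.
  rewrite er_E_sum; apply: eq_bigr => s si; rewrite er_E_sum; apply: eq_bigr => t /andP[ti _].
  by rewrite er_E_subset // finset.subUset !edge_im_upper.
rewrite muE expr2 big_distrlr /= -sumrB; apply: ler_sum => s si; rewrite -sumrB.
rewrite (bigID (fun t => overlap (vert_im t) (vert_im s))) /= [X in _ + X]big1 ?addr0; last first.
  move=> t /andP[ti nov]; rewrite -exprD cardsU (_ : edge_im F s :&: edge_im F t = finset.set0).
    by rewrite cards0 subn0 !card_edge_im // subrr.
  apply/setP => ij; rewrite !inE; apply/negbTE/negP => /andP[/edge_im_vert /andP[h _] /edge_im_vert /andP[h' _]].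
  by move/exists_inP: nov; apply; exists ij.1.
by apply: ler_sum => t _; rewrite lerBlDr lerDl mulr_ge0 ?exprn_ge0 ?(ltW q0).
Qed.

Lemma er_copies_chebyshev a : 0 < a ->
  er_E q (fun E => (a < `|copies R F E - er_E q (@copies R J F n)|)%R%:R) <=
  er_E q (@pair_sum R J F n 1) / a ^+ 2.
Proof.
move=> a0; apply: (@le_trans _ _ (er_E q (fun E => (a ^+ 2 < (copies R F E - er_E q (@copies R J F n)) ^+ 2)%R%:R))).
  apply: le_er_E => // E _; set z := copies R F E - _.
  by rewrite -(real_normK (num_real z)) ltr_pXn2r ?nnegrE // ltW.
apply: (le_trans (er_markov q01 _ _)); first by move=> E _; exact: sqr_ge0.
  by rewrite exprn_gt0.
by rewrite ler_wpM2r ?invr_ge0 ?sqr_ge0 //; exact: er_copies_var.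
Qed.

End CopiesVariance.

(** * Variance of the sampled count given the graph *)

Section ConditionalVariance.
Variables (R : realType) (J : finType) (F : {set J * J}) (n : nat) (p : R).
Hypothesis p01 : 0 < p < 1.
Implicit Types (s t u : {ffun J -> 'I_n}) (E : {set 'I_n * 'I_n}).
Local Notation pr := (fun _ : 'I_n => p).

Lemma pr_cst01 (i : 'I_n) : 0 <= pr i <= 1.
Proof. by case/andP: p01 => a b; rewrite !ltW. Qed.

Lemma moment_cst (A : {set 'I_n}) : moment pr A = p ^+ #|A|.
Proof. by rewrite /moment prodr_const. Qed.

Lemma bern_E_centeredM (A B : {set 'I_n}) :
  bern_E pr (fun x => centered pr A x * centered pr B x) = p ^+ #|A :|: B| - p ^+ #|A| * p ^+ #|B|.
Proof.
transitivity (bern_E pr (fun x => all_on R (A :|: B) x - moment pr B * all_on R A x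
   - moment pr A * all_on R B x + moment pr A * moment pr B)).
  by apply: eq_bern_E => x; rewrite all_onU /centered; ring.
rewrite bern_ED !bern_EB !bern_EZ bern_E_cst !bern_E_all_on !prodr_const !moment_cst; ring.
Qed.

Definition cond_var E : R := bern_E pr (fun x => Wsum pr (embeddings F E) (@vert_im J n) x ^+ 2).

(** For overlapping supports [#|A| + #|B|] exceeds [#|A :|: B|] by at least 1, so subtracting the
    product of the means costs at most the fraction [p] of the joint moment. *)
Lemma cond_var_bounds E :
  (1 - p) * pair_sum F p E <= cond_var E <= pair_sum F p E.
Proof.
case/andP: p01 => p0 p1.
rewrite /cond_var bern_E_Wsum2 /pair_sum; apply/andP; split.
  rewrite mulr_sumr; apply: ler_sum => s sE; rewrite mulr_sumr; apply: ler_sum => t /andP[tE ov].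
  rewrite bern_E_centeredM mulrBl mul1r lerB // -exprD -exprS; apply: ler_wiXn2l; rewrite ?(ltW p0) ?(ltW p1) //.
  rewrite -cardsUI -addn1 leq_add2l; apply/card_gt0P; case/exists_inP: ov => i it iS.
  by exists i; rewrite inE iS it.
apply: ler_sum => s sE; apply: ler_sum => t _.
by rewrite bern_E_centeredM lerBlDr lerDl mulr_ge0 ?exprn_ge0 ?(ltW p0).
Qed.

Section Restriction.
Variables (A : {set J}) (D : {set J * J}).
Hypothesis A0 : (0 < #|A|)%N.
Hypothesis DF : D \subset F.
Hypothesis DA : forall uv, uv \in D -> (uv.1 \in A) && (uv.2 \in A).

(** The subgraph receives a vertex type of its own, so that the general results on embeddings apply
    to it. *)
Definition subV : finType := {j : J | j \in A}.
Definition subE : {set subV * subV} := [set uv : subV * subV | (val uv.1, val uv.2) \in D].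
Definition restr s : {ffun subV -> 'I_n} := [ffun j => s (val j)].

Lemma card_subV : #|subV| = #|A|.
Proof. by rewrite card_sig; apply: eq_card => j; rewrite inE. Qed.

Lemma card_subE : #|subE| = #|D|.
Proof.
pose g (uv : subV * subV) := (val uv.1, val uv.2).
have ginj : injective g by move=> [a b] [c d] [/val_inj -> /val_inj ->].
rewrite -(card_imset (mem subE) ginj); apply: eq_card => uv.
apply/imsetP/idP => [[w + ->]|uvD]; first by rewrite inE.
have /andP[h1 h2] := DA uvD.
exists (Sub uv.1 h1, Sub uv.2 h2); last by rewrite /g /=; case: uv uvD {h1 h2}.
by rewrite inE /=; case: uv uvD {h1 h2}.
Qed.

Lemma restr_embeddings E s : s \in embeddings F E -> restr s \in embeddings subE E.
Proof.
rewrite !inE => /andP[/injectiveP si /fintype.subsetP sE]; apply/andP; split.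
  by apply/injectiveP => a b; rewrite !ffunE => /si /val_inj.
apply/fintype.subsetP => _ /imsetP[uv + ->]; rewrite inE => /(fintype.subsetP DF) h.
by apply: sE; rewrite !ffunE; apply/imsetP; exists (val uv.1, val uv.2).
Qed.

Lemma restr_union_card s t : injectiveb s -> injectiveb t -> restr t == restr s ->
  overlap (vert_im t) (vert_im s) && (#|vert_im s :|: vert_im t| <= #|J|.*2 - #|A|)%N.
Proof.
move=> si ti /eqP rst.
have st j : j \in A -> t j = s j.
  by move=> jA; have /ffunP/(_ (Sub j jA)) := rst; rewrite !ffunE SubK.
apply/andP; split.
  case/card_gt0P: A0 => j jA; apply/exists_inP; exists (t j); first exact: imset_f.
  by rewrite st // imset_f.
rewrite cards_setUD card_vert_im //.
have : (#|vert_im t :\: vert_im s| <= #|~: A|)%N.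
  apply: (@leq_trans #|[set t j | j in ~: A]%SET|); last exact: leq_imset_card.
  apply: subset_leq_card; apply/fintype.subsetP => i; rewrite inE => /andP[iS /imsetP[j _ ij]].
  rewrite ij; apply: imset_f; rewrite inE; apply: contra iS => jA.
  by rewrite ij st // imset_f.
rewrite -(cardsC A) -addnn; move: #|A| #|~: A| #|_ :\: _| => a b c; clear; lia.
Qed.

(* Cauchy-Schwarz over the fibres of the restriction of embeddings to the subgraph [(A, D)]. *)
Lemma copies_restr E :
  copies R F E ^+ 2 * p ^+ (#|J|.*2 - #|A|) <= copies R subE E * pair_sum F p E.
Proof.
case/andP: p01 => p0 p1.
set Y := embeddings subE E; set S := embeddings F E.
pose cnt y : R := \sum_(s in S | restr s == y) 1.
have N1 : copies R F E = \sum_(y in Y) cnt y.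
  rewrite /copies -sumr_const (partition_big restr (mem Y)) //= => s; exact: restr_embeddings.
have N2 : \sum_(y in Y) cnt y ^+ 2 = \sum_(s in S) cnt (restr s).
  rewrite [RHS](partition_big restr (mem Y)) /=; last by move=> s; exact: restr_embeddings.
  apply: eq_bigr => y _; rewrite expr2 {1}/cnt mulr_suml; apply: eq_bigr => s /andP[_ /eqP ->].
  by rewrite mul1r.
have CS : (\sum_(y in Y) cnt y) ^+ 2 <= #|Y|%:R * \sum_(y in Y) cnt y ^+ 2.
  rewrite expr2 big_distrlr /=.
  apply: (@le_trans _ _ (\sum_(y in Y) \sum_(z in Y) (cnt y ^+ 2 + cnt z ^+ 2) / 2)).
    apply: ler_sum => y _; apply: ler_sum => z _; have := sqr_ge0 (cnt y - cnt z); lra.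
  rewrite le_eqVlt; apply/orP; left; apply/eqP.
  have key y : \sum_(z in Y) (cnt y ^+ 2 + cnt z ^+ 2) / 2 =
      (#|Y|%:R * cnt y ^+ 2 + \sum_(z in Y) cnt z ^+ 2) / 2.
    by rewrite -mulr_suml big_split /= sumr_const mulr_natl.
  rewrite (eq_bigr _ (fun y _ => key y)) -mulr_suml big_split /= sumr_const -mulr_sumr -[X in _ + X]mulr_natl.
  by field.
rewrite N1; apply: (@le_trans _ _ (#|Y|%:R * (\sum_(y in Y) cnt y ^+ 2) * p ^+ (#|J|.*2 - #|A|))).
  by rewrite ler_wpM2r ?exprn_ge0 // ltW.
rewrite /copies -/Y -mulrA ler_wpM2l // N2 mulr_suml; apply: ler_sum => s sS.
rewrite /cnt mulr_suml [leLHS]big_mkcond [leRHS]big_mkcond; apply: ler_sum => t _.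
case: (boolP (t \in S)) => //= tS; case: (boolP (restr t == restr s)) => rts.
  have si : injectiveb s by move: sS; rewrite inE => /andP[].
  have ti : injectiveb t by move: tS; rewrite inE => /andP[].
  have /andP[-> cst] := restr_union_card si ti rts.
  by rewrite mul1r; apply: ler_wiXn2l; rewrite ?(ltW p0) ?(ltW p1).
by case: ifP; rewrite ?exprn_ge0 // ltW.
Qed.

End Restriction.
End ConditionalVariance.

(** * The statistics as sums over embeddings *)

Section Bridge.
Variables (R : realType) (k : nat) (e : rel 'I_k) (n : nat).
Local Notation F := (edgesH e).
Implicit Types (E : {set 'I_n * 'I_n}) (X : {ffun 'I_n -> bool}) (s : {ffun 'I_k -> 'I_n}).

Lemma edgesH_asym uv : uv \in F -> (uv.1 != uv.2) && ((uv.2, uv.1) \notin F).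
Proof.
rewrite !inE /= => /andP[_ lt]; apply/andP; split; first by apply: contraTneq lt => ->; rewrite ltnn.
by rewrite [(_ < uv.1)%N]ltnNge (ltnW lt) andbF.
Qed.

Lemma MHE E s : E \subset upper n -> MH R e E s = (edge_im F s \subset E)%:R.
Proof.
move=> EU; rewrite /MH; case: (boolP (edge_im F s \subset E)) => [/fintype.subsetP h|].
  by rewrite big1 // => uv uvF; rewrite adjE // h //; apply/imsetP; exists uv.
case/fintype.subsetPn => _ /imsetP[uv uvF ->] nE.
by rewrite (bigD1 uv) //= adjE // (negbTE nE) mul0r.
Qed.

Lemma XsE X s : Xs R X s = all_on R (vert_im s) X.
Proof.
rewrite /Xs all_onE; case: (boolP [forall i in vert_im s, X i]) => [/forall_inP h|].
  by rewrite big1 // => u _; rewrite h // imset_f.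
rewrite negb_forall_in => /exists_inP[_ /imsetP[u _ ->] /negbTE nX].
by rewrite (bigD1 u) //= nX mul0r.
Qed.

Local Notation alpha := ((#|autH e|%:R)^-1 : R).

Lemma aut_gt0 : 0 < alpha.
Proof.
rewrite invr_gt0 ltr0n; apply/card_gt0P; exists 1%g; rewrite inE.
by apply/forallP => u; apply/forallP => v; rewrite !perm1.
Qed.

Lemma NcountE E : E \subset upper n -> Ncount R e E = alpha * copies R F E.
Proof.
move=> EU; rewrite /Ncount copiesE; congr (_ * _); apply: eq_bigr => s _; exact: MHE.
Qed.

Lemma TcountE E X : E \subset upper n ->
  Tcount R e E X = alpha * \sum_(s in embeddings F E) all_on R (vert_im s) X.
Proof.
move=> EU; rewrite /Tcount sum_embeddingsT; congr (_ * _); apply: eq_bigr => s _.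
by rewrite MHE // XsE.
Qed.

Variable p : R.
Hypothesis p01 : 0 < p < 1.
Local Notation pr := (fun _ : 'I_n => p).
Local Notation W E := (Wsum pr (embeddings F E) (@vert_im 'I_k n)).

Lemma Wsum_copies E X :
  W E X = \sum_(s in embeddings F E) all_on R (vert_im s) X - p ^+ k * copies R F E.
Proof.
rewrite /Wsum /centered sumrB; congr (_ - _); rewrite /copies mulr_natr -sumr_const.
apply: eq_bigr => s; rewrite inE => /andP[si _].
by rewrite moment_cst card_vert_im // card_ord.
Qed.

Lemma Tcount_centered E X : E \subset upper n ->
  Tcount R e E X - p ^+ k * Ncount R e E = alpha * W E X.
Proof. by move=> EU; rewrite TcountE // NcountE // Wsum_copies; ring. Qed.

Lemma sigma2E E : E \subset upper n -> sigma2 p e E = alpha ^+ 2 * cond_var F p E.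
Proof.
move=> EU; rewrite /sigma2.
set t : R := p ^+ k * Ncount R e E.
have TW X : Tcount R e E X = alpha * W E X + t by rewrite -Tcount_centered // subrK.
have W0 : bern_E pr (W E) = 0.
  by rewrite /Wsum bern_E_sum big1 // => s _; rewrite bern_E_centered.
rewrite -![condE p _]/(bern_E pr _).
have -> : bern_E pr (fun X => Tcount R e E X) = t.
  transitivity (bern_E pr (fun X => alpha * W E X + t)); first exact: eq_bern_E.
  by rewrite bern_ED bern_EZ W0 bern_E_cst mulr0 add0r.
transitivity (bern_E pr (fun X => alpha ^+ 2 * W E X ^+ 2 + (2 * t * alpha) * W E X + t ^+ 2) - t ^+ 2).
  by congr (_ - _); apply: eq_bern_E => X; rewrite TW; ring.
by rewrite bern_ED bern_E_cst bern_ED !bern_EZ W0 /cond_var; ring.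
Qed.

(** The automorphism factor cancels. When the conditional variance is 0, both quotients are 0
    because x / 0 = 0. *)
Lemma ZstatE E X : E \subset upper n -> Zstat p e E X = W E X / Num.sqrt (cond_var F p E).
Proof.
move=> EU; rewrite /Zstat Tcount_centered // sigma2E // sqrtrM ?sqr_ge0 //.
rewrite sqrtr_sqr ger0_norm ?(ltW aut_gt0) //.
by rewrite -mulf_div divff ?mul1r // gt_eqF // aut_gt0.
Qed.

Lemma cond_var_ge0 E : 0 <= cond_var F p E.
Proof. apply: bern_E_ge0; [exact: (@pr_cst01 R n p p01)|by move=> X; exact: sqr_ge0]. Qed.

(** The uncentred count is nonnegative; this one-sided bound excludes a normal limit in the sparse
    regime. *)
Lemma Wsum_ge E X : - (p ^+ k * copies R F E) <= W E X.
Proof.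
rewrite Wsum_copies lerBrDr addNr; apply: sumr_ge0 => s _.
by case/andP: (all_on_01 R (vert_im s) X).
Qed.

Lemma consistency_ratioE E X : E \subset upper n -> 0 < copies R F E ->
  Nhat p e E X / Ncount R e E - 1 = W E X / (p ^+ k * copies R F E).
Proof.
move=> EU c0; have p0 : p != 0 by rewrite gt_eqF //; case/andP: p01.
have a0 : alpha != 0 by rewrite gt_eqF // aut_gt0.
have cn0 : copies R F E != 0 by rewrite gt_eqF.
have TW : Tcount R e E X = alpha * W E X + p ^+ k * Ncount R e E by rewrite -Tcount_centered // subrK.
rewrite /Nhat TW NcountE //.
set a : R := alpha in a0 *; set w := W E X; set c := copies R F E in cn0 *.
have pk0 : p ^+ k != 0 by rewrite expf_neq0.
move: (p ^+ k) pk0 => pk pk0.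
by field; rewrite pk0 a0 cn0.
Qed.

End Bridge.

(** * Maximal density and subgraph weights *)

Section Density.
Variables (R : realType) (k : nat) (e : rel 'I_k).
Local Notation F := (edgesH e).
Local Notation m := (m_density R e).

Definition subgraph (J : finType) (G : {set J * J}) (A : {set J}) (D : {set J * J}) : Prop :=
  [/\ (0 < #|A|)%N, D \subset G & forall uv, uv \in D -> (uv.1 \in A) && (uv.2 \in A)].

Definition subgraphb (J : finType) (G : {set J * J}) : pred ({set J} * {set J * J}) :=
  fun VE => [&& (0 < #|VE.1|)%N, VE.2 \subset G &
     [forall uv in VE.2, (uv.1 \in VE.1) && (uv.2 \in VE.1)]].

Lemma subgraphP (J : finType) (G : {set J * J}) VE : reflect (subgraph G VE.1 VE.2) (subgraphb G VE).
Proof.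
apply: (iffP and3P) => [[h1 h2 /forall_inP h3]|[h1 h2 h3]]; split => //.
by apply/forall_inP.
Qed.

Variable q : R.
Hypothesis q01 : 0 < q < 1.
Local Notation rho := (q `^ m).

Lemma rho_gt0 : 0 < rho.
Proof. by rewrite powR_gt0; case/andP: q01. Qed.

Lemma m_density_ge0 : 0 <= m.
Proof. by rewrite /m_density; apply: bigmax_ge_id. Qed.

Lemma rho_le1 : rho <= 1.
Proof.
by case/andP: q01 => q0 q1; rewrite -(powRr0 q) ger_powR ?m_density_ge0 // q0 ltW.
Qed.

Lemma rho_density (A : {set 'I_k}) (D : {set 'I_k * 'I_k}) : subgraph F A D -> rho ^+ #|A| <= q ^+ #|D|.
Proof.
case/andP: q01 => q0 q1 sg; have A0 : (0 < #|A|)%N by case: sg.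
have : #|D|%:R / #|A|%:R <= m.
  rewrite /m_density.
  apply: (@le_bigmax_cond _ R _ 0 (A, D) (subgraphb F)
    (fun VE : {set 'I_k} * {set 'I_k * 'I_k} => #|VE.2|%:R / #|VE.1|%:R)).
  exact/subgraphP.
rewrite ler_pdivrMr ?ltr0n // => h.
by rewrite -!powR_mulrn ?powR_ge0 ?(ltW q0) // -powRrM ger_powR // q0 ltW.
Qed.

Lemma densest_subgraph : (0 < k)%N -> exists A D, subgraph F A D /\ rho ^+ #|A| = q ^+ #|D|.
Proof.
case/andP: q01 => q0 q1 k0.
pose f (VE : {set 'I_k} * {set 'I_k * 'I_k}) : R := #|VE.2|%:R / #|VE.1|%:R.
pose v0 : 'I_k := Ordinal k0.
have P0 : subgraphb F ([set v0]%SET, finset.set0).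
  by apply/subgraphP; split; rewrite ?cards1 ?finset.sub0set // => uv; rewrite inE.
have mE := @bigmax_eq_arg _ R _ 0 _ (subgraphb F) f P0 _.
have {}mE : m = f [arg max_(VE > ([set v0]%SET, finset.set0) | subgraphb F VE) f VE]%O.
  by rewrite -mE // => VE _; rewrite divr_ge0.
move: mE; case: arg_maxP => //= -[A D] /subgraphP sg _ mE; exists A, D; split => //.
have A0 : (0 < #|A|)%N by case: sg.
by rewrite mE /f /= -!powR_mulrn ?powR_ge0 ?(ltW q0) // -powRrM divfK // pnatr_eq0 -lt0n.
Qed.

(** Since x [rho] >= 1, its power [#|A|] is at least x [rho] itself. It is used with x = n p and
    with x = n, and [dens] is a premise so that [G] can be H or a subgraph. *)
Lemma lambda_le_subgraph (J : finType) (G : {set J * J}) (x : R) :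
  (forall A D, subgraph G A D -> rho ^+ #|A| <= q ^+ #|D|) ->
  0 <= x -> 1 <= x * rho ->
  forall (A : {set J}) (D : {set J * J}), subgraph G A D -> x * rho <= x ^+ #|A| * q ^+ #|D|.
Proof.
move=> dens x0 l1 A D sg; have A0 : (0 < #|A|)%N by case: sg.
apply: (@le_trans _ _ ((x * rho) ^+ #|A|)); first by rewrite ler_eXnr.
by rewrite exprMn ler_wpM2l ?exprn_ge0 // dens.
Qed.

(** A subgraph of a subgraph of H is again a subgraph of H. *)
Lemma rho_density_sub (A : {set 'I_k}) (D : {set 'I_k * 'I_k}) : subgraph F A D ->
  forall (A' : {set subV A}) (D' : {set subV A * subV A}), subgraph (subE A D) A' D' ->
  rho ^+ #|A'| <= q ^+ #|D'|.
Proof.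
move=> [A0 DF DA] A' D' [A'0 D'D D'A].
pose g (uv : subV A * subV A) := (val uv.1, val uv.2).
have ginj : injective g by move=> [a b] [c d] [/val_inj -> /val_inj ->].
rewrite -(card_imset (mem A') val_inj) -(card_imset (mem D') ginj).
apply: rho_density; split.
- by rewrite card_imset //; exact: val_inj.
- apply/fintype.subsetP => _ /imsetP[uv /(fintype.subsetP D'D) + ->].
  by rewrite inE => /(fintype.subsetP DF).
- by move=> _ /imsetP[uv /D'A /andP[h1 h2] ->]; rewrite /g /= !imset_f.
Qed.

End Density.

(** * The regime n p q^m -> +oo *)

Section DenseRegime.
Variables (R : realType) (k : nat) (e : rel 'I_k) (n : nat) (p q : R).
Local Notation F := (edgesH e).
Local Notation rho := (q `^ m_density R e).
Local Notation lam := (n%:R * p * rho).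
Local Notation pr := (fun _ : 'I_n => p).
Local Notation W E := (Wsum pr (embeddings F E) (@vert_im 'I_k n)).
Hypothesis k0 : (0 < k)%N.
Hypothesis q01 : 0 < q < 1.
Hypothesis p20 : 0 < p <= 1 / 20.
Hypothesis kn : (k.*2 <= n)%N.
Implicit Types (E : {set 'I_n * 'I_n}).

Lemma samp_ratio01 : 0 < p < 1.
Proof. by case/andP: p20 => a b; rewrite a /=; lra. Qed.

Lemma vertices_gt0 : (0 < n)%N.
Proof. by apply: leq_trans kn; rewrite double_gt0. Qed.

Let p01 := samp_ratio01.
Let n0 := vertices_gt0.
Let nR0 : 0 < n%:R :> R. Proof. by rewrite ltr0n. Qed.
Let asym := @edgesH_asym k e.

Definition psi1 : R := n%:R ^+ k * q ^+ #|F|.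

Lemma psi1_gt0 : 0 < psi1.
Proof. by case/andP: q01 => q0 _; rewrite mulr_gt0 ?exprn_gt0. Qed.

Lemma psi_psi1 : psi F n p q = p ^+ k * psi1.
Proof. by rewrite /psi /psi1 card_ord exprMn; ring. Qed.

Definition Cpair : R := k.+1%:R ^+ k.
(** Half the constant of [er_copies_ge]: falling below [cfew * psi1] forces a deviation of at least
    that size from the mean. *)
Definition cfew : R := 2^-1 ^+ k.+1.
Definition Cfew : R := Cpair / cfew ^+ 2.
Definition Ctriple : R := ((k + k).+1)%:R ^+ k * k.+1%:R ^+ k.

Lemma cfew_gt0 : 0 < cfew. Proof. by rewrite exprn_gt0 // invr_gt0. Qed.
Lemma Cpair_gt0 : 0 < Cpair. Proof. by rewrite exprn_gt0. Qed.
Lemma Ctriple_gt0 : 0 < Ctriple. Proof. by rewrite mulr_gt0 ?exprn_gt0. Qed.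

(** Chebyshev's inequality, the variance being bounded by [er_pair_sum] at [p] = 1, where n [rho] is
    an admissible lower bound for all subgraph weights. *)
Lemma few_copies : 1 <= n%:R * rho ->
  er_E q (fun E => (copies R F E < cfew * psi1)%R%:R) <= Cfew / (n%:R * rho).
Proof.
move=> nr1; have nr0 : 0 < n%:R * rho by lra.
have a0 : 0 < cfew * psi1 by rewrite mulr_gt0 ?cfew_gt0 ?psi1_gt0.
have EN : 2 * (cfew * psi1) <= er_E q (@copies R 'I_k F n).
  have := @er_copies_ge R 'I_k F asym n q q01; rewrite card_ord => /(_ kn).
  by apply: le_trans; rewrite /cfew /psi1 exprS !mulrA divff ?mul1r ?pnatr_eq0.
apply: (@le_trans _ _ (er_E q (fun E => (cfew * psi1 < `|copies R F E - er_E q (@copies R 'I_k F n)|)%R%:R))).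
  apply: le_er_E => // E _; case: (ltP (copies R F E)) => // h.
  case: (ltP (cfew * psi1)) => // h'; move: h'; rewrite ler_norml; lra.
apply: (le_trans (er_copies_chebyshev asym n q01 a0)).
rewrite ler_pdivrMr ?exprn_gt0 //.
have := @er_pair_sum R 'I_k F asym n 1 q (n%:R * rho) ltr01 q01 nr0.
rewrite mulr1 card_ord => /(_ _ n0) h; apply: (le_trans (h _)).
  move=> A D h1 h2 h3.
  apply: (lambda_le_subgraph (q := q) (e := e) (G := F)) => //; first exact: rho_density.
rewrite /psi mulr1 card_ord -/psi1 /Cfew /Cpair le_eqVlt; apply/orP; left; apply/eqP.
have := cfew_gt0; have rr : rho != 0 by rewrite gt_eqF // rho_gt0.
by move=> c0; field; rewrite rr !gt_eqF.
Qed.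

Lemma minimal_subgraph : exists A D, subgraph F A D /\
  forall A' D', subgraph F A' D' -> (n%:R * p) ^+ #|A| * q ^+ #|D| <= (n%:R * p) ^+ #|A'| * q ^+ #|D'|.
Proof.
have [A0 [D0 [sg0 _]]] := densest_subgraph e q01 k0.
have P0 : subgraphb F (A0, D0) by apply/subgraphP.
pose f (VE : {set 'I_k} * {set 'I_k * 'I_k}) : R := (n%:R * p) ^+ #|VE.1| * q ^+ #|VE.2|.
have [[A D] /subgraphP sg mn] := @arg_minP _ R _ (A0, D0) (subgraphb F) f P0.
by exists A, D; split => // A' D' sg'; apply: (mn (A', D')); apply/subgraphP.
Qed.

Lemma lam_le : lam <= n%:R * rho.
Proof.
case/andP: p01 => pp0 pp1; rewrite ler_wpM2r ?(ltW (rho_gt0 _ _)) //.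
by rewrite ler_piMr ?(ltW nR0) // ltW.
Qed.

Hypothesis lam1 : 1 <= lam.

Lemma few_copies_lam : er_E q (fun E => (copies R F E < cfew * psi1)%R%:R) <= Cfew / lam.
Proof.
have h := lam_le; apply: (le_trans (few_copies (le_trans lam1 h))).
have C0 : 0 <= Cfew by rewrite divr_ge0 ?exprn_ge0 // ?(ltW Cpair_gt0) // (ltW cfew_gt0).
have l0 : 0 < lam by apply: lt_le_trans lam1.
have m0 : 0 < n%:R * rho by apply: lt_le_trans h.
by rewrite ler_wpM2l // lef_pV2 ?posrE.
Qed.

(** 19/20 bounds 1 - p from below, [cfew] comes from the copies of H, and [eps] from Markov's
    inequality for the copies of the minimal subgraph. *)
Definition cvar (eps : R) : R := 19 / 20 * cfew ^+ 2 * eps.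
Definition Mwass (eps : R) : R := 24 * stein_lip R * Ctriple / (eps * Num.sqrt (cvar eps) ^+ 3).

Lemma stein_lip_ge0 : 0 <= stein_lip R.
Proof. by rewrite /stein_lip; have := gabs_ge0 R; lra. Qed.

Section GoodGraph.
Variables (eps : R) (A : {set 'I_k}) (D : {set 'I_k * 'I_k}) (E : {set 'I_n * 'I_n}).
Hypothesis eps0 : 0 < eps.
Hypothesis sgAD : subgraph F A D.
Local Notation P0 := ((n%:R * p) ^+ #|A| * q ^+ #|D|).
Hypothesis many : cfew * psi1 <= copies R F E.
Hypothesis fewK : copies R (subE A D) E <= (n%:R ^+ #|A| * q ^+ #|D|) / eps.

Lemma minimal_gt0 : 0 < P0.
Proof. by case/andP: q01 => q0 _; case/andP: p01 => pp0 _; rewrite mulr_gt0 ?exprn_gt0 ?mulr_gt0. Qed.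

Lemma cond_var_ge : cvar eps * (psi F n p q ^+ 2 / P0) <= cond_var F p E.
Proof.
case/andP: (p01) => pp0 pp1; case/andP: (q01) => q0 q1; case: sgAD => A0 DF DA.
have Ak : (#|A| <= k.*2)%N.
  by apply: (leq_trans (max_card _)); rewrite card_ord -addnn leq_addr.
have Y0 : 0 < n%:R ^+ #|A| * q ^+ #|D| by rewrite mulr_gt0 ?exprn_gt0.
have := copies_restr p01 A0 DF E; rewrite card_ord => rs.
have PS0 : 0 <= pair_sum F p E by apply: sumr_ge0 => s _; apply: sumr_ge0 => t _; rewrite exprn_ge0 ?ltW.
(* Many copies of H spread over few copies of the subgraph force a large [pair_sum], by
   [copies_restr]. *)
have h1 : copies R F E ^+ 2 * p ^+ (k.*2 - #|A|) <= n%:R ^+ #|A| * q ^+ #|D| / eps * pair_sum F p E.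
  by apply: (le_trans rs); rewrite ler_wpM2r.
have h2 : (cfew * psi1) ^+ 2 * p ^+ (k.*2 - #|A|) <= n%:R ^+ #|A| * q ^+ #|D| / eps * pair_sum F p E.
  apply: le_trans h1; rewrite ler_wpM2r ?exprn_ge0 ?(ltW pp0) //.
  have cp0 : 0 <= cfew * psi1 by rewrite ltW // mulr_gt0 ?cfew_gt0 ?psi1_gt0.
  by apply: lerXn2r; rewrite ?nnegrE // (le_trans cp0 many).
have h3 : cfew ^+ 2 * eps * (psi F n p q ^+ 2 / P0) <= pair_sum F p E.
  rewrite -(ler_pM2l Y0) -[leRHS](divfK (lt0r_neq0 eps0)).
  rewrite [leRHS](_ : _ = eps * (n%:R ^+ #|A| * q ^+ #|D| / eps * pair_sum F p E)); last by ring.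
  apply: le_trans (ler_wpM2l (ltW eps0) h2).
  rewrite psi_psi1 -addnn.
  have -> : p ^+ (k + k - #|A|) = p ^+ k ^+ 2 / p ^+ #|A|.
    have pA0 : p ^+ #|A| != 0 by rewrite expf_neq0 // lt0r_neq0.
    by rewrite -[LHS](mulfK pA0) -exprD subnK ?addnn // -exprM muln2.
  rewrite [(n%:R * p) ^+ _]exprMn le_eqVlt; apply/orP; left; apply/eqP.
  have := exprn_gt0 #|A| pp0; have := exprn_gt0 #|A| nR0; have := exprn_gt0 #|D| q0.
  move: (p ^+ k) psi1 (p ^+ #|A|) (n%:R ^+ #|A|) (q ^+ #|D|) => u1 u2 u3 u4 u5 h5 h4 h3.
  by field; rewrite !lt0r_neq0.
have /andP[cv _] := cond_var_bounds F p01 E.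
apply: le_trans cv.
rewrite [leLHS](_ : _ = 19 / 20 * (cfew ^+ 2 * eps * (psi F n p q ^+ 2 / P0))); last by rewrite /cvar; ring.
apply: (@le_trans _ _ (19 / 20 * pair_sum F p E)); first by rewrite ler_wpM2l.
by rewrite ler_wpM2r //; case/andP: p20 => *; lra.
Qed.

Hypothesis fewT : triple_sum pr (embeddings F E) (@vert_im 'I_k n) <=
  Ctriple * (psi F n p q ^+ 3 / P0 ^+ 2) / eps.
Hypothesis lamP0 : lam <= P0.

(** The cube of the lower bound r T / S for the deviation cancels T^3 from the triple sum, and S^3 /
    P0^2 = 1 / S with S^2 = P0; finally P0 >= [lam]. *)
Lemma good_wass (h : R -> R) : (forall x y, `|h x - h y| <= `|x - y|) ->
  `|bern_E pr (fun X => h (W E X / Num.sqrt (cond_var F p E))) - gmean h| <= Mwass eps / Num.sqrt lam.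
Proof.
move=> h_lip; case/andP: (p01) => pp0 pp1.
have psi0 : 0 < psi F n p q by rewrite psi_psi1 mulr_gt0 ?exprn_gt0 ?psi1_gt0.
have P00 := minimal_gt0; have fewT' := fewT; set T := psi F n p q in psi0 fewT' *.
have c0 : 0 < cvar eps by rewrite /cvar !mulr_gt0 ?exprn_gt0 ?cfew_gt0.
set S := Num.sqrt P0; set r := Num.sqrt (cvar eps).
have S0 : 0 < S by rewrite sqrtr_gt0.
have r0 : 0 < r by rewrite sqrtr_gt0.
have SS : S ^+ 2 = P0 by rewrite sqr_sqrtr // ltW.
have rTS0 : 0 < r * T / S by rewrite divr_gt0 // mulr_gt0.
have sd_ge : r * T / S <= Num.sqrt (cond_var F p E).
  have <- : Num.sqrt ((r * T / S) ^+ 2) = r * T / S.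
    by rewrite sqrtr_sqr gtr0_norm.
  apply: ler_wsqrtr; apply: le_trans cond_var_ge.
  rewrite exprMn exprVn SS exprMn sqr_sqrtr ?(ltW c0) // -/T.
  by rewrite mulrA.
set sd := Num.sqrt (cond_var F p E) in sd_ge *.
have sd0 : 0 < sd by apply: lt_le_trans sd_ge.
apply: (le_trans (stein_wass (@pr_cst01 R n p p01) h_lip sd0)).
have L0 : 0 <= 24 * stein_lip R by rewrite mulr_ge0 ?stein_lip_ge0.
apply: (@le_trans _ _ (24 * stein_lip R * (Ctriple * (T ^+ 3 / P0 ^+ 2) / eps) / (r * T / S) ^+ 3)).
  apply: ler_pM.
  - rewrite mulr_ge0 //; apply: sumr_ge0 => s _; apply: sumr_ge0 => t _; apply: sumr_ge0 => u _.
    exact: (moment_ge0 (@pr_cst01 R n p p01)).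
  - by rewrite invr_ge0 exprn_ge0 // sqrtr_ge0.
  - by rewrite ler_wpM2l.
  - rewrite lef_pV2 ?posrE ?exprn_gt0 //.
    by apply: lerXn2r; rewrite ?nnegrE ?(ltW rTS0) ?(ltW sd0).
apply: (@le_trans _ _ (Mwass eps / S)).
  rewrite /Mwass -/r -SS le_eqVlt; apply/orP; left; apply/eqP; field.
  by rewrite !lt0r_neq0.
have M0 : 0 <= Mwass eps.
  by rewrite /Mwass divr_ge0 ?mulr_ge0 ?stein_lip_ge0 ?(ltW Ctriple_gt0) ?exprn_ge0 ?(ltW r0) ?(ltW eps0).
have l0 : 0 < lam by apply: lt_le_trans lam1.
rewrite ler_wpM2l // lef_pV2 ?posrE ?sqrtr_gt0 //.
exact: ler_wsqrtr.
Qed.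

End GoodGraph.

(** The exceptional set is chosen before [h], so the bound survives the supremum over test
    functions. Its two Markov events have probability at most [eps] each. *)
Lemma wass_good_event (eps : R) : 0 < eps -> exists bad : pred {set 'I_n * 'I_n},
  er_E q (fun E => (bad E)%:R) <= 2 * eps + Cfew / lam /\
  forall E, E \subset upper n -> ~~ bad E ->
  forall h : R -> R, (forall x y, `|h x - h y| <= `|x - y|) ->
  `|condE p (fun X => h (Zstat p e E X)) - gmean h| <= Mwass eps / Num.sqrt lam.
Proof.
move=> eps0; case/andP: (p01) => pp0 pp1; case/andP: (q01) => q0 q1.
have [A [D [sg mn]]] := minimal_subgraph.
have P00 := minimal_gt0 A D.
set P0 := (n%:R * p) ^+ #|A| * q ^+ #|D| in P00 mn.
have lamP0 : lam <= P0.
  apply: (lambda_le_subgraph (q := q) (e := e) (G := F)) => //; first exact: rho_density.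
  by rewrite mulr_ge0 ?(ltW nR0) ?(ltW pp0).
pose Y : R := n%:R ^+ #|A| * q ^+ #|D|.
have Y0 : 0 < Y by rewrite mulr_gt0 ?exprn_gt0.
have psi0 : 0 < psi F n p q by rewrite psi_psi1 mulr_gt0 ?exprn_gt0 ?psi1_gt0.
pose Q : R := Ctriple * (psi F n p q ^+ 3 / P0 ^+ 2).
have Q0 : 0 < Q by rewrite mulr_gt0 ?Ctriple_gt0 ?divr_gt0 ?exprn_gt0.
pose S3 E := triple_sum pr (embeddings F E) (@vert_im 'I_k n).
pose b1 E := (copies R F E < cfew * psi1)%R.
pose b2 E := (Y / eps < copies R (subE A D) E)%R.
pose b3 E := (Q / eps < S3 E)%R.
exists (fun E => [|| b1 E, b2 E | b3 E]); split.
  apply: (@le_trans _ _ (er_E q (fun E => (b1 E)%:R + (b2 E)%:R + (b3 E)%:R))).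
    apply: le_er_E => // E _; rewrite -!natrD ler_nat.
    by case: (b1 E); case: (b2 E); case: (b3 E).
  rewrite !er_ED; have h1 := few_copies_lam; rewrite -/b1 in h1.
  have h2 : er_E q (fun E => (b2 E)%:R) <= eps.
    apply: (le_trans (er_markov q01 (f := fun E => copies R (subE A D) E) _ _)) => //.
      by rewrite divr_gt0.
    rewrite ler_pdivrMr ?divr_gt0 // mulrC divfK ?lt0r_neq0 //.
    have [_ _ DA] := sg.
    have := er_copies_le (F := subE A D) _ n q01; rewrite card_subV card_subE //; apply.
    by move=> uv; rewrite !inE => uvD; have [_ /fintype.subsetP DF _] := sg;
      have := asym (DF _ uvD); rewrite /= => /andP[ne nF]; rewrite (contraNneq _ ne) ?(contra (DF _) nF) // => ->.
  have h3 : er_E q (fun E => (b3 E)%:R) <= eps.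
    apply: (le_trans (er_markov q01 (f := S3) _ _)).
    - move=> E _; apply: sumr_ge0 => s _; apply: sumr_ge0 => t _; apply: sumr_ge0 => u _.
      exact: (moment_ge0 (@pr_cst01 R n p p01)).
    - by rewrite divr_gt0.
    rewrite ler_pdivrMr ?divr_gt0 // mulrC divfK ?lt0r_neq0 //.
    have := @er_triple_sum R 'I_k F asym n p q P0 pp0 q01 P00 _ n0; rewrite card_ord; apply.
    by move=> A' D' c1 c2 c3; apply: mn.
  by move: h1 h2 h3; set x1 := er_E _ _; set x2 := er_E _ _; set x3 := er_E _ _; lra.
move=> E EU; rewrite !negb_or -!leNgt => /and3P[g1 g2 g3] h h_lip.
have := @good_wass eps A D E eps0 sg g1 g2 g3 lamP0 h h_lip.
apply: le_trans; rewrite le_eqVlt; apply/orP; left; apply/eqP; congr (`|_ - _|).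
by rewrite -[condE p _]/(bern_E pr _); apply: eq_bern_E => X; rewrite ZstatE.
Qed.

End DenseRegime.

Lemma std_normal_cdf_01 (R : realType) (x : R) : 0 <= std_normal_cdf x <= 1.
Proof.
apply/andP; split; first by rewrite /std_normal_cdf fine_ge0 // measure_ge0.
by rewrite -lee_fin /std_normal_cdf gauss_fin //; exact: probability_le1.
Qed.

Lemma dist_unit (R : realType) (a b : R) : 0 <= a <= 1 -> 0 <= b <= 1 -> `|a - b| <= 1.
Proof. by rewrite ler_norml; lra. Qed.

Lemma Mwass_ge0 (R : realType) (k : nat) (eps : R) : 0 < eps -> 0 <= Mwass k eps.
Proof.
move=> eps0; rewrite /Mwass divr_ge0 ?mulr_ge0 ?stein_lip_ge0 ?(ltW (Ctriple_gt0 _ _)) //.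
exact: ltW.
Qed.

(** * Probability bounds at fixed n in the dense regime *)

Section DenseConsequences.
Variables (R : realType) (k : nat) (e : rel 'I_k) (n : nat) (p q : R).
Local Notation F := (edgesH e).
Local Notation rho := (q `^ m_density R e).
Local Notation lam := (n%:R * p * rho).
Local Notation pr := (fun _ : 'I_n => p).
Hypothesis k0 : (0 < k)%N.
Hypothesis q01 : 0 < q < 1.
Hypothesis p20 : 0 < p <= 1 / 20.
Hypothesis kn : (k.*2 <= n)%N.
Hypothesis lam1 : 1 <= lam.
Implicit Types (E : {set 'I_n * 'I_n}).
Let p01 := samp_ratio01 p20.

Lemma condE_01 (A : pred {ffun 'I_n -> bool}) : 0 <= condE p (fun X => (A X)%:R) <= 1.
Proof.
rewrite -[condE p _]/(bern_E pr _); have pr01 := @pr_cst01 R n p p01.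
apply/andP; split; first exact: bern_E_ge0.
by rewrite -[leRHS](bern_E1 pr); apply: le_bern_E => // X; case: (A X).
Qed.

(** Conditional Chebyshev: on graphs with many embeddings the random normalisation is replaced by a
    deterministic lower bound before the conditional variance is averaged. The remaining graphs are
    charged probability 1. *)
Lemma consistency_bound (eps : R) : 0 < eps ->
  Prob q p (fun w : {set 'I_n * 'I_n} * {ffun 'I_n -> bool} =>
     eps < `|Nhat p e w.1 w.2 / Ncount R e w.1 - 1|) <=
  (Cfew R k + Cpair R k / (eps * cfew R k) ^+ 2) / lam.
Proof.
move=> eps0; case/andP: (p01) => pp0 pp1; case/andP: (q01) => q0 q1.
have pr01 := @pr_cst01 R n p p01.
have n0 := vertices_gt0 k0 kn.
have lam0 : 0 < lam by apply: lt_le_trans lam1.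
have ps0 : 0 < psi1 e n q := psi1_gt0 e k0 q01 kn.
have cf0 := cfew_gt0 R k.
pose a : R := eps * (p ^+ k * (cfew R k * psi1 e n q)).
have a0 : 0 < a by apply: mulr_gt0 => //; apply: mulr_gt0; [exact: exprn_gt0|exact: mulr_gt0].
rewrite er_E_prob /=.
apply: (@le_trans _ _ (er_E q (fun E => (copies R F E < cfew R k * psi1 e n q)%R%:R + a ^- 2 * pair_sum F p E))).
  apply: le_er_E => // E EU.
  have PS0 : 0 <= pair_sum F p E.
    by apply: sumr_ge0 => s _; apply: sumr_ge0 => t _; rewrite exprn_ge0 ?ltW.
  case: ltP => h.
    have /andP[_ le1] := condE_01 (fun X => eps < `|Nhat p e E X / Ncount R e E - 1|).
    by apply: (le_trans le1); rewrite lerDl mulr_ge0 // invr_ge0 sqr_ge0.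
  rewrite add0r; have c0 : 0 < copies R F E by apply: lt_le_trans h; rewrite mulr_gt0.
  have /andP[_ cv] := cond_var_bounds F p01 E.
  apply: le_trans (ler_wpM2l _ cv); last by rewrite invr_ge0 sqr_ge0.
  rewrite -[condE p _]/(bern_E pr _) /cond_var -bern_EZ; apply: le_bern_E => // X.
  rewrite consistency_ratioE // normrM normfV [`|p ^+ k * _|]gtr0_norm ?mulr_gt0 ?exprn_gt0 //.
  rewrite ltr_pdivlMr ?mulr_gt0 ?exprn_gt0 //.
  case: ltP => h'; last by rewrite mulr_ge0 ?invr_ge0 ?sqr_ge0.
  rewrite mulrC ler_pdivlMr ?exprn_gt0 // mul1r -[leRHS]real_normK ?num_real //.
  apply: lerXn2r; rewrite ?nnegrE ?(ltW a0) //; apply: le_trans (ltW h').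
  by rewrite /a ler_wpM2l ?(ltW eps0) // ler_wpM2l ?exprn_ge0 ?(ltW pp0).
rewrite er_ED er_EZ [leRHS]mulrDl; apply: lerD; first exact: few_copies_lam.
have := @er_pair_sum R 'I_k F (@edgesH_asym k e) n p q lam pp0 q01 lam0 _ n0.
rewrite card_ord => bnd.
apply: (le_trans (ler_wpM2l _ (bnd _))).
- by rewrite invr_ge0 sqr_ge0.
- move=> A D h1 h2 h3.
  apply: (lambda_le_subgraph (q := q) (e := e) (G := F)) => //; first exact: rho_density.
  by rewrite mulr_ge0 ?(ltW pp0).
rewrite psi_psi1 /a /Cpair le_eqVlt; apply/orP; left; apply/eqP.
have := exprn_gt0 k pp0; move: lam0 cf0 ps0.
move: (psi1 e n q) (cfew R k) (lam) (p ^+ k) (k.+1%:R ^+ k) => u1 u2 u3 u4 u5 h1 h2 h3 h4.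
by field; rewrite !lt0r_neq0.
Qed.

Lemma cdf_bound (eps d x : R) : 0 < eps -> 0 < d ->
  `|Prob q p (fun w : {set 'I_n * 'I_n} * {ffun 'I_n -> bool} => Zstat p e w.1 w.2 <= x) - std_normal_cdf x|
  <= 2 * eps + Cfew R k / lam + (d + Mwass k eps / Num.sqrt lam / d).
Proof.
move=> eps0 d0; have pr01 := @pr_cst01 R n p p01.
have lam0 : 0 < lam by apply: lt_le_trans lam1.
have [bad [er_bad good]] := wass_good_event k0 q01 p20 kn lam1 eps0.
set w := Mwass k eps / Num.sqrt lam in good *.
rewrite er_E_prob /= -[X in _ - X](@er_E_cst R n q) -er_EB.
set G := fun E => _.
apply: (@le_trans _ _ (er_E q (fun E => `|G E|))).
  by rewrite /er_E; apply: norm_bern_E; exact: edge_pr01.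
apply: (@le_trans _ _ (er_E q (fun E => (bad E)%:R + (d + w / d)))); last first.
  by rewrite er_ED er_E_cst lerD2r.
apply: le_er_E => // E EU; rewrite /G.
case: (boolP (bad E)) => bE.
  have w0 : 0 <= w.
    by rewrite divr_ge0 // Mwass_ge0.
  have wd0 : 0 <= w / d by rewrite divr_ge0 // ltW.
  apply: (@le_trans _ _ 1); last by rewrite lerDl addr_ge0 // ltW.
  by apply: dist_unit; [exact: condE_01|exact: std_normal_cdf_01].
rewrite add0r; apply: (cdf_of_wass (pr := pr)) => //.
by move=> h h_lip; exact: good.
Qed.

Lemma wass_tail_bound (eps Mv : R) : 0 < eps -> Mwass k eps <= Mv ->
  Prob q p (fun w : {set 'I_n * 'I_n} * {ffun 'I_n -> bool} =>
     ((Mv * (Num.sqrt lam)^-1)%:E < abse (wass_cond p (Zstat p e w.1)))%E) <=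
  2 * eps + Cfew R k / lam.
Proof.
move=> eps0 MM; have [bad [er_bad good]] := wass_good_event k0 q01 p20 kn lam1 eps0.
rewrite er_E_prob /=; apply: le_trans er_bad; apply: le_er_E => // E EU.
case: (boolP (bad E)) => bE.
  by have /andP[_ ->] := condE_01 (fun=> ((Mv * (Num.sqrt lam)^-1)%:E < abse (wass_cond p (Zstat p e E)))%E).
suff -> : ((Mv * (Num.sqrt lam)^-1)%:E < abse (wass_cond p (Zstat p e E)))%E = false.
  by rewrite -[condE p _]/(bern_E pr _) bern_E_cst.
apply/negbTE; rewrite -leNgt.
have ub : (wass_cond p (Zstat p e E) <= (Mv * (Num.sqrt lam)^-1)%:E)%E.
  apply: ge_ereal_sup => _ [h [h_lip ->]].
  rewrite gmeanE // -EFinB lee_fin; apply: (le_trans (good E EU bE h h_lip)).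
  by rewrite ler_wpM2r // invr_ge0 sqrtr_ge0.
(* The test function 0 shows that the supremum is nonnegative. *)
rewrite gee0_abs //.
apply: le_trans (ereal_sup_ubound _); last by exists (fun=> 0); split => // x y; rewrite subrr normr0.
exact: abse_ge0.
Qed.

End DenseConsequences.

(** * Limits in the dense regime *)

Section DenseLimits.
Variables (R : realType) (k : nat) (e : rel 'I_k) (q p : nat -> R).
Hypothesis k0 : (0 < k)%N.
Hypothesis q01 : forall n, 0 < q n < 1.
Hypothesis p20 : forall n, 0 < p n <= 1 / 20.
Hypothesis lam_infty : lambda e q p @ \oo --> +oo.
Local Notation lam := (lambda e q p).

Lemma lam_eventually (K : R) : \forall n \near \oo, (k.*2 <= n)%N /\ Num.max 1 K <= lam n.
Proof.
near=> n; split; first by near: n; exact: nbhs_infty_ge.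
by near: n; move/cvgryPge : lam_infty; apply.
Unshelve. all: by end_near. Qed.

Lemma lam_div (C eps : R) : 0 < eps -> \forall n \near \oo,
  [/\ (k.*2 <= n)%N, 1 <= lam n & C / lam n <= eps].
Proof.
move=> eps0; near=> n.
have [kn] : (k.*2 <= n)%N /\ Num.max 1 (C / eps) <= lam n by near: n; exact: lam_eventually.
rewrite ge_max => /andP[l1 lC]; split => //.
by rewrite ler_pdivrMr ?(lt_le_trans ltr01 l1) // mulrC -ler_pdivrMr.
Unshelve. all: by end_near. Qed.

Lemma lam_sqrt_div (C eps : R) : 0 <= C -> 0 < eps -> \forall n \near \oo, C / Num.sqrt (lam n) <= eps.
Proof.
move=> C0 eps0; have := lam_div (C ^+ 2) (exprn_gt0 2 eps0); apply: filterS => n [_ l1 h].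
have l0 : 0 < lam n by apply: lt_le_trans l1.
rewrite -(ler_pXn2r (n := 2)) ?nnegrE ?(ltW eps0) //; last by rewrite divr_ge0 ?sqrtr_ge0.
by rewrite exprMn exprVn sqr_sqrtr // ltW.
Qed.

Lemma dense_consistent : cvg_in_prob q p (fun n E X => Nhat (p n) e E X / Ncount R e E) 1.
Proof.
move=> eps eps0; apply/cvgrPdist_le => d d0.
have := lam_div (Cfew R k + Cpair R k / (eps * cfew R k) ^+ 2) d0.
apply: filterS => n [kn l1 h]; rewrite sub0r normrN ger0_norm.
  by apply: le_trans h; apply: consistency_bound.
rewrite er_E_prob; apply: er_E_ge0 => // E _.
by case/andP: (@condE_01 R n (p n) (p20 n) (fun X => eps < `|Nhat (p n) e E X / Ncount R e E - 1|)).
Qed.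

(** Both the exceptional probability d / 8, counted twice, and the smoothing scale d / 4 are fixed
    before n grows; [cdf_bound] then splits into four terms of at most d / 4. *)
Lemma dense_clt : cvg_in_dist_std_normal q p (fun n E X => Zstat (p n) e E X).
Proof.
move=> x; apply/cvgrPdist_le => d d0.
have d4 : 0 < d / 4 by rewrite divr_gt0.
have d8 : 0 < d / 8 by rewrite divr_gt0.
have M0 : 0 <= Mwass k (d / 8).
  exact: Mwass_ge0.
have Md0 : 0 <= Mwass k (d / 8) / (d / 4) by rewrite divr_ge0 // ltW.
near=> n.
have [kn l1 h1] : [/\ (k.*2 <= n)%N, 1 <= lam n & Cfew R k / lam n <= d / 4] by near: n; exact: lam_div.
have h2 : Mwass k (d / 8) / (d / 4) / Num.sqrt (lam n) <= d / 4 by near: n; exact: lam_sqrt_div.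
have hb := cdf_bound k0 (q01 n) (p20 n) kn l1 x d8 d4.
rewrite distrC; apply: (le_trans hb).
rewrite -/(lam n) [_ / Num.sqrt _ / _]mulrAC; lra.
Unshelve. all: by end_near. Qed.

Lemma dense_wass : stoch_bigO q p (fun n E => wass_cond (p n) (Zstat (p n) e E))
  (fun n => (Num.sqrt (lam n))^-1).
Proof.
move=> eps eps0; have e4 : 0 < eps / 4 by rewrite divr_gt0.
have e2 : 0 < eps / 2 by rewrite divr_gt0.
exists (Mwass k (eps / 4)).
have := lam_div (Cfew R k) e2; apply: filterS => n [kn l1 h].
apply: (le_trans (wass_tail_bound k0 (q01 n) (p20 n) kn l1 e4 (lexx _))).
rewrite -/(lam n); lra.
Qed.

End DenseLimits.

(** * The regime n p q^m = O(1) *)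

Lemma expR_le_1B (R : realType) (x : R) : 0 <= x <= 1 / 2 -> expR (- (2 * x)) <= 1 - x.
Proof.
move=> /andP[x0 x1]; have y0 : 0 < 1 - x by lra.
rewrite expRN -[leRHS]invrK lef_pV2 ?posrE ?expR_gt0 ?invr_gt0 //.
apply: le_trans (expR_ge1Dx _); rewrite -[leLHS]mul1r ler_pdivrMr //.
by nra.
Qed.

Lemma le_Prob (R : realType) (n : nat) (q p : R) (A B : pred ({set 'I_n * 'I_n} * {ffun 'I_n -> bool})) :
  0 < q < 1 -> 0 < p < 1 ->
  (forall (E : {set 'I_n * 'I_n}) X, E \subset upper n -> A (E, X) -> B (E, X)) -> Prob q p A <= Prob q p B.
Proof.
move=> q01 p01 AB; rewrite !er_E_prob; apply: le_er_E => // E EU.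
rewrite -![condE p _]/(bern_E _ _); apply: le_bern_E => [i|X]; first exact: (@pr_cst01 R n p p01).
by rewrite ler_nat; have := AB E X EU; case: (A (E, X)) => // ->.
Qed.

Lemma onem_indic_01 (R : realType) (b : bool) (t : R) : 0 <= t <= 1 -> 0 <= 1 - b%:R * t <= 1.
Proof. by case: b; rewrite ?mul1r ?mul0r; lra. Qed.

Section SparseRegime.
Variables (R : realType) (k : nat) (e : rel 'I_k) (n : nat) (p q : R).
Local Notation F := (edgesH e).
Local Notation rho := (q `^ m_density R e).
Local Notation lam := (n%:R * p * rho).
Local Notation pr := (fun _ : 'I_n => p).
Hypothesis k0 : (0 < k)%N.
Hypothesis q01 : 0 < q < 1.
Hypothesis p20 : 0 < p <= 1 / 20.
Hypothesis n0 : (0 < n)%N.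
Variables (A : {set 'I_k}) (D : {set 'I_k * 'I_k}).
Hypothesis sgAD : subgraph F A D.
Hypothesis densest : rho ^+ #|A| = q ^+ #|D|.
Implicit Types (E : {set 'I_n * 'I_n}) (X : {ffun 'I_n -> bool}).
Local Notation K := (subE A D).
Local Notation emb_K := {ffun subV A -> 'I_n}.
Let p01 := samp_ratio01 p20.

Lemma subE_asym uv : uv \in K -> (uv.1 != uv.2) && ((uv.2, uv.1) \notin K).
Proof.
case: sgAD => _ /fintype.subsetP DF _; rewrite !inE => /DF uvF.
have /andP[ne nF] := edgesH_asym uvF; apply/andP; split.
  by apply: contraNneq ne => ->.
by apply: contra nF; exact: DF.
Qed.

Lemma card_KE : #|K| = #|D|.
Proof. by apply: card_subE; case: sgAD. Qed.

(** At most [n ^ #|A|] factors occur, and [expR_le_1B] turns each into an exponential; this is where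
    1/2 is needed. *)
Lemma harris_copies (a : R) : 0 <= a <= 1 -> a * q ^+ #|D| <= 1 / 2 ->
  expR (- (2 * (a * q ^+ #|D|))) ^+ (n ^ #|A|) <=
  er_E q (fun E => \prod_(y : emb_K | injectiveb y) (1 - a * (edge_im K y \subset E)%:R)).
Proof.
move=> /andP[a0 a1] aq; case/andP: (q01) => q0 q1.
have aq0 : 0 <= a * q ^+ #|D| by rewrite mulr_ge0 // exprn_ge0 // ltW.
have aq1 : 0 <= 1 - a * q ^+ #|D| by lra.
pose r : seq emb_K := seq.filter (fun y : emb_K => injectiveb y) (index_enum _).
have a01 (y : emb_K) : 0 <= a <= 1 by rewrite a0 a1.
have := @bern_harris R _ (edge_pr q) (edge_pr01 q01) _ r (fun=> a) (@edge_im _ K n) a01.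
rewrite big_filter => h.
apply: (@le_trans _ _ (\prod_(y : emb_K | injectiveb y) (1 - a * \prod_(i in edge_im K y) edge_pr q i))).
  rewrite (eq_bigr (fun=> 1 - a * q ^+ #|D|)) /=; last first.
    move=> y yi; congr (1 - a * _).
    rewrite -card_KE -(card_edge_im subE_asym yi) -prodr_const; apply: eq_bigr => ij ijE.
    by rewrite /edge_pr (fintype.subsetP (edge_im_upper subE_asym yi) _ ijE).
  rewrite prodr_const; set m := #|_|.
  have mn : (m <= n ^ #|A|)%N.
    by apply: (leq_trans (max_card _)); rewrite card_ffun card_ord card_subV.
  have e1 : expR (- (2 * (a * q ^+ #|D|))) <= 1 by rewrite expR_le1 oppr_le0 mulr_ge0.
  apply: (le_trans (ler_wiXn2l (expR_ge0 _) e1 mn)).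
  by apply: lerXn2r; rewrite ?nnegrE ?expR_ge0 ?expR_le_1B ?aq0.
apply: (le_trans h); rewrite le_eqVlt; apply/orP; left; apply/eqP.
rewrite /er_E; apply: eq_bern_E => x; rewrite big_filter; apply: eq_bigr => y _.
rewrite all_onE; congr (1 - a * _%:R); congr nat_of_bool.
by apply/forall_inP/fintype.subsetP => h' ij /h'; rewrite inE.
Qed.

(** For the densest subgraph, n^|A| q^|D| is exactly (n [rho])^|A|. *)
Lemma harris_rhs (a : R) : expR (- (2 * (a * q ^+ #|D|))) ^+ (n ^ #|A|) = expR (- (2 * (a * (n%:R * rho) ^+ #|A|))).
Proof.
by rewrite -expRM_natl -mulr_natl natrX exprMn densest; congr expR; ring.
Qed.

Lemma restr_in E s : s \in embeddings F E ->
  injectiveb (restr A s) && (edge_im K (restr A s) \subset E).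
Proof. by case: sgAD => _ DF _ sE; have := @restr_embeddings _ F n A D DF E s sE; rewrite inE. Qed.

(** An embedding of H restricts to one of the subgraph and so annihilates a factor of the
    product. *)
Lemma copies0_ge E : \prod_(y : emb_K | injectiveb y) (1 - 1 * (edge_im K y \subset E)%:R) <=
  (embeddings F E == finset.set0)%:R :> R.
Proof.
have [_|/finset.set0Pn[s sE]] := eqVneq; last first.
  have /andP[si sub] := restr_in sE.
  by rewrite (bigD1 (restr A s)) //= sub mulr1 subrr mul0r.
by apply: prodr_ile1 => y _; case: (_ \subset _); rewrite mul1r ?subrr ?subr0 ?lexx ?ler01.
Qed.

Lemma Tcount0_ge E : E \subset upper n ->
  \prod_(y : emb_K | injectiveb y) (1 - p ^+ #|A| * (edge_im K y \subset E)%:R) <=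
  condE p (fun X => (Tcount R e E X == 0)%:R).
Proof.
move=> EU; rewrite -[condE p _]/(bern_E pr _).
have pr01 := @pr_cst01 R n p p01.
pose r : seq emb_K := seq.filter (fun y : emb_K => injectiveb y) (index_enum _).
have M01 (y : emb_K) : 0 <= ((edge_im K y \subset E)%:R : R) <= 1.
  by case: (_ \subset _); rewrite ?lexx ?ler01.
have h := @bern_harris R _ pr pr01 _ r (fun y => (edge_im K y \subset E)%:R) (@vert_im _ n) M01.
rewrite big_filter in h.
apply: (@le_trans _ _ (\prod_(y : emb_K | injectiveb y) (1 - (edge_im K y \subset E)%:R * \prod_(i in vert_im y) p))).
  rewrite le_eqVlt; apply/orP; left; apply/eqP; apply: eq_bigr => y yi.
  by rewrite prodr_const card_vert_im // card_subV mulrC.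
apply: (le_trans h); apply: le_bern_E => // X; rewrite big_filter.
have fac01 (y : emb_K) : 0 <= 1 - (edge_im K y \subset E)%:R * all_on R (vert_im y) X <= 1.
  by apply: onem_indic_01; exact: all_on_01.
have [_|T0] := eqVneq; first by apply: prodr_ile1 => y _; exact: fac01.
have : [exists s in embeddings F E, [forall i in vert_im s, X i]].
  apply: contraNT T0 => /exists_inPn nos; rewrite TcountE // big1 ?mulr0 // => s sE.
  by rewrite all_onE (negbTE (nos s sE)).
case/exists_inP => s sE /forall_inP sX; have /andP[si sub] := restr_in sE.
rewrite (bigD1 (restr A s)) //= sub mul1r all_onE.
have -> : [forall i in vert_im (restr A s), X i] = true.
  by apply/forall_inP => _ /imsetP[j _ ->]; rewrite ffunE; apply: sX; exact: imset_f.
by rewrite subrr mul0r.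
Qed.

(** Harris is used twice: [Tcount0_ge] averages over the sampled vertices of a fixed graph, and
    [harris_copies] then averages over graphs with weight [p ^+ #|A|]. *)
Lemma prob_Tcount0 : expR (- (2 * lam ^+ #|A|)) <=
  Prob q p (fun w : {set 'I_n * 'I_n} * {ffun 'I_n -> bool} => Tcount R e w.1 w.2 == 0).
Proof.
case/andP: (p01) => pp0 pp1; case/andP: (q01) => q0 q1; have [A0 _ _] := sgAD.
rewrite er_E_prob; apply: le_trans (le_er_E q01 (fun E => @Tcount0_ge E)).
have -> : lam ^+ #|A| = p ^+ #|A| * (n%:R * rho) ^+ #|A| by rewrite -exprMn; congr (_ ^+ _); ring.
rewrite -harris_rhs; apply: harris_copies.
  by rewrite exprn_ge0 ?exprn_ile1 // ltW.
have h1 : p ^+ #|A| <= p by rewrite ler_iXnr // ltW.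
have h2 : 0 <= q ^+ #|D| <= 1 by rewrite exprn_ge0 ?exprn_ile1 // ltW.
case/andP: h2 => h2 h3; case/andP: p20 => _ h4.
apply: (@le_trans _ _ (p ^+ #|A|)); last lra.
by rewrite ler_piMr // exprn_ge0 // ltW.
Qed.

Lemma er_no_copies (K0 : R) : n%:R * rho <= K0 -> 2 * K0 <= n%:R ->
  expR (- (2 * (n%:R * rho) ^+ #|A|)) <= er_E q (fun E => (embeddings F E == finset.set0)%:R).
Proof.
move=> nK Kn; have [A0 _ _] := sgAD.
apply: le_trans (le_er_E q01 (fun E _ => @copies0_ge E)).
rewrite -[X in 2 * X]mul1r -harris_rhs; apply: harris_copies; first by rewrite ler01 lexx.
have nR0 : 0 < n%:R :> R by rewrite ltr0n.
have r0 := rho_gt0 e q01; have r1 := rho_le1 e q01.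
(* From n [rho] <= K0 and 2 K0 <= n follows [rho] <= 1/2, as [harris_copies] requires. *)
rewrite mul1r -densest; apply: (@le_trans _ _ rho); first by rewrite ler_iXnr // ltW.
by rewrite -(ler_pM2l nR0); lra.
Qed.

(** Without copies of H the centred sum is empty and Z = 0, so the distribution function jumps
    between [- eta] and 0 by at least the probability of that event. *)
Lemma zero_atom (K0 eta : R) : 0 < eta -> n%:R * rho <= K0 -> 2 * K0 <= n%:R ->
  expR (- (2 * (n%:R * rho) ^+ #|A|)) +
  Prob q p (fun w : {set 'I_n * 'I_n} * {ffun 'I_n -> bool} => Zstat p e w.1 w.2 <= - eta) <=
  Prob q p (fun w : {set 'I_n * 'I_n} * {ffun 'I_n -> bool} => Zstat p e w.1 w.2 <= 0).
Proof.
move=> eta0 nK Kn.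
apply: (@le_trans _ _ (er_E q (fun E => (embeddings F E == finset.set0)%:R +
    condE p (fun X => (Zstat p e E X <= - eta)%R%:R)))).
  by rewrite er_ED er_E_prob lerD2r; exact: (er_no_copies nK Kn).
rewrite er_E_prob; apply: le_er_E => // E EU; rewrite -![condE p _]/(bern_E pr _).
have pr01 := @pr_cst01 R n p p01.
have [E0|_] := eqVneq; last first.
  rewrite add0r; apply: le_bern_E => // X /=; rewrite ler_nat.
  by case: (lerP _ (- eta)) => // h; rewrite (_ : Zstat p e E X <= 0) //; apply: (le_trans h); rewrite oppr_le0 ltW.
have Z0 X : Zstat p e E X = 0 by rewrite ZstatE // /Wsum E0 big_set0 mul0r.
rewrite (@eq_bern_E _ _ _ _ (fun=> 0)) ?bern_E_cst ?addr0; last first.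
  by move=> X; rewrite Z0 lerNr oppr0 leNgt eta0.
rewrite (@eq_bern_E _ _ _ _ (fun=> 1)) ?bern_E_cst //.
by move=> X /=; rewrite Z0 lexx.
Qed.

(** The mean is at most n^|A| q^|D|, so exceeding twice this value is a deviation to which
    Chebyshev's inequality applies. *)
Lemma many_copies_K : 1 <= n%:R * rho ->
  er_E q (fun E => (2 * (n%:R ^+ #|A| * q ^+ #|D|) < copies R K E)%R%:R) <= Cpair R k / (n%:R * rho).
Proof.
move=> nr1; have nr0 : 0 < n%:R * rho by lra.
case/andP: (q01) => q0 q1; have nR0 : 0 < n%:R :> R by rewrite ltr0n.
set a := n%:R ^+ #|A| * q ^+ #|D|.
have a0 : 0 < a by rewrite mulr_gt0 ?exprn_gt0.
have EN : er_E q (@copies R _ K n) <= a.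
  by have := er_copies_le subE_asym n q01; rewrite card_subV card_KE.
apply: (@le_trans _ _ (er_E q (fun E => (a < `|copies R K E - er_E q (@copies R _ K n)|)%R%:R))).
  apply: le_er_E => // E _; case: (ltP (2 * a)) => // h.
  case: (ltP a) => // h'; move: h'; rewrite ler_norml; lra.
apply: (le_trans (er_copies_chebyshev subE_asym n q01 a0)).
rewrite ler_pdivrMr ?exprn_gt0 //.
have := @er_pair_sum R _ K subE_asym n 1 q (n%:R * rho) ltr01 q01 nr0.
rewrite mulr1 => /(_ _ n0) h; apply: (le_trans (h _)).
  move=> A' D' h1 h2 h3.
  by apply: (lambda_le_subgraph (q := q) (e := e) (G := K)) => //; exact: rho_density_sub.
rewrite /psi mulr1 card_subV card_KE -/a [leRHS]mulrAC -mulrA.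
apply: ler_wpM2r; first by rewrite divr_ge0 ?sqr_ge0 // ltW.
rewrite /Cpair -!natrX ler_nat.
have Ak : (#|A| <= k)%N by apply: (leq_trans (max_card _)); rewrite card_ord.
by apply: (@leq_trans (k.+1 ^ #|A|)%N); [rewrite leq_exp2r //; case: sgAD|rewrite leq_pexp2l].
Qed.

(** Z is at least -p^k N / sigma in terms of embeddings. By [copies_restr], (p^k N)^2 is at most
    p^|A| times the copies of the subgraph times [pair_sum]; this is at most 2 [lam]^|A| times
    [pair_sum], which is at most twice the variance. *)
Lemma Zstat_lower (C : R) E X : 1 <= C -> lam <= C -> E \subset upper n ->
  copies R K E <= 2 * (n%:R ^+ #|A| * q ^+ #|D|) -> - (2 * C ^+ k) <= Zstat p e E X.
Proof.
move=> C1 lC EU cK; case/andP: (p01) => pp0 pp1; case/andP: (q01) => q0 q1.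
case: (sgAD) => A0 DF DA.
have Ak : (#|A| <= k)%N by apply: (leq_trans (max_card _)); rewrite card_ord.
have lam0 : 0 <= lam by rewrite !mulr_ge0 ?(ltW pp0) ?(ltW (rho_gt0 e q01)).
have Ck1 : 1 <= C ^+ k by rewrite exprn_ege1.
have PS0 : 0 <= pair_sum F p E by apply: sumr_ge0 => s _; apply: sumr_ge0 => t _; rewrite exprn_ge0 ?ltW.
have := copies_restr p01 A0 DF E; rewrite card_ord => rs.
have lamA : lam ^+ #|A| <= C ^+ k.
  apply: (@le_trans _ _ (C ^+ #|A|)); first by apply: lerXn2r; rewrite ?nnegrE //; lra.
  exact: ler_weXn2l.
have sq : (p ^+ k * copies R F E) ^+ 2 <= (2 * C ^+ k) ^+ 2 * cond_var F p E.
  have -> : (p ^+ k * copies R F E) ^+ 2 = p ^+ #|A| * (copies R F E ^+ 2 * p ^+ (k.*2 - #|A|)).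
    rewrite mulrCA -exprD subnKC; last by rewrite -addnn (leq_trans Ak) // leq_addr.
    by rewrite exprMn -exprM muln2 mulrC.
  apply: (@le_trans _ _ (2 * C ^+ k * pair_sum F p E)).
    apply: (le_trans (ler_wpM2l (exprn_ge0 _ (ltW pp0)) rs)).
    rewrite mulrA ler_wpM2r //.
    apply: (le_trans (ler_wpM2l (exprn_ge0 _ (ltW pp0)) cK)).
    rewrite [leLHS](_ : _ = 2 * lam ^+ #|A|); first by rewrite ler_wpM2l.
    by rewrite !exprMn densest; ring.
  have /andP[cv _] := cond_var_bounds F p01 E.
  have cv2 : pair_sum F p E <= 2 * cond_var F p E.
    have : 1 / 2 * pair_sum F p E <= (1 - p) * pair_sum F p E.
      by rewrite ler_wpM2r //; case/andP: p20 => *; lra.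
    by move: cv; move: (pair_sum F p E) (cond_var F p E) => u1 u2; lra.
  have v0 := @cond_var_ge0 R k e n p p01 E.
  apply: (le_trans (ler_wpM2l _ cv2)); first by lra.
  rewrite mulrA ler_wpM2r // expr2.
  have : C ^+ k <= C ^+ k * C ^+ k by rewrite ler_peMr //; lra.
  by move: (C ^+ k) => u1; lra.
rewrite ZstatE //; set sd := Num.sqrt _.
have sd0 : 0 <= sd by exact: sqrtr_ge0.
have CC0 : 0 <= 2 * C ^+ k by lra.
have lin : p ^+ k * copies R F E <= 2 * C ^+ k * sd.
  rewrite -(ler_pXn2r (n := 2)) ?nnegrE ?mulr_ge0 ?exprn_ge0 ?(ltW pp0) //; last by lra.
  by rewrite [leRHS]exprMn sqr_sqrtr ?(@cond_var_ge0 R k e n p p01 E).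
(* If the deviation is 0, then Z = 0 by the convention for division by 0. *)
have := Wsum_ge e p E X; move: sd0; rewrite le_eqVlt => /predU1P[<-|sd0].
  by rewrite invr0 mulr0 => _; lra.
by move=> W0; rewrite ler_pdivlMr //; move: lin W0; rewrite mulNr; lra.
Qed.

Lemma lower_tail (C : R) : 1 <= C -> lam <= C -> 1 <= n%:R * rho ->
  Prob q p (fun w : {set 'I_n * 'I_n} * {ffun 'I_n -> bool} =>
    Zstat p e w.1 w.2 <= - (2 * C ^+ k) - 1) <= Cpair R k / (n%:R * rho).
Proof.
move=> C1 lC nr1; apply: le_trans (many_copies_K nr1).
rewrite er_E_prob; apply: le_er_E => // E EU.
case: ltP => cK; first by case/andP: (condE_01 p20 (fun X => Zstat p e E X <= - (2 * C ^+ k) - 1)).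
rewrite -[condE p _]/(bern_E pr _) (@eq_bern_E _ _ _ _ (fun=> 0)) ?bern_E_cst // => X /=.
case: (boolP (Zstat p e E X <= _)) => // h.
by have := le_trans (Zstat_lower X C1 lC EU cK) h; rewrite lerDl oppr_ge0 ler10.
Qed.

End SparseRegime.


(** * Failure of both limits in the sparse regime *)

Section SparseLimits.
Variables (R : realType) (k : nat) (e : rel 'I_k) (q p : nat -> R).
Hypothesis k0 : (0 < k)%N.
Hypothesis q01 : forall n, 0 < q n < 1.
Hypothesis p20 : forall n, 0 < p n <= 1 / 20.
Local Notation lam := (lambda e q p).
Local Notation rho n := (q n `^ m_density R e).
Variable C : R.
Hypothesis C1 : 1 <= C.
Hypothesis lam_bound : \forall n \near \oo, lam n <= C.

Lemma lam_ge0 n : 0 <= lam n.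
Proof.
by case/andP: (p20 n) => pp0 _; rewrite /lambda !mulr_ge0 ?(ltW pp0) ?(ltW (rho_gt0 e (q01 n))).
Qed.

(** The densest subgraph is obtained anew for every n; bounding its order by k makes the estimates
    uniform in n. *)
Lemma expR_pow_bound (x B : R) (a : nat) : 0 <= x -> x <= B -> 1 <= B -> (a <= k)%N ->
  expR (- (2 * B ^+ k)) <= expR (- (2 * x ^+ a)).
Proof.
move=> x0 xB B1 ak; rewrite ler_expR lerN2 ler_wpM2l //.
apply: (@le_trans _ _ (B ^+ a)); last exact: ler_weXn2l.
by apply: lerXn2r; rewrite ?nnegrE // (le_trans x0).
Qed.

Lemma card_le_k (A : {set 'I_k}) : (#|A| <= k)%N.
Proof. by apply: (leq_trans (max_card _)); rewrite card_ord. Qed.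

Lemma sparse_inconsistent : ~ cvg_in_prob q p (fun n E X => Nhat (p n) e E X / Ncount R e E) 1.
Proof.
have h2 : (0 : R) < 1 / 2 by rewrite divr_gt0.
move=> /(_ _ h2) cvg0.
have c0 : 0 < expR (- (2 * C ^+ k)) / 2 by rewrite divr_gt0 ?expR_gt0.
pose close := fun n : nat => is_true (
  `|0 - Prob (q n) (p n) (fun w : {set 'I_n * 'I_n} * {ffun 'I_n -> bool} => 1 / 2 < `|Nhat (p n) e w.1 w.2 / Ncount R e w.1 - 1|)|
  <= expR (- (2 * C ^+ k)) / 2).
have small : \forall n \near \oo, close n by move/cvgrPdist_le : cvg0 => /(_ _ c0).
near \oo => n.
have n0 : (0 < n)%N by near: n; exact: nbhs_infty_gt.
have lC : lam n <= C by near: n.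
have : close n by near: n.
rewrite /close sub0r normrN => /(le_trans (ler_norm _)); apply/negP; rewrite -ltNge.
have [A [D [sg den]]] := densest_subgraph e (q01 n) k0.
have T0 := prob_Tcount0 n (q01 n) (p20 n) sg den.
have T1 := le_trans (expR_pow_bound (lam_ge0 n) lC C1 (card_le_k A)) T0.
apply: (@lt_le_trans _ _ (expR (- (2 * C ^+ k)))).
  by rewrite ltr_pdivrMr // ltr_pMr ?expR_gt0 // ltr1n.
apply: (le_trans T1); apply: le_Prob => //; first exact: samp_ratio01.
(* When T = 0 the ratio is 0, also when N = 0 since 0 / 0 = 0, and its distance 1 to the limit
   exceeds 1/2. *)
move=> E X _ /= /eqP TE; rewrite /Nhat TE mulr0 mul0r sub0r normrN1.
by rewrite ltr_pdivrMr // mul1r ltr1n.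
Unshelve. all: by end_near. Qed.

(* If [n rho] is small the event of no copies of [H] gives [Z] an atom at 0; otherwise the densest
   subgraph has boundedly many sampled copies, so [Z >= -2 C ^ k] with high probability. *)
Lemma sparse_not_normal : ~ cvg_in_dist_std_normal q p (fun n E X => Zstat (p n) e E X).
Proof.
move=> clt.
(* A point strictly below the floor of Z given by [Zstat_lower], where the normal distribution
   function is still positive. *)
pose x0 : R := - (2 * C ^+ k) - 1.
have del0 := std_normal_cdf_gt0 x0; set del := std_normal_cdf x0 in del0.
have Cp0 := Cpair_gt0 R k.
(* Above this threshold the exceptional probability in [lower_tail] is at most [del / 4]. *)
pose K0 : R := Num.max 1 (4 * Cpair R k / del).
have K01 : 1 <= K0 by rewrite /K0 le_max lexx.
have K0d : 4 * Cpair R k / del <= K0 by rewrite /K0 le_max lexx orbT.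
pose c1 : R := expR (- (2 * K0 ^+ k)).
have c10 : 0 < c1 by exact: expR_gt0.
have eta0 : 0 < c1 / 2 by rewrite divr_gt0.
have c8 : 0 < c1 / 8 by rewrite divr_gt0.
have d2 : 0 < del / 2 by rewrite divr_gt0.
pose close := fun (x d : R) (n : nat) => is_true (
  `|std_normal_cdf x - Prob (q n) (p n) (fun w : {set 'I_n * 'I_n} * {ffun 'I_n -> bool} => Zstat (p n) e w.1 w.2 <= x)| <= d).
have small x d : 0 < d -> \forall n \near \oo, close x d n.
  by move=> d0; have /cvgrPdist_le/(_ _ d0) := clt x.
near \oo => n.
have n0 : (0 < n)%N by near: n; exact: nbhs_infty_gt.
have Kn : 2 * K0 <= n%:R by near: n; exact: nbhs_infty_ger.
have lC : lam n <= C by near: n.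
have [A [D [sg den]]] := densest_subgraph e (q01 n) k0.
(* The alternative is decided at a single large n, so n [rho] may oscillate between the two
   cases. *)
have [nK|nK] := leP (n%:R * rho n) K0.
  have E2 : close 0 (c1 / 8) n by near: n; exact: small.
  have E3 : close (- (c1 / 2)) (c1 / 8) n by near: n; exact: small.
  have at0 := zero_atom (q01 n) (p20 n) n0 sg den eta0 nK Kn.
  have nr0 : 0 <= n%:R * rho n by rewrite mulr_ge0 // ltW // (rho_gt0 e (q01 n)).
  have c1le := expR_pow_bound nr0 nK K01 (card_le_k A).
  (* The normal law puts at most [c1 / 2] between [- (c1 / 2)] and 0; with two errors of [c1 / 8]
     this falls short of the jump [c1]. *)
  have := std_normal_cdf_lip (- (c1 / 2)) (ltW eta0); rewrite addNr.
  rewrite -/c1 in c1le; 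
  move: E2 E3 at0 c1le c10; rewrite /close !ler_norml; clear.
  move: (Prob _ _ _) (Prob _ _ _) (expR _) (std_normal_cdf _) (std_normal_cdf _) => *; lra.
have E1 : close x0 (del / 2) n by near: n; exact: small.
have nr1 : 1 <= n%:R * rho n by rewrite ltW // (le_lt_trans K01).
have tail := lower_tail (q01 n) (p20 n) n0 sg den C1 lC nr1.
have nr0 : 0 < n%:R * rho n by rewrite (lt_le_trans ltr01).
have : Cpair R k / (n%:R * rho n) <= del / 4.
  rewrite ler_pdivrMr // mulrC -ler_pdivrMr ?divr_gt0 //.
  by rewrite invf_div mulrA [Cpair R k * 4]mulrC (le_trans K0d) // ltW.
(* The probability at [x0] would be at least [del / 2] by convergence, but is at most [del / 4]. *)
move: tail E1 del0; rewrite /close -/x0 -/del ler_norml; clear.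
move: (Prob _ _ _) (Cpair R k / _) del => *; lra.
Unshelve. all: by end_near. Qed.

End SparseLimits.

Unset Implicit Arguments.
Set Strict Implicit.

Theorem theorem2p14 (R : realType) (k : nat) (e : rel 'I_k) (q p : nat -> R) :
  (0 < k)%N -> symmetric e -> irreflexive e -> (forall u v, connect e u v) ->
  (forall n, 0 < q n < 1) -> (forall n, 0 < p n <= 1 / 20) ->
  ((lambda e q p @ \oo --> +oo) ->
     [/\ cvg_in_prob q p (fun n E X => Nhat (p n) e E X / Ncount R e E) 1,
         cvg_in_dist_std_normal q p (fun n E X => Zstat (p n) e E X) &
         stoch_bigO q p (fun n E => wass_cond (p n) (Zstat (p n) e E))
               (fun n => (Num.sqrt (lambda e q p n))^-1)])
  /\
  ((exists C : R, \forall n \near \oo, lambda e q p n <= C) ->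
     ~ cvg_in_prob q p (fun n E X => Nhat (p n) e E X / Ncount R e E) 1 /\
     ~ cvg_in_dist_std_normal q p (fun n E X => Zstat (p n) e E X)).
Proof.
move=> k0 _ _ _ q01 p20; split.
  by move=> lam_infty; split; [exact: dense_consistent|exact: dense_clt|exact: dense_wass].
move=> [C lamC].
(* Raising the bound to at least 1 makes its powers increase with the exponent. *)
have lamC1 : \forall n \near \oo, lambda e q p n <= Num.max 1 C.
  by apply: filterS lamC => n; rewrite le_max => ->; rewrite orbT.
have C1 : 1 <= Num.max 1 C by rewrite le_max lexx.
by split; [exact: (sparse_inconsistent k0 q01 p20 C1 lamC1)|exact: (sparse_not_normal k0 q01 p20 C1 lamC1)].
Qed.
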